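(* Let $m,n\ge1$, let $\alpha$ be an $n\times n$ matrix and $\vartheta_1$ an $n\times m$ matrix such that $$\alpha=\alpha^*,\quad \vartheta_1^*\alpha\vartheta_1=0,\quad \det\alpha\ne0,\quad \det(I_m\pm\vartheta_1^*\alpha^{-1}\vartheta_1)\ne0,\quad \vartheta_1^*\alpha^{-1}\vartheta_1\not\le0 .$$ Let $f(x)$, $x\ge0$, be the $m\times m$ matrix function determined by the triple $\{\alpha,\vartheta_1,0\}$ (see the context). There is no self-adjoint $m\times m$ matrix function $u(x,t)$ on the quarter-plane $x\ge0$, $t\ge0$ satisfying all of the following: (a) $u_t+3(uu_x+u_xu)-u_{xxx}=0$ on the quarter-plane; (b) $u$ is bounded on the quarter-plane, and the corresponding matrix functions $G$ and $F$ (defined in the context) are continuously differentiable there; (c) $u(x,0)=f(x)$ for $x\ge0$ and $u(0,t)=u_{xx}(0,t)=0$ for $t\ge0$; (d) the Weyl functions $M(t,z)$ of $u(\cdot,t)$ satisfy $\displaystyle\lim_{t\to\infty}M(t,z)=\frac{i\sqrt z-1}{i\sqrt z+1}I_m$ $(z\in\mathbb C_+)$.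
   Context: $\mathbb C_+=\{z:\Im z>0\}$; $I_k$ is the $k\times k$ identity matrix; for $z\in\mathbb C_+$ the branch of $\sqrt z$ is chosen with $\sqrt z\in\mathbb C_+$. $X\not\le0$ for a Hermitian matrix $X$ means that $X$ is not negative semidefinite. Function determined by a triple: given an $n\times n$ matrix $\alpha$ and $n\times m$ matrices $\vartheta_1,\vartheta_2$ with $\alpha-\alpha^*=\vartheta_1\vartheta_2^*-\vartheta_2\vartheta_1^*$ (an admissible triple), put for $x\ge0$ $$\begin{bmatrix}\Lambda_1(x)\\ \Lambda_2(x)\end{bmatrix}=e^{x\beta}\begin{bmatrix}\vartheta_1\\ \vartheta_2\end{bmatrix},\quad \beta=\begin{bmatrix}0&\alpha\\-I_n&0\end{bmatrix},\quad S(x)=I_n+\int_0^x\Lambda_2(y)\Lambda_2(y)^*dy .$$ The function determined by the triple is $$f(x)=2\big\{(\Lambda_2^*S^{-1}\Lambda_2)^2+\Lambda_1^*S^{-1}\Lambda_2+\Lambda_2^*S^{-1}\Lambda_1\big\}(x).$$ Here $\vartheta_2=0$. Put $$G=\begin{bmatrix}0&I_m\\ u-zI_m&0\end{bmatrix},\quad F=\begin{bmatrix}u_x&-2(u+2zI_m)\\ u_{xx}-2(u+2zI_m)(u-zI_m)&-u_x\end{bmatrix},\quad T=\frac1{\sqrt2}\begin{bmatrix} iI_m&I_m\\ iI_m&-I_m\end{bmatrix}.$$ Weyl function $M(t,z)$: let $\Psi(x,t,z)$ be the $2m\times 2m$ solution of $\Psi_x=G\Psi$, $\Psi(0,t,z)=I_{2m}$,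 and put $\widetilde\Psi(x,t,z)=(\Psi(x,t,0)T)^{-1}\Psi(x,t,z)T$. Let $\mathcal A(l,t,z)=\widetilde\Psi(l,t,\overline z)^*$ with $m\times m$ blocks $\mathcal A_{kj}$. For $z\in\mathbb C_+$, $l>0$ put $$M(l,t,z)=i\big(\mathcal A_{11}P_l+\mathcal A_{12}Q_l\big)\big(\mathcal A_{21}P_l+\mathcal A_{22}Q_l\big)^{-1},$$ where $P_l,Q_l$ are any $m\times m$ matrix functions meromorphic in $z\in\mathbb C_+$ with $P_l^*P_l+Q_l^*Q_l>0$, $P_l^*Q_l+Q_l^*P_l\ge0$. For bounded self-adjoint $u$ the limit $M(t,z)=\lim_{l\to\infty}M(l,t,z)$ exists and is independent of the choice of $P_l,Q_l$; it is the Weyl function at time $t$. (For $u\equiv0$ it equals $\frac{i\sqrt z-1}{i\sqrt z+1}I_m$.) *)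

(* Defs.v *)
From HB Require Import structures.
From mathcomp Require Import all_boot all_order all_algebra.
From mathcomp Require Import complex.
From mathcomp Require Import all_classical all_reals all_analysis.

Set Implicit Arguments.
Unset Strict Implicit.
Unset Printing Implicit Defensive.

Import Order.TTheory GRing.Theory Num.Theory.
Import numFieldNormedType.Exports.

Local Open Scope classical_set_scope.
Local Open Scope ring_scope.
Local Open Scope complex_scope.
Local Open Scope sesquilinear_scope.

(* The library puts the norm topology only on the copy [R[i]^o] of the complex
   numbers.  Transporting it to [R[i]] makes ['M[R[i]]_(p, q)] a normed module
   over [R[i]], so limits, continuity and complex differentiability below are
   the library ones. *)
#[non_forgetful_inheritance, warnings="-redundant-canonical-projection"]
HB.instance Definition _ (R : realType) := NormedModule.copy R[i] R[i]^o.

Section Definitions.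
Variable R : realType.
Local Notation C := R[i].

(** * Half-line and quarter-plane calculus *)

(* Derivative on the closed half-line [0, +oo[: two-sided at x > 0, one-sided
   at x = 0; values of f at negative arguments are never used. *)
Definition hl_quot (V : normedModType C) (f : R -> V) (x : R) : R -> V :=
  fun y => ((y - x)^-1)%:C *: (f y - f x).

Definition hl_filter (x : R) : set_system R := within [set y | 0 <= y] x^'.

Definition hl_derivable (V : normedModType C) (f : R -> V) (x : R) : Prop :=
  cvg (hl_quot f x @ hl_filter x).

Definition hl_derive (V : normedModType C) (f : R -> V) (x : R) : V :=
  lim (hl_quot f x @ hl_filter x).

Definition dx (V : normedModType C) (w : R -> R -> V) : R -> R -> V :=
  fun x t => hl_derive (w^~ t) x.

Definition dt (V : normedModType C) (w : R -> R -> V) : R -> R -> V :=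
  fun x t => hl_derive (w x) t.

Definition quarter_plane : set (R * R) := [set p | 0 <= p.1 /\ 0 <= p.2].

Definition quarter_plane_C1 (V : normedModType C) (w : R -> R -> V) : Prop :=
  [/\ forall x t, 0 <= x -> 0 <= t ->
        hl_derivable (w^~ t) x /\ hl_derivable (w x) t,
      {within quarter_plane, continuous (fun p : R * R => dx w p.1 p.2)} &
      {within quarter_plane, continuous (fun p : R * R => dt w p.1 p.2)}].

Definition quarter_plane_bounded (V : normedModType C) (w : R -> R -> V) : Prop :=
  exists K : R, forall x t, 0 <= x -> 0 <= t -> `|w x t| <= K%:C.

(** * Matrices *)

(* In the order of R[i], 0 <= c and c <= 0 entail that c is real, so these
   conditions force X to be Hermitian. *)
Definition pos_def (p : nat) (X : 'M[C]_p) : Prop :=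
  forall v : 'cV[C]_p, v != 0 -> 0 < (v ^t* *m X *m v) 0 0.

Definition pos_semidef (p : nat) (X : 'M[C]_p) : Prop :=
  forall v : 'cV[C]_p, 0 <= (v ^t* *m X *m v) 0 0.

Definition neg_semidef (p : nat) (X : 'M[C]_p) : Prop :=
  forall v : 'cV[C]_p, (v ^t* *m X *m v) 0 0 <= 0.

Definition mexp (p : nat) (A : 'M[C]_p) : 'M[C]_p :=
  lim (series (fun k : nat => (k`!%:R : C)^-1 *: A ^+ k) @ \oo).

Definition mintegral (p q : nat) (f : R -> 'M[C]_(p, q)) (x : R) : 'M[C]_(p, q) :=
  \matrix_(i < p, j < q)
    ((\int[lebesgue_measure]_(y in `[0, x]) complex.Re (f y i j)) +i*
     (\int[lebesgue_measure]_(y in `[0, x]) complex.Im (f y i j))).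

(** * The function determined by a triple *)

Definition triple_beta (n : nat) (alpha : 'M[C]_n) : 'M[C]_(n + n) :=
  block_mx 0 alpha (- 1%:M) 0.

Definition triple_Lambda (n m : nat) (alpha : 'M[C]_n) (th1 th2 : 'M[C]_(n, m))
    (x : R) : 'M[C]_(n + n, m) :=
  mexp (x%:C *: triple_beta alpha) *m col_mx th1 th2.

Definition triple_S (n m : nat) (alpha : 'M[C]_n) (th1 th2 : 'M[C]_(n, m))
    (x : R) : 'M[C]_n :=
  let L2 y := dsubmx (triple_Lambda alpha th1 th2 y) in
  1%:M + mintegral (fun y => L2 y *m (L2 y) ^t*) x.

Definition triple_fun (n m : nat) (alpha : 'M[C]_n) (th1 th2 : 'M[C]_(n, m))
    (x : R) : 'M[C]_m :=
  let L1 := usubmx (triple_Lambda alpha th1 th2 x) in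
  let L2 := dsubmx (triple_Lambda alpha th1 th2 x) in
  let Sinv := invmx (triple_S alpha th1 th2 x) in
  2%:R *: ((L2 ^t* *m Sinv *m L2) ^+ 2
           + L1 ^t* *m Sinv *m L2 + L2 ^t* *m Sinv *m L1).

(** * The zero curvature coefficients *)

Definition coefG (m : nat) (u : 'M[C]_m) (z : C) : 'M[C]_(m + m) :=
  block_mx 0 1%:M (u - z%:M) 0.

(* u, ux, uxx stand for the values of u, u_x, u_xx at a point. *)
Definition coefF (m : nat) (u ux uxx : 'M[C]_m) (z : C) : 'M[C]_(m + m) :=
  let v := u + (2%:R * z)%:M in
  block_mx ux (- (2%:R *: v))
           (uxx - 2%:R *: (v *m (u - z%:M))) (- ux).

Definition matT (m : nat) : 'M[C]_(m + m) :=
  ((Num.sqrt (2%:R : R))^-1)%:C *: block_mx ('i%C)%:M 1%:M ('i%C)%:M (- 1%:M).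

(** * Weyl functions *)

Definition fundamental_solution (m : nat) (v : R -> 'M[C]_m) (z : C)
    (Psi : R -> 'M[C]_(m + m)) : Prop :=
  Psi 0 = 1%:M /\
  forall x, 0 <= x ->
    hl_derivable Psi x /\ hl_derive Psi x = coefG (v x) z *m Psi x.

Definition holomorphic_at (p q : nat) (f : C -> 'M[C]_(p, q)) (z : C) : Prop :=
  \forall w \near z, derivable f w 1.

(* f is a total function; its values at poles are irrelevant. *)
Definition meromorphic_upper (p q : nat) (f : C -> 'M[C]_(p, q)) : Prop :=
  forall z, 0 < complex.Im z ->
    exists (k : nat) (g : C -> 'M[C]_(p, q)),
      holomorphic_at g z /\ \forall w \near z^', (w - z) ^+ k *: f w = g w.

Definition admissible_pair (m : nat) (P Q : R -> C -> 'M[C]_m) : Prop :=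
  forall l, 0 < l ->
    [/\ meromorphic_upper (P l), meromorphic_upper (Q l) &
        forall z, 0 < complex.Im z ->
          holomorphic_at (P l) z -> holomorphic_at (Q l) z ->
          pos_def ((P l z) ^t* *m P l z + (Q l z) ^t* *m Q l z) /\
          pos_semidef ((P l z) ^t* *m Q l z + (Q l z) ^t* *m P l z)].

Definition calA (m : nat) (Psi : C -> R -> 'M[C]_(m + m)) (l : R) (z : C) :
    'M[C]_(m + m) :=
  let tPsi x w := invmx (Psi 0 x *m matT m) *m Psi w x *m matT m in
  (tPsi l (z^*)) ^t*.

Definition weylM (m : nat) (Psi : C -> R -> 'M[C]_(m + m))
    (P Q : R -> C -> 'M[C]_m) (l : R) (z : C) : 'M[C]_m :=
  let A := calA Psi l z in
  'i%C *: ((ulsubmx A *m P l z + ursubmx A *m Q l z) *m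
         invmx (dlsubmx A *m P l z + drsubmx A *m Q l z)).

(* M is the limit for every choice of the pair (P, Q), at each z that is not a
   pole of P l or Q l for large l (constant pairs reach every z). *)
Definition is_weyl_function (m : nat) (v : R -> 'M[C]_m) (M : C -> 'M[C]_m) :
    Prop :=
  exists Psi : C -> R -> 'M[C]_(m + m),
    (forall z, fundamental_solution v z (Psi z)) /\
    forall P Q : R -> C -> 'M[C]_m, admissible_pair P Q ->
      forall z, 0 < complex.Im z ->
        (\forall l \near +oo, holomorphic_at (P l) z /\ holomorphic_at (Q l) z) ->
        weylM Psi P Q l z @[l --> +oo] --> M z.

(** * The nonlinear equation *)

Definition kdv_solution (m : nat) (u : R -> R -> 'M[C]_m) : Prop :=
  forall x t, 0 <= x -> 0 <= t ->
    [/\ hl_derivable (u x) t, hl_derivable (u^~ t) x,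
        hl_derivable ((dx u)^~ t) x, hl_derivable ((dx (dx u))^~ t) x &
        dt u x t + 3%:R *: (u x t *m dx u x t + dx u x t *m u x t)
          - dx (dx (dx u)) x t = 0].

(* The library's principal square root maps the upper half-plane to itself. *)
Lemma Im_sqrtc_gt0 (z : C) : 0 < complex.Im z -> 0 < complex.Im (sqrtc z).
Proof.
case: z => a b /= b0; rewrite gt_eqF// gtr0_sg// mul1r sqrtr_gt0.
rewrite divr_gt0// subr_gt0 (le_lt_trans (ler_norm a))//.
rewrite -sqrtr_sqr ltr_sqrt; last by rewrite ltr_wpDl ?sqr_ge0// exprn_gt0.
by rewrite ltrDl exprn_gt0.
Qed.

End Definitions.

(* Main.v *)
(* Write a solution of [Psi_x = G Psi] as [y = (y1; y2)] and put [wr y = Im (y1^* y2)], so that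
   [wr_x = - Im z * |y1|^2].  At each time the Weyl function is determined by the solutions with
   [y1] square integrable, which are exactly those with [wr >= 0] on the whole half-line.
   Zero curvature lets a solution evolve by [y_t = F y], and
   [wr_t >= C * wr_x] because only [u], not its derivatives, enters [wr_t].  Hence [wr] is monotone
   along lines [x + C t = const], and a Weyl solution stays one for all time.

   At [x = 0] the boundary conditions leave [F = [[q, -4z], [4z^2, -q]]] with [q = u_x(0,t)]
   Hermitian.  For [w = e^(2 i pi/3)] and [z] close to the negative half-axis, [Im (w y1^* y2)] is
   nondecreasing in [t], while the limit of the Weyl functions makes it eventually nonpositive.  So
   [Im (w c^* m0 c) <= 0], where [m0 = i sqrt z + th1^* (alpha - z)^-1 th1] is the slope [y2 / y1]
   of the Weyl solution at time 0, computed by a double commutation.  The hypotheses on the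
   triple give [m0] a pole at a negative eigenvalue of [alpha], near which
   [Im (w c^* m0 c)] becomes positive in this sector: a contradiction. *)

Require Import Defs.
From HB Require Import structures.
From mathcomp Require Import all_boot all_order all_algebra.
From mathcomp Require Import complex.
From mathcomp Require Import all_classical all_reals all_analysis.
From mathcomp Require Import ring lra zify.
Import Order.TTheory GRing.Theory Num.Theory.
Import numFieldNormedType.Exports.
Local Open Scope classical_set_scope.
Local Open Scope ring_scope.
Local Open Scope complex_scope.
Local Open Scope sesquilinear_scope.
Set Implicit Arguments.
Unset Strict Implicit.
Unset Printing Implicit Defensive.

(** Only [u] is assumed bounded: [dx u] and [dx (dx u)] may grow in x, so [F] is unbounded on the
    half-line and offers no estimate uniform in x that would carry square integrability from one
    time to the next. Positivity of [wr] is therefore transported along lines of finite slope, each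
    of which stays in a compact region. The fundamental solutions come from the Weyl functions
    separately at each time, with no regularity in t; differentiability of y in t has to be
    recovered from zero curvature.

    The cube root of unity comes from the boundary matrix: its off-diagonal entries have degrees 1
    and 2 in z, so replacing z by w z with w^3 = 1 amounts to a constant diagonal conjugation. This
    yields the form Im (w y1^* y2), monotone whatever the unknown q is. For w = 1 the sign of Im
    (c^* m0 c) is nonnegative for every Hermitian alpha and cannot detect a pole. The rotated form
    can: to the left of an eigenvalue d, the quotient w / (d - z) lies in the upper half-plane, and
    it dominates the bounded term w i sqrt z, which lies in the lower one. *)

Local Notation Re := complex.Re.
Local Notation Im := complex.Im.
(* In [complex_scope], [^*] is [conjc], which is convertible but not syntactically
   equal to the [Num.conj] hidden in [^t*]. *)
Local Notation "z ^*" := (Num.conj z) : complex_scope.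

(** * Entrywise limits of complex matrices *)

Section ComplexParts.
Context {R : realType}.
Implicit Types x y : R[i].
Lemma cReD x y : Re (x + y) = Re x + Re y. Proof. by case: x y => ? ? []. Qed.
Lemma cImD x y : Im (x + y) = Im x + Im y. Proof. by case: x y => ? ? []. Qed.
Lemma cReN x : Re (- x) = - Re x. Proof. by case: x. Qed.
Lemma cImN x : Im (- x) = - Im x. Proof. by case: x. Qed.
Lemma cReM x y : Re (x * y) = Re x * Re y - Im x * Im y.
Proof. by case: x y => ? ? []. Qed.
Lemma cImM x y : Im (x * y) = Re x * Im y + Im x * Re y.
Proof. by case: x y => ? ? []. Qed.
Lemma cReC x : Re (x^*) = Re x. Proof. by case: x. Qed.
Lemma cImC x : Im (x^*) = - Im x. Proof. by case: x. Qed.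
Lemma Re_sum I (r : seq I) (P : pred I) (F : I -> R[i]) :
  Re (\sum_(i <- r | P i) F i) = \sum_(i <- r | P i) Re (F i).
Proof. by elim/big_rec2: _ => // i a b _ <-; rewrite cReD. Qed.
Lemma Im_sum I (r : seq I) (P : pred I) (F : I -> R[i]) :
  Im (\sum_(i <- r | P i) F i) = \sum_(i <- r | P i) Im (F i).
Proof. by elim/big_rec2: _ => // i a b _ <-; rewrite cImD. Qed.
Lemma Complex_eq x y : Re x = Re y -> Im x = Im y -> x = y.
Proof. by case: x y => ? ? [] ? ? /= -> ->. Qed.
Lemma normRe_le x (e : R) : `|x| <= e%:C -> `|Re x| <= e.
Proof. by move=> h; rewrite -lecR (le_trans (normc_ge_Re x)). Qed.
Lemma normIm_le x (e : R) : `|x| <= e%:C -> `|Im x| <= e.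
Proof.
rewrite -[Im x]opprK -ReiNIm normrN => h.
by apply: normRe_le; rewrite normrM complexiE normCi mulr1.
Qed.
Lemma norm_le_parts x (e : R) : `|Re x| <= e -> `|Im x| <= e -> `|x| <= (2 * e)%:C.
Proof.
move=> h1 h2; rewrite normc_def lecR.
have e0 : 0 <= e by apply: le_trans h1.
rewrite -[leRHS]ger0_norm ?mulr_ge0// -sqrtr_sqr ler_wsqrtr//.
rewrite -(real_normK (num_real (Re x))) -(real_normK (num_real (Im x))).
have := normr_ge0 (Re x); have := normr_ge0 (Im x); nra.
Qed.
End ComplexParts.

Section Limits.
Context {R : realType} {T : Type} (F : set_system T) {FF : Filter F}.
Local Notation C := R[i].

(** Real and imaginary parts converge separately, so that the real limit lemmas apply. [mcvg_cvg]
    and [mcvg_to_cvg] compare the entrywise notion [mcvg] with the norm topology of the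
    definitions. *)
Definition ccvg (f : T -> C) (l : C) :=
  (Re (f t) @[t --> F] --> Re l) /\ (Im (f t) @[t --> F] --> Im l).

Lemma ccvg_cst (c : C) : ccvg (fun=> c) c.
Proof. by split; exact: cvg_cst. Qed.
Lemma ccvgD f g a b : ccvg f a -> ccvg g b -> ccvg (fun t => f t + g t) (a + b).
Proof.
move=> [f1 f2] [g1 g2]; split.
- by under eq_fun do rewrite cReD; rewrite cReD; exact: cvgD.
- by under eq_fun do rewrite cImD; rewrite cImD; exact: cvgD.
Qed.
Lemma ccvgN f a : ccvg f a -> ccvg (fun t => - f t) (- a).
Proof.
move=> [f1 f2]; split.
- by under eq_fun do rewrite cReN; rewrite cReN; exact: cvgN.
- by under eq_fun do rewrite cImN; rewrite cImN; exact: cvgN.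
Qed.
Lemma ccvgM f g a b : ccvg f a -> ccvg g b -> ccvg (fun t => f t * g t) (a * b).
Proof.
move=> [f1 f2] [g1 g2]; split.
- under eq_fun do rewrite cReM; rewrite cReM.
  by apply: cvgB; exact: cvgM.
- under eq_fun do rewrite cImM; rewrite cImM.
  by apply: cvgD; exact: cvgM.
Qed.
Lemma ccvgC f a : ccvg f a -> ccvg (fun t => (f t)^*) (a^*).
Proof.
move=> [f1 f2]; split.
- by under eq_fun do rewrite cReC; rewrite cReC.
- by under eq_fun do rewrite cImC; rewrite cImC; exact: cvgN.
Qed.
Lemma ccvg_sum I (r : seq I) (f : I -> T -> C) (a : I -> C) :
  (forall i, ccvg (f i) (a i)) ->
  ccvg (fun t => \sum_(i <- r) f i t) (\sum_(i <- r) a i).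
Proof.
move=> h; elim: r => [|i r IH].
  by rewrite big_nil; under eq_fun do rewrite big_nil; exact: ccvg_cst.
by rewrite big_cons; under eq_fun do rewrite big_cons; exact: ccvgD.
Qed.
Definition mcvg p q (f : T -> 'M[C]_(p, q)) (L : 'M[C]_(p, q)) :=
  forall i j, ccvg (fun t => f t i j) (L i j).

Lemma mcvg_cst p q (L : 'M[C]_(p, q)) : mcvg (fun=> L) L.
Proof. by move=> i j; exact: ccvg_cst. Qed.
Lemma mcvgD p q (f g : T -> 'M[C]_(p, q)) a b :
  mcvg f a -> mcvg g b -> mcvg (fun t => f t + g t) (a + b).
Proof.
by move=> h k i j; under eq_fun do rewrite mxE; rewrite mxE; exact: ccvgD.
Qed.
Lemma mcvgN p q (f : T -> 'M[C]_(p, q)) a : mcvg f a -> mcvg (fun t => - f t) (- a).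
Proof.
by move=> h i j; under eq_fun do rewrite mxE; rewrite mxE; exact: ccvgN.
Qed.
Lemma mcvgB p q (f g : T -> 'M[C]_(p, q)) a b :
  mcvg f a -> mcvg g b -> mcvg (fun t => f t - g t) (a - b).
Proof. by move=> h k; apply: mcvgD => //; exact: mcvgN. Qed.
Lemma mcvgZ p q (c : T -> C) (f : T -> 'M[C]_(p, q)) l a :
  ccvg c l -> mcvg f a -> mcvg (fun t => c t *: f t) (l *: a).
Proof.
by move=> h k i j; under eq_fun do rewrite mxE; rewrite mxE; exact: ccvgM.
Qed.
Lemma mcvgM p q r (f : T -> 'M[C]_(p, q)) (g : T -> 'M[C]_(q, r)) a b :
  mcvg f a -> mcvg g b -> mcvg (fun t => f t *m g t) (a *m b).
Proof.
move=> h k i j; under eq_fun do rewrite mxE; rewrite mxE.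
by apply: ccvg_sum => l; exact: ccvgM.
Qed.
Lemma mcvg_trC p q (f : T -> 'M[C]_(p, q)) a :
  mcvg f a -> mcvg (fun t => (f t) ^t*) (a ^t*).
Proof.
by move=> h i j; under eq_fun do rewrite !mxE; rewrite !mxE; exact: ccvgC.
Qed.
Lemma mcvg_near p q (f g : T -> 'M[C]_(p, q)) a :
  (\forall t \near F, f t = g t) -> mcvg f a -> mcvg g a.
Proof.
move=> fg h i j; have [h1 h2] := h i j; split.
- by move: h1; apply: cvg_trans; apply: near_eq_cvg; near=> t; rewrite (near fg t).
- by move: h2; apply: cvg_trans; apply: near_eq_cvg; near=> t; rewrite (near fg t).
Unshelve. all: by end_near. Qed.
Lemma mcvg_ext p q (f g : T -> 'M[C]_(p, q)) a : f =1 g -> mcvg f a -> mcvg g a.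
Proof. by move=> /funext ->. Qed.
Lemma mcvg_usub p1 p2 q (f : T -> 'M[C]_(p1 + p2, q)) a :
  mcvg f a -> mcvg (fun t => usubmx (f t)) (usubmx a).
Proof. by move=> h i j; under eq_fun do rewrite mxE; rewrite mxE; exact: h. Qed.
Lemma mcvg_dsub p1 p2 q (f : T -> 'M[C]_(p1 + p2, q)) a :
  mcvg f a -> mcvg (fun t => dsubmx (f t)) (dsubmx a).
Proof. by move=> h i j; under eq_fun do rewrite mxE; rewrite mxE; exact: h. Qed.
Lemma mcvg_col p1 p2 q (f : T -> 'M[C]_(p1, q)) (g : T -> 'M[C]_(p2, q)) a b :
  mcvg f a -> mcvg g b -> mcvg (fun t => col_mx (f t) (g t)) (col_mx a b).
Proof.
move=> h k i j; under eq_fun do rewrite mxE; rewrite mxE.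
by case: (fintype.split i) => l; [exact: h|exact: k].
Qed.
Lemma mcvg_row p q1 q2 (f : T -> 'M[C]_(p, q1)) (g : T -> 'M[C]_(p, q2)) a b :
  mcvg f a -> mcvg g b -> mcvg (fun t => row_mx (f t) (g t)) (row_mx a b).
Proof.
move=> h k i j; under eq_fun do rewrite mxE; rewrite mxE.
by case: (fintype.split j) => l; [exact: h|exact: k].
Qed.

Lemma mcvg_cvg p q (f : T -> 'M[C]_(p, q)) L : f @ F --> L -> mcvg f L.
Proof.
move=> /cvg_ballP fL i j; split; apply/cvgrPdist_lt => e e0.
- have := fL e%:C; rewrite ltcR => /(_ e0); apply: filterS => t [_ /(_ i j)].
  rewrite /ball /= => h; rewrite -ltcR -cReN -cReD.
  by apply: le_lt_trans h; exact: normc_ge_Re.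
- have := fL e%:C; rewrite ltcR => /(_ e0); apply: filterS => t [_ /(_ i j)].
  rewrite /ball /= => h; rewrite -ltcR -cImN -cImD.
  apply: le_lt_trans h; rewrite -[Im _]opprK -ReiNIm normrN.
  by apply: le_trans (normc_ge_Re _) _; rewrite normrM complexiE normCi mulr1.
Qed.

End Limits.

Lemma mcvg_unique {R : realType} T (F : set_system T) {FF : ProperFilter F} p q
    (f : T -> 'M[R[i]]_(p, q)) a b : mcvg F f a -> mcvg F f b -> a = b.
Proof.
move=> h k; apply/matrixP => i j; have [h1 h2] := h i j; have [k1 k2] := k i j.
apply: Complex_eq; [exact: cvg_unique h1 k1|exact: cvg_unique h2 k2].
Qed.

Lemma mcvg_to_cvg {R : realType} T (F : set_system T) {FF : Filter F} p q
    (f : T -> 'M[R[i]]_(p, q)) L : mcvg F f L -> f @ F --> L.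
Proof.
move=> h; apply/cvg_ballP => e e0.
have [e1 e1E] : exists e1 : R, e = e1%:C.
  by exists (Re e); rewrite RRe_real// gtr0_real.
move: e0; rewrite {}e1E ltcR => e0.
suff H i j : \forall t \near F, `|L i j - f t i j| < e1%:C.
  have : \forall t \near F, forall ij : 'I_p * 'I_q, `|L ij.1 ij.2 - f t ij.1 ij.2| < e1%:C.
    by apply: filter_forall => -[i j] /=.
  by apply: filterS => t H2; split; [rewrite ltcR | move=> i j; exact: (H2 (i, j))].
have [/cvgrPdist_lt h1 /cvgrPdist_lt h2] := h i j.
have e4 : 0 < e1 / 4 by rewrite divr_gt0.
near=> t.
apply: (@le_lt_trans _ _ (2 * (e1 / 4))%:C); last first.
  rewrite ltcR; lra.
apply: norm_le_parts; rewrite ?cReD ?cReN ?cImD ?cImN; apply: ltW; near: t.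
  exact: h1. 
exact: h2.
Unshelve. all: by end_near. Qed.

(** * Derivatives on the half-line *)

Section RealInduction.
Context {R : realType}.
Implicit Types (P : R -> Prop) (f : R -> R).

(** Induction through the supremum of the points reached. One local hypothesis serves twice: a step
    from any [y] left of [x] to any [y'] right of [x] shows both that the supremum is reached and
    that it can be passed. *)
Lemma interval_induction (a b : R) P : a <= b -> P a ->
  (forall x, a <= x <= b -> exists2 d, 0 < d &
     forall y y', a <= y <= x -> x <= y' <= b -> x - d < y -> y' < x + d -> P y -> P y') ->
  P b.
Proof.
move=> ab Pa H.
pose S := [set x | a <= x <= b /\ P x].
have Sa : S a by split=> //; rewrite lexx.
have Sub : ubound S b by move=> x [/andP[]].
have hS : has_sup S by split; [exists a | exists b].
have aS : a <= sup S by apply: ub_le_sup Sa; exists b.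
have Sb : sup S <= b by apply: ge_sup => //; exists a.
have [|d d0 Hd] := H (sup S); first by rewrite aS.
have [y [yab Py] ySd] := sup_adherent d0 hS.
have yS : y <= sup S by apply: ub_le_sup; [exists b | split].
have [Sb'|Sb'] := ltP (sup S) b.
  pose y' := Num.min b (sup S + d / 2).
  have y'S : sup S < y'.
    by rewrite lt_min Sb' ltrDl divr_gt0.
  have : S y'.
    split; first by rewrite (le_trans aS (ltW y'S)) ge_min lexx.
    apply: (Hd y) => //.
    - by case/andP: yab => -> _.
    - by rewrite (ltW y'S) ge_min lexx.
    - by rewrite gt_min ltrD2l ltr_pdivrMr// ltr_pMr// ltr1n orbT.
  move=> Sy'; have := ub_le_sup (ex_intro _ b Sub) Sy'.
  by rewrite leNgt y'S.
have Eb : sup S = b by apply/eqP; rewrite eq_le Sb Sb'.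
rewrite -Eb; apply: (Hd y) => //.
- by case/andP: yab => -> _.
- by rewrite lexx Sb.
- by rewrite ltrDl.
Qed.

(** Increments are compared with the centre [x] only; adding the one from [y] to [x] and the one
    from [x] to [y'] carries the bound across. *)
Lemma dini_le (a b e : R) f : a <= b ->
  (forall x, a <= x <= b -> exists2 d, 0 < d & forall y, a <= y <= b -> `|y - x| < d ->
     (x <= y -> f y - f x <= e * (y - x)) /\ (y <= x -> f x - f y <= e * (x - y))) ->
  f b - f a <= e * (b - a).
Proof.
move=> ab H.
apply: (@interval_induction a b (fun y => f y - f a <= e * (y - a))) => //.
  by rewrite !subrr mulr0.
move=> x xab; have [d d0 Hd] := H _ xab; exists d => // y y'.
case/andP: xab => ax xb /andP[ay yx] /andP[xy' y'b] h1 h2 Py.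
have [|| _ /(_ yx) A] := Hd y.
- by rewrite ay (le_trans yx).
- by rewrite ltr_norml; apply/andP; split; lra.
have [|| /(_ xy') B _] := Hd y'.
- by rewrite y'b (le_trans ax).
- by rewrite ltr_norml; apply/andP; split; lra.
lra.
Qed.

(** Stands in for compactness of the interval: the local radii depend on the point, and monotonicity
    in [d] lets the minimum of two radii serve both pieces. *)
Lemma uniform_of_local (a b : R) (Q : R -> R -> Prop) : a <= b ->
  (forall x d d', d' <= d -> Q x d -> Q x d') ->
  (forall x, a <= x <= b -> exists2 d, 0 < d &
     forall y, a <= y <= b -> `|y - x| < d -> Q y d) ->
  exists2 d, 0 < d & forall y, a <= y <= b -> Q y d.
Proof.
move=> ab mono H.
apply: (@interval_induction a b (fun c => exists2 d, 0 < d & forall y, a <= y <= c -> Q y d)) => //.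
  have [|d d0 Hd] := H a; first by rewrite lexx.
  exists d => // y /andP[h1 h2].
  have -> : y = a by apply/eqP; rewrite eq_le h1 h2.
  by apply: Hd; rewrite ?lexx// subrr normr0.
move=> x xab; have [d d0 Hd] := H _ xab; exists d => // y y' yx xy' yd dy' [c c0 Hc].
exists (Num.min c d) => [|z /andP[az zy']]; first by rewrite lt_min c0 d0.
have [zy|yz] := leP z y.
  apply: (mono _ c); first by rewrite ge_min lexx.
  by apply: Hc; rewrite az zy.
apply: (mono _ d); first by rewrite ge_min lexx orbT.
case/andP: xy' => xy' y'b.
apply: Hd; first by rewrite az (le_trans zy').
by rewrite ltr_norml; apply/andP; split; lra.
Qed.

End RealInduction.

#[global] Instance hl_filter_filter {R : realType} (x : R) : Filter (hl_filter x).
Proof. exact: within_filter. Qed.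

Section HalfLine.
Context {R : realType}.
Local Notation C := R[i].

Lemma hl_filterP (x : R) (P : R -> Prop) :
  (\forall y \near hl_filter x, P y) <->
  exists2 d, 0 < d & forall y, 0 <= y -> y != x -> `|y - x| < d -> P y.
Proof.
split.
  rewrite /hl_filter /within /= => /nbhs_ballP[d d0 H]; exists d => // y y0 yx yd.
  by apply: H => //; rewrite /ball /= distrC.
move=> [d d0 H]; apply/nbhs_ballP; exists d => // y yd yx y0.
by apply: H => //; rewrite distrC.
Qed.

Lemma hl_filter_proper (x : R) : 0 <= x -> ProperFilter (hl_filter x).
Proof.
move=> x0; split; last exact: hl_filter_filter.
move=> /(hl_filterP _ (fun=> False))[d d0 H].
apply: (H (x + d / 2)).
- lra.
- by apply/eqP => h; lra.
- by rewrite [x + _]addrC addrK gtr0_norm; lra.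
Qed.

Lemma hl_cvgP (x : R) (f : R -> R) (l : R) :
  f @ hl_filter x --> l <->
  forall e, 0 < e -> exists2 d, 0 < d &
    forall y, 0 <= y -> y != x -> `|y - x| < d -> `|f y - l| <= e.
Proof.
split.
  move=> /cvgrPdist_le h e e0; apply/hl_filterP.
  by apply: filterS (h _ e0) => y; rewrite distrC.
move=> h; apply/cvgrPdist_le => e e0.
by have /hl_filterP := h _ e0; apply: filterS => y; rewrite distrC.
Qed.

(** A relation rather than a [lim], so that the rules of calculus give existence and value at once.
    [hdRP] is the first-order form, in which [y = x] is allowed. *)
Definition hdR (f : R -> R) (x d : R) :=
  (y - x)^-1 * (f y - f x) @[y --> hl_filter x] --> d.

Lemma hdRP (f : R -> R) (x d : R) :
  hdR f x d <->
  forall e, 0 < e -> exists2 dl, 0 < dl &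
    forall y, 0 <= y -> `|y - x| < dl -> `|f y - f x - d * (y - x)| <= e * `|y - x|.
Proof.
split.
  move=> /hl_cvgP h e e0; have [dl dl0 H] := h _ e0; exists dl => // y y0 yd.
  have [->|yx] := eqVneq y x; first by rewrite !subrr mulr0 subr0 normr0 mulr0.
  have := H _ y0 yx yd; have yx' : y - x != 0 by rewrite subr_eq0.
  have -> : f y - f x - d * (y - x) = ((y - x)^-1 * (f y - f x) - d) * (y - x).
    by field.
  by rewrite normrM ler_pM2r// normr_gt0.
move=> h; apply/hl_cvgP => e e0; have [dl dl0 H] := h _ e0; exists dl => // y y0 yx yd.
have yx' : y - x != 0 by rewrite subr_eq0.
rewrite -(@ler_pM2r _ `|y - x|) ?normr_gt0// -normrM.
have -> : ((y - x)^-1 * (f y - f x) - d) * (y - x) = f y - f x - d * (y - x) by field.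
exact: H.
Qed.

Lemma hdR_cont (f : R -> R) x d : hdR f x d -> f @ hl_filter x --> f x.
Proof.
move=> /hdRP h; apply/hl_cvgP => e e0.
have [dl dl0 H] := h 1 ltr01.
pose K := 1 + `|d|.
have K0 : 0 < K by rewrite /K ltr_pwDl.
exists (Num.min dl (e / K)) => [|y y0 yx]; first by rewrite lt_min dl0 divr_gt0.
rewrite lt_min => /andP[yd ye].
have h2 := H _ y0 yd; rewrite mul1r in h2.
rewrite (_ : f y - f x = (f y - f x - d * (y - x)) + d * (y - x)); last by ring.
apply: (le_trans (ler_normD _ _)); rewrite normrM.
apply: (@le_trans _ _ (K * `|y - x|)); first by rewrite /K; lra.
by rewrite mulrC -ler_pdivlMr// ltW.
Qed.

Lemma hdR_cst (c x : R) : hdR (fun=> c) x 0.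
Proof.
rewrite /hdR; under eq_fun do rewrite subrr mulr0; exact: cvg_cst.
Qed.
Lemma hdR_id (x : R) : hdR id x 1.
Proof. by apply/hdRP => e e0; exists 1 => // y _ _; rewrite mul1r subrr normr0 mulr_ge0// ltW. Qed.
Lemma hdRD f g x (a b : R) : hdR f x a -> hdR g x b -> hdR (fun y => f y + g y) x (a + b).
Proof.
move=> h k; rewrite /hdR.
under eq_fun do rewrite opprD addrACA mulrDr; exact: cvgD.
Qed.
Lemma hdRN f x (a : R) : hdR f x a -> hdR (fun y => - f y) x (- a).
Proof.
move=> h; rewrite /hdR.
under eq_fun do rewrite -opprD mulrN; exact: cvgN.
Qed.
Lemma hdRB f g x (a b : R) : hdR f x a -> hdR g x b -> hdR (fun y => f y - g y) x (a - b).
Proof. by move=> h k; apply: hdRD => //; exact: hdRN. Qed.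
Lemma hdRM f g x (a b : R) : hdR f x a -> hdR g x b ->
  hdR (fun y => f y * g y) x (a * g x + f x * b).
Proof.
move=> h k; rewrite /hdR.
have -> : (fun y => (y - x)^-1 * (f y * g y - f x * g x)) =
  (fun y => (y - x)^-1 * (f y - f x) * g y + f x * ((y - x)^-1 * (g y - g x))).
  by apply/funext => y; ring.
apply: cvgD; last by apply: cvgMr; exact: k.
by apply: cvgM => //; exact: hdR_cont k.
Qed.
Lemma hdRZ (c : R) f x (a : R) : hdR f x a -> hdR (fun y => c * f y) x (c * a).
Proof.
by move=> h; have := hdRM (hdR_cst c x) h; rewrite mul0r add0r.
Qed.
Lemma hdR_lin (c x : R) : hdR (fun y => c * y) x c.
Proof. by have := hdRM (hdR_cst c x) (hdR_id x); rewrite mul0r add0r mulr1. Qed.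
Lemma hdR_eq f x (a b : R) : hdR f x a -> a = b -> hdR f x b.
Proof. by move=> h <-. Qed.

Lemma hdR_is_derive (f : R -> R) (x d : R) : is_derive x 1 f d -> hdR f x d.
Proof.
move=> [df <-]; move: df => /cvg_ex[l] /[dup] h /cvg_lim.
rewrite -/(derive f x 1) => -> //.
apply/hl_cvgP => e e0.
move/cvgrPdist_le : h => /(_ _ e0) /nbhs_ballP[dl dl0 H].
exists dl => // y y0 yx yd.
have := H (y - x); rewrite /ball /= sub0r normrN => /(_ yd).
rewrite subr_eq0 => /(_ yx).
by rewrite distrC /GRing.scale /= mulr1 subrK.
Qed.

Lemma hdR_expR (c x : R) : hdR (fun y => expR (c * y)) x (c * expR (c * x)).
Proof.
apply: hdR_is_derive; apply: is_derive_eq.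
by rewrite /GRing.scale /= mulr1 mulrC.
Qed.

(** Mean value inequality without continuity of the derivative: locally the slope is at most [e],
    [dini_le] makes this global, and [e] tends to 0. *)
Lemma hdR_le (f d : R -> R) (a b : R) : 0 <= a -> a <= b ->
  (forall x, a <= x <= b -> hdR f x (d x)) ->
  (forall x, a <= x <= b -> d x <= 0) -> f b <= f a.
Proof.
move=> a0 ab hf hd.
have H e : 0 < e -> f b - f a <= e * (b - a).
  move=> e0; apply: dini_le => // x xab.
  have /hdRP/(_ _ e0) [dl dl0 H] := hf _ xab.
  exists dl => // y /andP[ay yb] yd.
  have := H _ (le_trans a0 ay) yd; rewrite ler_norml => /andP[h1 h2].
  have dx := hd _ xab.
  by split=> xy; [have yx0 : 0 <= y - x by lra|have yx0 : 0 <= x - y by lra];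
    [rewrite ger0_norm// in h1 h2|rewrite distrC ger0_norm// in h1 h2]; nra.
rewrite -subr_le0; apply/ler_addgt0Pl => e e0; rewrite addr0.
(* The summand 1 keeps the denominator positive when [a = b]. *)
have := H (e / (b - a + 1)).
rewrite divr_gt0//; last by lra.
move=> /(_ isT) /le_trans; apply.
rewrite mulrAC ler_pdivrMr; last by lra.
by rewrite ler_pM2l//; lra.
Qed.

Lemma hdR_ge (f d : R -> R) (a b : R) : 0 <= a -> a <= b ->
  (forall x, a <= x <= b -> hdR f x (d x)) ->
  (forall x, a <= x <= b -> 0 <= d x) -> f a <= f b.
Proof.
move=> a0 ab hf hd; rewrite -lerN2.
apply: (@hdR_le (fun x => - f x) (fun x => - d x) a b) => //.
- by move=> x xab; apply: hdRN; exact: hf.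
- by move=> x xab; rewrite oppr_le0 hd.
Qed.

Lemma hdR_const (f : R -> R) (b : R) : 0 <= b ->
  (forall x, 0 <= x -> hdR f x 0) -> f b = f 0.
Proof.
move=> b0 h; apply/eqP; rewrite eq_le; apply/andP; split.
- by apply: (@hdR_le f (fun=> 0)) => // x /andP[x0 _]; exact: h.
- by apply: (@hdR_ge f (fun=> 0)) => // x /andP[x0 _]; exact: h.
Qed.

(** Both [g + f] and [g - f] are nondecreasing. *)
Lemma hdR_mvt (f g df dg : R -> R) (a b : R) : 0 <= a -> a <= b ->
  (forall x, a <= x <= b -> hdR f x (df x)) ->
  (forall x, a <= x <= b -> hdR g x (dg x)) ->
  (forall x, a <= x <= b -> `|df x| <= dg x) -> `|f b - f a| <= g b - g a.
Proof.
move=> a0 ab hf hg hd; rewrite ler_norml; apply/andP; split.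
- have : g a + f a <= g b + f b.
    apply: (@hdR_ge (fun x => g x + f x) (fun x => dg x + df x)) => // x xab.
      by apply: hdRD; [exact: hg|exact: hf].
    by have := hd _ xab; rewrite ler_norml => /andP[]; lra.
  lra.
- have : g a - f a <= g b - f b.
    apply: (@hdR_ge (fun x => g x - f x) (fun x => dg x - df x)) => // x xab.
      by apply: hdRB; [exact: hg|exact: hf].
    by have := hd _ xab; rewrite ler_norml => /andP[]; lra.
  lra.
Qed.

Lemma hdR_mvt_lin (f df : R -> R) (a b c e : R) : 0 <= a -> a <= b ->
  (forall x, a <= x <= b -> hdR f x (df x)) ->
  (forall x, a <= x <= b -> `|df x - c| <= e) ->
  `|f b - f a - c * (b - a)| <= e * (b - a).
Proof.
move=> a0 ab hf hd.
have := @hdR_mvt (fun x => f x - c * x) (fun x => e * x)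
  (fun x => df x - c) (fun=> e) a b a0 ab.
rewrite (_ : _ - _ = f b - f a - c * (b - a)); last by ring.
rewrite -mulrBr; apply => //.
- by move=> x xab; apply: hdRB; [exact: hf|exact: hdR_lin].
- by move=> x _; exact: hdR_lin.
Qed.

End HalfLine.

Section Derivatives.
Context {R : realType}.
Local Notation C := R[i].

Definition HD p q (f : R -> 'M[C]_(p, q)) (x : R) (D : 'M[C]_(p, q)) :=
  mcvg (hl_filter x) (fun y => ((y - x)^-1)%:C *: (f y - f x)) D.

Lemma HDP p q (f : R -> 'M[C]_(p, q)) x D :
  HD f x D <-> forall i j, hdR (fun y => Re (f y i j)) x (Re (D i j)) /\
                           hdR (fun y => Im (f y i j)) x (Im (D i j)).
Proof.
have E1 i j y : Re ((((y - x)^-1)%:C *: (f y - f x)) i j) =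
    (y - x)^-1 * (Re (f y i j) - Re (f x i j)).
  by rewrite !mxE cReM /= mul0r subr0 cReD cReN.
have E2 i j y : Im ((((y - x)^-1)%:C *: (f y - f x)) i j) =
    (y - x)^-1 * (Im (f y i j) - Im (f x i j)).
  by rewrite !mxE cImM /= mul0r addr0 cImD cImN.
split=> h i j; have [h1 h2] := h i j; rewrite /hdR; split; move: h1 h2;
  rewrite /ccvg /hdR; (under eq_fun do rewrite ?E1 ?E2); try by [].
- by move=> _; under eq_fun do rewrite E2.
- by under eq_fun do rewrite -E1.
- by move=> _; under eq_fun do rewrite -E2.
Qed.

Lemma HD_Re p q (f : R -> 'M[C]_(p, q)) x D i j :
  HD f x D -> hdR (fun y => Re (f y i j)) x (Re (D i j)).
Proof. by move=> /HDP /(_ i j) []. Qed.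
Lemma HD_Im p q (f : R -> 'M[C]_(p, q)) x D i j :
  HD f x D -> hdR (fun y => Im (f y i j)) x (Im (D i j)).
Proof. by move=> /HDP /(_ i j) []. Qed.

Lemma HD_cont p q (f : R -> 'M[C]_(p, q)) x D : HD f x D -> mcvg (hl_filter x) f (f x).
Proof.
move=> h i j; split.
- exact: (hdR_cont (HD_Re (i := i) (j := j) h)).
- exact: (hdR_cont (HD_Im (i := i) (j := j) h)).
Qed.
Lemma HD_cst p q (M : 'M[C]_(p, q)) x : HD (fun=> M) x 0.
Proof. by apply/HDP => i j; split; rewrite mxE; exact: hdR_cst. Qed.
Lemma HDD p q (f g : R -> 'M[C]_(p, q)) x A B :
  HD f x A -> HD g x B -> HD (fun y => f y + g y) x (A + B).
Proof.
move=> h k; apply: mcvg_ext (mcvgD h k) => y.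
by rewrite -scalerDr opprD addrACA.
Qed.
Lemma HDN p q (f : R -> 'M[C]_(p, q)) x A : HD f x A -> HD (fun y => - f y) x (- A).
Proof.
by move=> h; apply: mcvg_ext (mcvgN h) => y; rewrite -scalerN opprD.
Qed.
Lemma HDB p q (f g : R -> 'M[C]_(p, q)) x A B :
  HD f x A -> HD g x B -> HD (fun y => f y - g y) x (A - B).
Proof. by move=> h k; apply: HDD => //; exact: HDN. Qed.
Lemma HDM p q r (f : R -> 'M[C]_(p, q)) (g : R -> 'M[C]_(q, r)) x A B :
  HD f x A -> HD g x B -> HD (fun y => f y *m g y) x (A *m g x + f x *m B).
Proof.
move=> h k.
apply: mcvg_ext (mcvgD (mcvgM h (HD_cont k)) (mcvgM (mcvg_cst (f x)) k)) => y; rewrite -scalemxAl -scalemxAr -scalerDr; congr (_ *: _).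
by rewrite mulmxBl mulmxBr addrA subrK.
Qed.
Lemma HDMl p q r (M : 'M[C]_(p, q)) (g : R -> 'M[C]_(q, r)) x B :
  HD g x B -> HD (fun y => M *m g y) x (M *m B).
Proof. by move=> h; have := HDM (HD_cst M x) h; rewrite mul0mx add0r. Qed.
Lemma HDMr p q r (f : R -> 'M[C]_(p, q)) (M : 'M[C]_(q, r)) x A :
  HD f x A -> HD (fun y => f y *m M) x (A *m M).
Proof. by move=> h; have := HDM h (HD_cst M x); rewrite mulmx0 addr0. Qed.
Lemma HDZ p q (c : C) (f : R -> 'M[C]_(p, q)) x A :
  HD f x A -> HD (fun y => c *: f y) x (c *: A).
Proof.
move=> h; apply: mcvg_ext (mcvgZ (ccvg_cst c) h) => y.
by rewrite scalerA mulrC -scalerA scalerBr.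
Qed.
Lemma HD_trC p q (f : R -> 'M[C]_(p, q)) x A :
  HD f x A -> HD (fun y => (f y) ^t*) x (A ^t*).
Proof.
move=> h; apply: mcvg_ext (mcvg_trC h) => y.
apply/matrixP => i j; rewrite !mxE.
by apply: Complex_eq; rewrite ?cReC ?cImC ?cReM ?cImM ?cReD ?cImD ?cReN ?cImN ?cReC ?cImC /=; ring.
Qed.
Lemma HD_usub p1 p2 q (f : R -> 'M[C]_(p1 + p2, q)) x A :
  HD f x A -> HD (fun y => usubmx (f y)) x (usubmx A).
Proof.
by move=> h; apply: mcvg_ext (mcvg_usub h) => y; apply/matrixP => i j; rewrite !mxE.
Qed.
Lemma HD_dsub p1 p2 q (f : R -> 'M[C]_(p1 + p2, q)) x A :
  HD f x A -> HD (fun y => dsubmx (f y)) x (dsubmx A).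
Proof.
by move=> h; apply: mcvg_ext (mcvg_dsub h) => y; apply/matrixP => i j; rewrite !mxE.
Qed.
Lemma HD_col p1 p2 q (f : R -> 'M[C]_(p1, q)) (g : R -> 'M[C]_(p2, q)) x A B :
  HD f x A -> HD g x B -> HD (fun y => col_mx (f y) (g y)) x (col_mx A B).
Proof.
move=> h k; apply: mcvg_ext (mcvg_col h k) => y.
by rewrite opp_col_mx add_col_mx scale_col_mx.
Qed.
Lemma HD_row p q1 q2 (f : R -> 'M[C]_(p, q1)) (g : R -> 'M[C]_(p, q2)) x A B :
  HD f x A -> HD g x B -> HD (fun y => row_mx (f y) (g y)) x (row_mx A B).
Proof.
move=> h k; apply: mcvg_ext (mcvg_row h k) => y.
by rewrite opp_row_mx add_row_mx scale_row_mx.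
Qed.
Lemma HD_block p1 p2 q1 q2 (f1 : R -> 'M[C]_(p1, q1)) (f2 : R -> 'M[C]_(p1, q2))
   (f3 : R -> 'M[C]_(p2, q1)) (f4 : R -> 'M[C]_(p2, q2)) x A1 A2 A3 A4 :
  HD f1 x A1 -> HD f2 x A2 -> HD f3 x A3 -> HD f4 x A4 ->
  HD (fun y => block_mx (f1 y) (f2 y) (f3 y) (f4 y)) x (block_mx A1 A2 A3 A4).
Proof. by move=> *; apply: HD_col; exact: HD_row. Qed.
Lemma HD_eq p q (f : R -> 'M[C]_(p, q)) x A B : HD f x A -> A = B -> HD f x B.
Proof. by move=> h <-. Qed.
Lemma HD_ext p q (f g : R -> 'M[C]_(p, q)) x A :
  (forall y, 0 <= y -> f y = g y) -> 0 <= x -> HD f x A -> HD g x A.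
Proof.
move=> fg x0; apply: mcvg_near => //; apply/hl_filterP; exists 1 => // y y0 _ _.
by rewrite !fg.
Qed.
Lemma HD_unique p q (f : R -> 'M[C]_(p, q)) x A B :
  0 <= x -> HD f x A -> HD f x B -> A = B.
Proof. by move=> x0; have := hl_filter_proper x0 => ?; exact: mcvg_unique. Qed.

Lemma HD_hl p q (f : R -> 'M[C]_(p, q)) x :
  hl_derivable f x -> HD f x (hl_derive f x).
Proof. by move=> h; apply: mcvg_cvg; exact: h. Qed.

Lemma HD_const p q (f : R -> 'M[C]_(p, q)) x : 0 <= x ->
  (forall y, 0 <= y -> HD f y 0) -> f x = f 0.
Proof.
move=> x0 h; apply/matrixP => i j; apply: Complex_eq.
- by apply: (@hdR_const _ (fun y => Re (f y i j))) => // y y0; have := HD_Re (i := i) (j := j) (h y y0); rewrite mxE.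
- by apply: (@hdR_const _ (fun y => Im (f y i j))) => // y y0; have := HD_Im (i := i) (j := j) (h y y0); rewrite mxE.
Qed.

Lemma mx_entry_le p q (M : 'M[C]_(p, q)) (K : R) i j : `|M| <= K%:C ->
  `|Re (M i j)| <= K /\ `|Im (M i j)| <= K.
Proof.
suff : `|M i j| <= `|M|.
  by move=> h1 h2; split; [apply: normRe_le|apply: normIm_le]; exact: le_trans h1 h2.
rewrite {2}/Num.norm/= mx_normE -[leLHS]nngE num_le.
exact: (le_bigmax _ (fun ij : 'I_p * 'I_q => `|M ij.1 ij.2|%:nng) (i, j)).
Qed.

End Derivatives.

(** * The Hermitian inner product and its elementary bounds *)

Section InnerProduct.
Context {R : realType}.
Local Notation C := R[i].

Lemma cJM (x y : C) : (x * y)^* = x^* * y^*.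
Proof. by apply: Complex_eq; rewrite !(cReM, cImM, cReC, cImC); ring. Qed.
Lemma cJD (x y : C) : (x + y)^* = x^* + y^*.
Proof. by apply: Complex_eq; rewrite !(cReD, cImD, cReC, cImC); ring. Qed.
Lemma cJN (x : C) : (- x)^* = - x^*.
Proof. by apply: Complex_eq; rewrite !(cReN, cImN, cReC, cImC). Qed.
Lemma cJ_sum I (r : seq I) (F : I -> C) :
  (\sum_(i <- r) F i)^* = \sum_(i <- r) (F i)^*.
Proof. by elim/big_rec2: _ => [|i a b _ <-]; rewrite ?conjC0 ?cJD. Qed.

Definition ip p (a b : 'cV[C]_p) : C := (a ^t* *m b) 0 0.
Definition sqn p (a : 'cV[C]_p) : R := Re (ip a a).

Lemma ipE p (a b : 'cV[C]_p) : ip a b = \sum_i (a i 0)^* * b i 0.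
Proof. by rewrite /ip mxE; apply: eq_bigr => i _; rewrite !mxE. Qed.
Lemma ipDr p (a b c : 'cV[C]_p) : ip a (b + c) = ip a b + ip a c.
Proof. by rewrite /ip mulmxDr mxE. Qed.
Lemma ipNr p (a b : 'cV[C]_p) : ip a (- b) = - ip a b.
Proof. by rewrite /ip mulmxN mxE. Qed.
Lemma ipZr p (a b : 'cV[C]_p) c : ip a (c *: b) = c * ip a b.
Proof. by rewrite /ip -scalemxAr mxE. Qed.
Lemma ipC p (a b : 'cV[C]_p) : ip b a = (ip a b)^*.
Proof.
rewrite !ipE cJ_sum; apply: eq_bigr => i _.
by rewrite cJM conjCK mulrC.
Qed.
Lemma ipDl p (a b c : 'cV[C]_p) : ip (a + b) c = ip a c + ip b c.
Proof. by rewrite ipC ipDr cJD -!ipC. Qed.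
Lemma ipNl p (a b : 'cV[C]_p) : ip (- a) b = - ip a b.
Proof. by rewrite ipC ipNr cJN -!ipC. Qed.
Lemma ipZl p (a b : 'cV[C]_p) c : ip (c *: a) b = c^* * ip a b.
Proof. by rewrite ipC ipZr cJM -!ipC. Qed.
Lemma ipMl p q (M : 'M[C]_(q, p)) (a : 'cV[C]_p) (b : 'cV[C]_q) :
  ip (M *m a) b = ip a (M ^t* *m b).
Proof. by rewrite /ip trmx_mul map_mxM mulmxA. Qed.
Lemma ip_herm p (M : 'M[C]_p) (a : 'cV[C]_p) : M ^t* = M -> Im (ip a (M *m a)) = 0.
Proof.
move=> h; have : ip a (M *m a) = (ip a (M *m a))^* by rewrite -ipC ipMl h.
by move=> /(congr1 (@complex.Im R)); rewrite cImC; lra.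
Qed.
Lemma sqnE p (a : 'cV[C]_p) : sqn a = \sum_i (Re (a i 0) ^+ 2 + Im (a i 0) ^+ 2).
Proof.
rewrite /sqn ipE Re_sum; apply: eq_bigr => i _; rewrite cReM cReC cImC; ring.
Qed.
Lemma sqn_ge0 p (a : 'cV[C]_p) : 0 <= sqn a.
Proof. by rewrite sqnE sumr_ge0// => i _; rewrite addr_ge0 ?sqr_ge0. Qed.
Lemma ip_self p (a : 'cV[C]_p) : ip a a = (sqn a)%:C.
Proof.
apply: Complex_eq => //=.
by have := ip_herm a (M := 1%:M); rewrite mul1mx => -> //; rewrite trmx1 map_mx1.
Qed.
Lemma sqn_eq0 p (a : 'cV[C]_p) : sqn a = 0 -> a = 0.
Proof.
rewrite sqnE => /eqP; rewrite psumr_eq0; last first.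
  by move=> i _; rewrite addr_ge0 ?sqr_ge0.
move=> /allP h; apply/colP => i; rewrite mxE.
have := h i (mem_index_enum _); rewrite paddr_eq0 ?sqr_ge0// !sqrf_eq0.
by move=> /andP[/eqP h1 /eqP h2]; apply: Complex_eq.
Qed.
Lemma sqn_entry p (a : 'cV[C]_p) i : Re (a i 0) ^+ 2 + Im (a i 0) ^+ 2 <= sqn a.
Proof.
rewrite sqnE (bigD1 i)//= lerDl sumr_ge0// => j _; by rewrite addr_ge0 ?sqr_ge0.
Qed.
Lemma sqn_le p (a : 'cV[C]_p) (e : R) : 0 <= e ->
  (forall i, `|Re (a i 0)| <= e /\ `|Im (a i 0)| <= e) -> sqn a <= p%:R * (2 * e ^+ 2).
Proof.
move=> e0 h; rewrite sqnE; have -> : p%:R * (2 * e ^+ 2) = \sum_(i < p) (2 * e ^+ 2).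
  by rewrite sumr_const card_ord mulr_natl.
apply: ler_sum => i _; have [h1 h2] := h i.
rewrite mulr_natl mulr2n -(real_normK (num_real (Re _))) -(real_normK (num_real (Im _))).
by apply: lerD; rewrite lerXn2r ?nnegrE.
Qed.
Lemma sqnB_le p (a b : 'cV[C]_p) : sqn (a - b) <= 2 * sqn a + 2 * sqn b.
Proof.
have := sqn_ge0 (a + b); rewrite /sqn !(ipDl, ipDr, ipNl, ipNr) !(cReD, cReN).
by move: (Re _) (Re _) (Re _) (Re _) => *; lra.
Qed.
(** Expand the squared norms of [a + c b] and [a - c b] for a unimodular [c]: [c = 1] gives the real
    part, [c = i] the imaginary part. *)
Lemma ip_le p (a b : 'cV[C]_p) :
  `|Re (ip a b)| <= (sqn a + sqn b) / 2 /\ `|Im (ip a b)| <= (sqn a + sqn b) / 2.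
Proof.
have H (c : C) : Re c ^+ 2 + Im c ^+ 2 = 1 -> `|Re (c * ip a b)| <= (sqn a + sqn b) / 2.
  move=> c1.
  have E2 : c^* * c = 1.
    by apply: Complex_eq; rewrite ?cReM ?cImM cReC cImC /=; lra.
  have S : sqn (c *: b) = sqn b.
    by rewrite /sqn ipZl ipZr mulrA E2 mul1r.
  have h1 := sqn_ge0 (a + c *: b); have h2 := sqn_ge0 (a - c *: b).
  have h : Re (ip (c *: b) a) = Re (c * ip a b) by rewrite ipC cReC ipZr.
  rewrite /sqn !(ipDl, ipDr, ipNl, ipNr) !(cReD, cReN) h ipZr -/(sqn _) -/(sqn (c *: b)) S in h1 h2.
  move: (Re (c * ip a b)) h1 h2; rewrite /sqn; move: (Re _) (Re _) => A1 A2 A3 h1 h2.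
  by rewrite ler_norml; apply/andP; split; lra.
split.
- have := H 1; rewrite mul1r /=; apply; by rewrite expr1n expr0n addr0.
- have := H (0 +i* 1); rewrite cReM /= mul0r mul1r sub0r normrN; apply.
  by rewrite expr1n expr0n add0r.
Qed.

Lemma ip_mx_le p (M : 'M[C]_p) (K : R) (a b : 'cV[C]_p) :
  (forall i j, `|Re (M i j)| <= K /\ `|Im (M i j)| <= K) ->
  `|Re (ip a (M *m b))| <= K * p%:R * (sqn a + sqn b).
Proof.
move=> h; rewrite ipE Re_sum.
apply: (le_trans (ler_norm_sum _ _ _)).
have -> : K * p%:R * (sqn a + sqn b) =
  \sum_(i < p) \sum_(j < p) K * ((Re (a i 0) ^+ 2 + Im (a i 0) ^+ 2) +
     (Re (b j 0) ^+ 2 + Im (b j 0) ^+ 2)).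
  under eq_bigr do rewrite -mulr_sumr big_split /= sumr_const card_ord -sqnE.
  rewrite -mulr_sumr big_split /= sumr_const card_ord sumrMnl -sqnE.
  by rewrite -[sqn a *+ p]mulr_natl -[sqn b *+ p]mulr_natl; ring.
apply: ler_sum => i _; rewrite mxE mulr_sumr Re_sum.
apply: (le_trans (ler_norm_sum _ _ _)).
apply: ler_sum => j _; have [h1 h2] := h i j.
set al := a i 0; set be := b j 0; set mu := M i j in h1 h2 *.
rewrite !(cReM, cImM, cReC, cImC).
move: (Re al) (Im al) (Re be) (Im be) (Re mu) (Im mu) h1 h2 => a1 a2 b1 b2 m1 m2.
move=> k1 k2.
set s := a1^+2 + a2^+2 + (b1^+2 + b2^+2).
rewrite (_ : a1 * _ - _ = m1 * (a1 * b1 + a2 * b2) - m2 * (a1 * b2 - a2 * b1)); last by ring.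
have n1 : `|a1 * b1 + a2 * b2| <= s / 2.
  have := addr_ge0 (sqr_ge0 (a1 - b1)) (sqr_ge0 (a2 - b2)).
  have := addr_ge0 (sqr_ge0 (a1 + b1)) (sqr_ge0 (a2 + b2)).
  by rewrite /s ler_norml => q1 q2; apply/andP; split; lra.
have n2 : `|a1 * b2 - a2 * b1| <= s / 2.
  have := addr_ge0 (sqr_ge0 (a1 - b2)) (sqr_ge0 (a2 + b1)).
  have := addr_ge0 (sqr_ge0 (a1 + b2)) (sqr_ge0 (a2 - b1)).
  by rewrite /s ler_norml => q1 q2; apply/andP; split; lra.
apply: (le_trans (ler_normB _ _)).
rewrite !normrM (_ : K * s = K * (s / 2) + K * (s / 2)); last by field.
by apply: lerD; apply: ler_pM.
Qed.

Lemma HD_ip p (a b : R -> 'cV[C]_p) x A B : HD a x A -> HD b x B ->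
  hdR (fun y => Re (ip (a y) (b y))) x (Re (ip A (b x)) + Re (ip (a x) B)) /\
  hdR (fun y => Im (ip (a y) (b y))) x (Im (ip A (b x)) + Im (ip (a x) B)).
Proof.
move=> h k; have H := HDM (HD_trC h) k; split.
- by have := HD_Re (i := 0) (j := 0) H; rewrite mxE cReD.
- by have := HD_Im (i := 0) (j := 0) H; rewrite mxE cImD.
Qed.

Lemma HD_sqn p (a : R -> 'cV[C]_p) x A : HD a x A ->
  hdR (fun y => sqn (a y)) x (2 * Re (ip (a x) A)).
Proof.
move=> h; have [h1 _] := HD_ip h h; apply: hdR_eq h1 _.
by rewrite [ip A _]ipC cReC; ring.
Qed.

End InnerProduct.

(** * Linear differential equations *)

Section L1Norm.
Context {R : realType}.
Local Notation C := R[i].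

(** The sum norm over real coordinates is real-valued and submultiplicative, as the differential
    inequalities below require. *)
Definition nrm p q (M : 'M[C]_(p, q)) : R := \sum_i \sum_j (`|Re (M i j)| + `|Im (M i j)|).

Lemma nrm_ge0 p q (M : 'M[C]_(p, q)) : 0 <= nrm M.
Proof. by apply: sumr_ge0 => i _; apply: sumr_ge0 => j _; rewrite addr_ge0. Qed.
Lemma nrm0 p q : nrm (0 : 'M[C]_(p, q)) = 0.
Proof. by apply: big1 => i _; apply: big1 => j _; rewrite mxE /= normr0 addr0. Qed.
Lemma nrmN p q (M : 'M[C]_(p, q)) : nrm (- M) = nrm M.
Proof.
by apply: eq_bigr => i _; apply: eq_bigr => j _; rewrite mxE cReN cImN !normrN.
Qed.
Lemma nrmD p q (M N : 'M[C]_(p, q)) : nrm (M + N) <= nrm M + nrm N.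
Proof.
rewrite /nrm -big_split; apply: ler_sum => i _; rewrite -big_split; apply: ler_sum => j _ /=.
by rewrite mxE cReD cImD addrACA; apply: lerD; exact: ler_normD.
Qed.
Lemma nrmB p q (M N : 'M[C]_(p, q)) : nrm (M - N) <= nrm M + nrm N.
Proof. by rewrite -(nrmN N) nrmD. Qed.
Lemma nrmBC p q (M N : 'M[C]_(p, q)) : nrm (M - N) = nrm (N - M).
Proof. by rewrite -nrmN opprB. Qed.
Lemma nrm_entry p q (M : 'M[C]_(p, q)) i j : `|Re (M i j)| + `|Im (M i j)| <= nrm M.
Proof.
rewrite /nrm (bigD1 i)//= (bigD1 j)//=.
apply: (@le_trans _ _ (`|Re (M i j)| + `|Im (M i j)| +
  \sum_(k | k != j) (`|Re (M i k)| + `|Im (M i k)|))); rewrite lerDl.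
- by apply: sumr_ge0 => k _; rewrite addr_ge0.
- by apply: sumr_ge0 => k _; apply: sumr_ge0 => l _; rewrite addr_ge0.
Qed.
Lemma nrm_Re p q (M : 'M[C]_(p, q)) i j : `|Re (M i j)| <= nrm M.
Proof. by apply: le_trans (nrm_entry M i j); rewrite lerDl. Qed.
Lemma nrm_Im p q (M : 'M[C]_(p, q)) i j : `|Im (M i j)| <= nrm M.
Proof. by apply: le_trans (nrm_entry M i j); rewrite lerDr. Qed.
Lemma nrm_le p q (M : 'M[C]_(p, q)) (e : R) :
  (forall i j, `|Re (M i j)| <= e /\ `|Im (M i j)| <= e) ->
  nrm M <= (2 * p * q)%:R * e.
Proof.
move=> h; rewrite /nrm.
have -> : (2 * p * q)%:R * e = \sum_(i < p) \sum_(j < q) (e + e).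
  rewrite !sumr_const !card_ord -mulr2n -!mulrnA mulr_natl; congr (_ *+ _); lia.
by apply: ler_sum => i _; apply: ler_sum => j _; have [h1 h2] := h i j; apply: lerD.
Qed.
Lemma nrmM p q r (M : 'M[C]_(p, q)) (N : 'M[C]_(q, r)) : nrm (M *m N) <= nrm M * nrm N.
Proof.
pose c (z : C) := `|Re z| + `|Im z|.
have c0 z : 0 <= c z by rewrite addr_ge0.
have cD y z : c (y + z) <= c y + c z.
  by rewrite /c cReD cImD addrACA; apply: lerD; exact: ler_normD.
have cM y z : c (y * z) <= c y * c z.
  rewrite /c cReM cImM; apply: (le_trans (lerD (ler_normB _ _) (ler_normD _ _))).
  by rewrite !normrM le_eqVlt; apply/orP; left; apply/eqP; ring.
have cS (I : finType) (F : I -> C) : c (\sum_i F i) <= \sum_i c (F i).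
  elim/big_rec2: _ => [|i a b _ h]; first by rewrite /c /= normr0 addr0.
  by apply: (le_trans (cD _ _)); rewrite lerD2l.
apply: (@le_trans _ _ (\sum_i \sum_j \sum_k c (M i k) * c (N k j))).
  apply: ler_sum => i _; apply: ler_sum => j _; rewrite -/(c _) mxE.
  by apply: (le_trans (cS _ _)); apply: ler_sum => k _; exact: cM.
rewrite /nrm mulr_suml; apply: ler_sum => i _.
rewrite exchange_big mulr_suml /=; apply: ler_sum => k _.
rewrite -mulr_sumr ler_wpM2l//.
by rewrite (bigD1 k)//= lerDl sumr_ge0// => l _; apply: sumr_ge0.
Qed.

(** [hdR_mvt] is applied to each of the [2 * p * q] real coordinates, whence the factor. *)
Lemma HD_mvt p q (f df : R -> 'M[C]_(p, q)) (g dg : R -> R) (a b : R) : 0 <= a -> a <= b ->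
  (forall x, a <= x <= b -> HD f x (df x)) ->
  (forall x, a <= x <= b -> hdR g x (dg x)) ->
  (forall x, a <= x <= b -> nrm (df x) <= dg x) ->
  nrm (f b - f a) <= (2 * p * q)%:R * (g b - g a).
Proof.
move=> a0 ab hf hg hd; apply: nrm_le => i j; rewrite !mxE cReD cReN cImD cImN; split.
- apply: (@hdR_mvt _ (fun y => Re (f y i j)) g (fun y => Re (df y i j)) dg a b) => //.
  + by move=> x xab; apply: HD_Re; exact: hf.
  + by move=> x xab; apply: le_trans (hd _ xab); exact: nrm_Re.
- apply: (@hdR_mvt _ (fun y => Im (f y i j)) g (fun y => Im (df y i j)) dg a b) => //.
  + by move=> x xab; apply: HD_Im; exact: hf.
  + by move=> x xab; apply: le_trans (hd _ xab); exact: nrm_Im.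
Qed.

Definition mcont p q (f : R -> 'M[C]_(p, q)) := forall x, 0 <= x -> mcvg (hl_filter x) f (f x).

Lemma mcvg_nrm T (F : set_system T) {FF : Filter F} p q (f : T -> 'M[C]_(p, q)) M :
  mcvg F f M <-> nrm (f t - M) @[t --> F] --> (0 : R).
Proof.
split=> [h|h i j].
  apply/cvgrPdist_le => e e0; pose d := e / (2 * p * q).+1%:R.
  have d0 : 0 < d by rewrite divr_gt0.
  have H i j : \forall t \near F,
      `|Re ((f t - M) i j)| <= d /\ `|Im ((f t - M) i j)| <= d.
    have [/cvgrPdist_le /(_ _ d0) h1 /cvgrPdist_le /(_ _ d0) h2] := h i j.
    apply: filterS2 h1 h2 => t h1 h2; split; rewrite !mxE.
    - by rewrite cReD cReN distrC.
    - by rewrite cImD cImN distrC.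
  have : \forall t \near F, forall ij : 'I_p * 'I_q,
     `|Re ((f t - M) ij.1 ij.2)| <= d /\ `|Im ((f t - M) ij.1 ij.2)| <= d.
    by apply: filter_forall => -[i j] /=.
  apply: filterS => t Ht; rewrite sub0r normrN ger0_norm ?nrm_ge0//.
  apply: (@le_trans _ _ ((2 * p * q)%:R * d)).
    by apply: nrm_le => i j; exact: (Ht (i, j)).
  by rewrite /d mulrA ler_pdivrMr// mulrC ler_pM2l// ler_nat.
split; apply/cvgrPdist_le => e e0; move/cvgrPdist_le : h => /(_ _ e0);
  apply: filterS => t; rewrite sub0r normrN ger0_norm ?nrm_ge0// => h.
- by apply: le_trans h; have := nrm_Re (f t - M) i j; rewrite !mxE cReD cReN distrC.
- by apply: le_trans h; have := nrm_Im (f t - M) i j; rewrite !mxE cImD cImN distrC.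
Qed.

Lemma mcvg_hlP p q (f : R -> 'M[C]_(p, q)) x M :
  mcvg (hl_filter x) f M <->
  forall e, 0 < e -> exists2 d, 0 < d &
    forall y, 0 <= y -> y != x -> `|y - x| < d -> nrm (f y - M) <= e.
Proof.
split.
  move=> /mcvg_nrm /hl_cvgP h e e0; have [d d0 H] := h _ e0; exists d => // y y0 yx yd.
  by have := H _ y0 yx yd; rewrite subr0 ger0_norm ?nrm_ge0.
move=> h; apply/mcvg_nrm/hl_cvgP => e e0; have [d d0 H] := h _ e0; exists d => // y y0 yx yd.
by rewrite subr0 ger0_norm ?nrm_ge0//; exact: H.
Qed.

Lemma mcontP p q (f : R -> 'M[C]_(p, q)) x : 0 <= x -> mcont f ->
  forall e, 0 < e -> exists2 d, 0 < d &
    forall y, 0 <= y -> `|y - x| < d -> nrm (f y - f x) <= e.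
Proof.
move=> x0 /(_ _ x0) /mcvg_hlP h e e0; have [d d0 H] := h _ e0; exists d => // y y0 yd.
have [->|yx] := eqVneq y x; first by rewrite subrr nrm0 ltW.
exact: H.
Qed.

Lemma mcont_bounded p q (f : R -> 'M[C]_(p, q)) (T : R) : 0 <= T -> mcont f ->
  exists2 L, 0 < L & forall x, 0 <= x <= T -> nrm (f x) <= L.
Proof.
move=> T0 hf.
(* Boundedness is phrased as [nrm (f x) * d <= 1], which persists when [d] shrinks; a uniform [d]
   then gives the bound [d^-1]. *)
have [||d d0 Hd] := @uniform_of_local R 0 T (fun x d => nrm (f x) * d <= 1) T0.
- by move=> x d d' dd'; apply: le_trans; rewrite ler_wpM2l ?nrm_ge0.
- move=> x /andP[x0 xT]; have [d d0 H] := mcontP x0 hf ltr01.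
  pose M := nrm (f x) + 1.
  have M0 : 0 < M by rewrite ltr_pwDr// nrm_ge0.
  exists (Num.min d M^-1) => [|y /andP[y0 yT]]; first by rewrite lt_min d0 invr_gt0.
  rewrite lt_min => /andP[yd _].
  apply: (@le_trans _ _ (M * M^-1)); last by rewrite divff ?gt_eqF.
  apply: ler_pM; rewrite ?nrm_ge0//.
  + by rewrite le_min (ltW d0) invr_ge0 ltW.
  + rewrite -[f y](subrK (f x)); apply: (le_trans (nrmD _ _)).
    by rewrite /M addrC lerD2l H.
  + by rewrite ge_min lexx orbT.
exists d^-1 => [|x xT]; first by rewrite invr_gt0.
by rewrite -[leRHS]mul1r ler_pdivlMr// Hd.
Qed.

Lemma HD_mcont p q (f df : R -> 'M[C]_(p, q)) :
  (forall x, 0 <= x -> HD f x (df x)) -> mcont f.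
Proof. by move=> h x x0; apply: HD_cont; exact: h. Qed.
Lemma mcontM p q r (f : R -> 'M[C]_(p, q)) (g : R -> 'M[C]_(q, r)) :
  mcont f -> mcont g -> mcont (fun x => f x *m g x).
Proof. by move=> h k x x0; apply: mcvgM; [exact: h|exact: k]. Qed.

End L1Norm.

Section Antiderivative.
Context {R : realType}.
Local Notation C := R[i].
Local Notation mu := (@lebesgue_measure R).

Lemma hdR_Rintegral (g : R -> R) (x : R) :
  (forall y, 0 <= y -> g @ hl_filter y --> g y) -> 0 <= x ->
  hdR (fun z => \int[mu]_(y in `[0, z]) g y) x (g x).
Proof.
(* [g] is controlled on the half-line only. Freezing it at [g 0] on the left makes it continuous on
   the whole line, and integrating from -1 makes [x = 0] an interior point for the fundamental
   theorem. *)
move=> gc x0; pose h y := g (Num.max y 0).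
have hc : continuous h.
  move=> y; apply/cvgrPdist_le => e e0.
  have m0 : 0 <= Num.max y 0 by rewrite le_max lexx orbT.
  have /hl_cvgP /(_ _ e0)[d d0 H] := gc _ m0.
  apply/nbhs_ballP; exists d => //= z; rewrite /ball /= => zd.
  rewrite distrC; have [zy|zy] := eqVneq (Num.max z 0) (Num.max y 0).
    by rewrite /h zy subrr normr0 ltW.
  apply: H => //; first by rewrite le_max lexx orbT.
  apply: le_lt_trans zd; rewrite distrC.
  rewrite !maxEle; case: ifP => a; case: ifP => b; rewrite ?subrr ?normr0//.
  - move/negbT: b; rewrite -ltNge => b; rewrite sub0r normrN (gtr0_norm b) distrC.
    by rewrite (le_trans _ (ler_norm _))//; lra.
  - move/negbT: a; rewrite -ltNge => a; rewrite subr0 (gtr0_norm a).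
    by rewrite (le_trans _ (ler_norm _))//; lra.
pose H z := \int[mu]_(y in `[-1, z]) h y.
have hint a b : mu.-integrable `[a, b] (EFin \o h).
  apply: continuous_compact_integrable; first exact: segment_compact.
  by apply: continuous_subspaceT; exact: hc.
have E z : 0 <= z -> \int[mu]_(y in `[0, z]) g y = H z - H 0.
  move=> z0.
  have -> : \int[mu]_(y in `[0, z]) g y = \int[mu]_(y in `[0, z]) h y.
    apply: eq_Rintegral => y; rewrite inE/= in_itv/= => /andP[y0 _].
    by rewrite /h max_l.
  rewrite /H (@Rintegral_itvB _ h (BLeft (-1)) (BRight z) 0)//; last first.
  - by rewrite bnd_simp; lra.
  - by rewrite Rintegral_itv_obnd_cbnd//; apply: integrableS (hint 0 z) => //; exact: subset_itv_oc_cc.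
have [||||/= dH H'] := @continuous_FTC1_closed R h (-1) x (x + 1).
- by rewrite ltrDl.
- exact: hint.
- by lra.
- exact: hc.
have dH2 : is_derive x 1 H (h x).
  by split; [exact: dH | rewrite -derive1E].
have := hdRB (hdR_is_derive dH2) (hdR_cst (H 0) x).
rewrite subr0 {1}/h max_l// => /hdRP D; apply/hdRP => e e0.
have [d d0 D'] := D e e0; exists d => // y y0 yd.
by rewrite !E//; exact: D'.
Qed.

Lemma HD_mintegral p q (f : R -> 'M[C]_(p, q)) x : mcont f -> 0 <= x ->
  HD (mintegral f) x (f x).
Proof.
move=> fc x0; apply/HDP => i j; split.
- rewrite /mintegral; under eq_fun do rewrite mxE /=.
  by apply: hdR_Rintegral => // y y0; have [] := fc y y0 i j.
- rewrite /mintegral; under eq_fun do rewrite mxE /=.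
  by apply: hdR_Rintegral => // y y0; have [] := fc y y0 i j.
Qed.

Lemma mintegral0 p q (f : R -> 'M[C]_(p, q)) : mintegral f 0 = 0.
Proof.
apply/matrixP => i j; rewrite !mxE set_itv1 /Rintegral !integral_set1.
by apply: Complex_eq.
Qed.

End Antiderivative.

Section GeometricConvergence.
Context {R : realType}.
Local Notation C := R[i].

(** Nested intervals: [e k] is the sum of the bounds on all increments from step [k] on, so the
    intervals of radius [e k] about [u k] decrease and share a point. *)
Lemma geometric_limit (u : nat -> R) (B : R) :
  (forall k, `|u k.+1 - u k| <= B / 2 ^+ k) ->
  exists l, forall k, `|u k - l| <= 2 * B / 2 ^+ k.
Proof.
move=> H; pose e k : R := 2 * B / 2 ^+ k.
have eS k : e k.+1 = B / 2 ^+ k.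
  by rewrite /e exprS; field; rewrite gt_eqF// exprn_gt0.
have eD k : e k = e k.+1 + B / 2 ^+ k.
  by rewrite eS /e; field; rewrite gt_eqF// exprn_gt0.
have lo : {homo (fun k => u k - e k) : k l / (k <= l)%N >-> k <= l}.
  apply: homo_leq => [//|y x z|k]; first exact: le_trans.
  by have := H k; rewrite ler_norml eD => /andP[h1 h2]; lra.
have hi : {homo (fun k => u k + e k) : k l / (k <= l)%N >-> l <= k}.
  apply: homo_leq => [//|y x z h1 h2|k]; first exact: le_trans h2 h1.
  by have := H k; rewrite ler_norml [e k]eD => /andP[h1 h2]; lra.
have e0 k : 0 <= e k.
  rewrite /e; apply: divr_ge0; last by rewrite exprn_ge0.
  have := le_trans (normr_ge0 _) (H 0%N); rewrite expr0 divr1; lra.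
have lh k l : u k - e k <= u l + e l.
  case: (leqP k l) => kl.
  - by have := lo _ _ kl; have := e0 l; lra.
  - by have := hi _ _ (ltnW kl); have := e0 k; lra.
pose S := [set u k - e k | k in setT].
have hS : has_sup S.
  split; first by exists (u 0%N - e 0%N), 0%N.
  by exists (u 0%N + e 0%N) => _ [k _ <-].
exists (sup S) => k; rewrite -/(e k) ler_norml; apply/andP; split.
- have : sup S <= u k + e k by apply: ge_sup; [case: hS | move=> _ [l _ <-]].
  lra.
- have : u k - e k <= sup S by apply: ub_le_sup; [case: hS | exists k].
  lra.
Qed.

Lemma geometric_small (B e : R) : 0 < e -> exists K, forall k, (K <= k)%N -> B / 2 ^+ k <= e.
Proof.
move=> e0; have [B0|B0] := leP B 0.
  exists 0%N => k _; apply: le_trans (ltW e0).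
  by rewrite ler_pdivrMr ?exprn_gt0// mul0r.
have [K HK] : exists K : nat, B / e <= K%:R.
  by exists (Num.truncn (B / e)).+1; apply: ltW; exact: truncnS_gt.
exists K => k kK; rewrite ler_pdivrMr ?exprn_gt0// mulrC -ler_pdivrMr//.
apply: (le_trans HK); rewrite -natrX ler_nat.
by apply: (leq_trans kK); apply: ltnW; exact: ltn_expl.
Qed.

(** The mean value inequality compares the difference quotients of every late [f k] with [G x],
    within a radius that does not depend on [k]; the limit in [k] is taken last. *)
Lemma hdR_limit (f g : nat -> R -> R) (F G : R -> R) :
  (forall k x, 0 <= x -> hdR (f k) x (g k x)) ->
  (forall k x, 0 <= x -> g k @ hl_filter x --> g k x) ->
  (forall x e, 0 <= x -> 0 < e -> exists K, forall k, (K <= k)%N -> `|f k x - F x| <= e) ->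
  (forall T e, 0 <= T -> 0 < e -> exists K, forall k, (K <= k)%N -> forall x, 0 <= x <= T ->
      `|g k x - G x| <= e) ->
  forall x, 0 <= x -> hdR F x (G x).
Proof.
move=> fg gc fF gG x x0; apply/hdRP => e e0.
have e4 : 0 < e / 4 by rewrite divr_gt0.
have T0 : 0 <= x + 1 by rewrite addr_ge0 ?ler01.
have [K HK] := gG _ _ T0 e4.
have /hl_cvgP /(_ _ e4)[d d0 Hd] := gc K x x0.
exists (Num.min d 1) => [|y y0]; first by rewrite lt_min d0 ltr01.
rewrite lt_min => /andP[yd y1].
have near_x s : 0 <= s -> `|s - x| <= `|y - x| -> 0 <= s <= x + 1.
  move=> s0 sy; rewrite s0 -lerBlDl (le_trans (ler_norm _))// (le_trans sy)//.
  exact: ltW.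
(* Four errors of [e / 4]: from [g k] to [G] at [s], back to [g K] at [s], from [s] to [x] for
   [g K], and from [g K] to [G] at [x]. *)
have dG k s : (K <= k)%N -> 0 <= s -> `|s - x| <= `|y - x| -> `|g k s - G x| <= e.
  move=> kK s0 sy; have sT := near_x _ s0 sy.
  have xT : 0 <= x <= x + 1 by rewrite x0 lerDl ler01.
  have := HK k kK s sT; have := HK K (leqnn _) s sT; have := HK K (leqnn _) x xT.
  have : `|g K s - g K x| <= e / 4.
    have [->|sx] := eqVneq s x; first by rewrite subrr normr0 ltW.
    by apply: Hd => //; apply: le_lt_trans yd.
  rewrite !ler_norml => /andP[? ?] /andP[? ?] /andP[? ?] /andP[? ?].
  by apply/andP; split; lra.
have main k : (K <= k)%N -> `|f k y - f k x - G x * (y - x)| <= e * `|y - x|.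
  move=> kK; have [xy|yx] := leP x y.
    rewrite [`|y - x|]ger0_norm ?subr_ge0//.
    apply: (@hdR_mvt_lin _ (f k) (g k)) => // s /andP[xs sy].
      by apply: fg; exact: le_trans xs.
    have s0 : 0 <= s by exact: le_trans xs.
    apply: dG => //; rewrite ger0_norm ?subr_ge0// ger0_norm ?subr_ge0//.
    by rewrite lerB.
  have yx' := ltW yx.
  rewrite [`|y - x|]distrC [`|x - y|]ger0_norm ?subr_ge0//.
  rewrite (_ : f k y - f k x - G x * (y - x) = - (f k x - f k y - G x * (x - y))); last by ring.
  rewrite normrN; apply: (@hdR_mvt_lin _ (f k) (g k)) => // s /andP[ys sx].
    by apply: fg; exact: le_trans ys.
  have s0 : 0 <= s by exact: le_trans ys.
  apply: dG => //; rewrite distrC ger0_norm ?subr_ge0// distrC ger0_norm ?subr_ge0//.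
  by rewrite lerB.
apply/ler_addgt0Pl => eta eta0.
have eta2 : 0 < eta / 2 by rewrite divr_gt0.
have [K1 HK1] := fF y _ y0 eta2; have [K2 HK2] := fF x _ x0 eta2.
pose k := maxn K (maxn K1 K2).
have := main k (leq_maxl _ _).
have := HK1 k; rewrite /k !leq_max leqnn !orbT => /(_ isT).
have := HK2 k; rewrite /k !leq_max leqnn !orbT => /(_ isT).
rewrite -/k; move: (f k x) (f k y) => fx fy.
rewrite [in X in X -> _]ler_norml => /andP[h1 h2].
rewrite [in X in X -> _]ler_norml => /andP[h3 h4].
move: (e * _) => E.
rewrite ![in X in X -> _]ler_norml => /andP[h5 h6].
by rewrite ler_norml; apply/andP; split; lra.
Qed.

End GeometricConvergence.

Lemma mxBE {V : zmodType} p q (M N : 'M[V]_(p, q)) i j : (M - N) i j = M i j - N i j.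
Proof. by rewrite mxE [(- N) i j]mxE. Qed.

(** * Picard iteration for linear systems *)

Section Picard.
Context {R : realType}.
Local Notation C := R[i].
Variables (p q : nat) (A : R -> 'M[C]_p) (Y : nat -> R -> 'M[C]_(p, q)).
Hypothesis Ac : mcont A.
Hypothesis Y0 : forall x, Y 0%N x = Y 0%N 0.
Hypothesis YS : forall k x, 0 <= x -> HD (Y k.+1) x (A x *m Y k x).
Hypothesis Yi : forall k, Y k.+1 0 = Y 0%N 0.

Lemma picard_cont k : mcont (Y k).
Proof.
case: k => [|k]; last exact: HD_mcont (YS k).
move=> x x0; rewrite (_ : Y 0%N = fun=> Y 0%N 0); last by apply/funext.
exact: mcvg_cst.
Qed.

(* In the norm weighted by [expR (c * x)] each Picard step contracts by 1/2. *)
Lemma picard_step (T : R) : 0 <= T ->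
  exists B, forall k x, 0 <= x <= T -> nrm (Y k.+1 x - Y k x) <= B / 2 ^+ k.
Proof.
move=> T0; have [L L0 HL] := mcont_bounded T0 Ac.
pose P : R := (2 * p * q).+1%:R; have P0 : 0 < P by [].
(* Chosen so that the factor [P * L / c] gained in one step is 1/2; [P] accounts for the constant of
   [HD_mvt]. *)
pose c := 2 * P * L; have c0 : 0 < c by rewrite !mulr_gt0.
pose B := P * L * nrm (Y 0%N 0) * T.
have B0 : 0 <= B by rewrite !mulr_ge0 ?nrm_ge0// ltW.
have PP (r : R) : 0 <= r -> (2 * p * q)%:R * r <= P * r.
  by move=> r0; rewrite ler_wpM2r// ler_nat leqnSn.
suff H k x : 0 <= x <= T -> nrm (Y k.+1 x - Y k x) <= B / 2 ^+ k * expR (c * x).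
  exists (B * expR (c * T)) => k x xT; apply: (le_trans (H k x xT)).
  rewrite mulrAC ler_wpM2r ?invr_ge0 ?exprn_ge0// ler_wpM2l// ler_expR.
  by apply: ler_wpM2l; [exact: ltW | case/andP: xT].
elim: k x => [|k IH] x /andP[x0 xT].
  rewrite expr0 divr1 (Y0 x) -(Yi 0).
  apply: (@le_trans _ _ B); last first.
    by rewrite ler_peMr// -expR0 ler_expR mulr_ge0// ltW.
  pose b := L * nrm (Y 0%N 0).
  have b0 : 0 <= b by rewrite mulr_ge0 ?nrm_ge0// ltW.
  apply: (@le_trans _ _ ((2 * p * q)%:R * (b * x - b * 0))).
    apply: (@HD_mvt _ _ _ (Y 1%N) (fun s => A s *m Y 0%N s) (fun s => b * s) (fun=> b) 0 x) => //.
    - by move=> s /andP[s0 _]; exact: YS.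
    - by move=> s _; exact: hdR_lin.
    - move=> s /andP[s0 sx]; apply: (le_trans (nrmM _ _)); rewrite (Y0 s).
      by rewrite ler_wpM2r ?nrm_ge0// HL// s0 (le_trans sx).
  rewrite mulr0 subr0; apply: le_trans (PP _ _) _; first by rewrite mulr_ge0.
  rewrite (_ : B = P * (b * T)); last by rewrite /B /b; ring.
  by apply: ler_wpM2l; [exact: ltW | exact: ler_wpM2l].
pose b := L * (B / 2 ^+ k).
have b0 : 0 <= b by rewrite mulr_ge0 ?divr_ge0 ?exprn_ge0// ltW.
have D : nrm ((Y k.+2 x - Y k.+1 x) - (Y k.+2 0 - Y k.+1 0)) <=
    (2 * p * q)%:R * (b / c * expR (c * x) - b / c * expR (c * 0)).
  apply: (@HD_mvt _ _ _ (fun s => Y k.+2 s - Y k.+1 s)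
    (fun s => A s *m Y k.+1 s - A s *m Y k s)
    (fun s => b / c * expR (c * s)) (fun s => b / c * (c * expR (c * s))) 0 x) => //.
  - by move=> s /andP[s0 _]; apply: HDB; exact: YS.
  - by move=> s _; apply: hdRZ; exact: hdR_expR.
  - move=> s /andP[s0 sx]; rewrite -mulmxBr; apply: (le_trans (nrmM _ _)).
    have sT : 0 <= s <= T by rewrite s0 (le_trans sx).
    rewrite mulrA divfK ?gt_eqF// /b -mulrA.
    by apply: ler_pM; rewrite ?nrm_ge0//; [exact: HL|exact: IH].
move: D; rewrite !Yi subrr subr0 => /le_trans; apply.
have E0 : 0 <= b / c * expR (c * x) - b / c * expR (c * 0).
  rewrite subr_ge0; apply: ler_wpM2l; first by apply: divr_ge0 => //; exact: ltW.
  by rewrite ler_expR; apply: ler_wpM2l => //; exact: ltW.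
apply: (le_trans (PP _ E0)).
have -> : B / 2 ^+ k.+1 * expR (c * x) = P * (b / c * expR (c * x)).
  rewrite /b /c exprS; field.
  by rewrite !gt_eqF// exprn_gt0.
apply: ler_wpM2l; first exact: ltW.
rewrite gerBl; apply: mulr_ge0; last exact: expR_ge0.
by apply: divr_ge0 => //; exact: ltW.
Qed.

(** The iterates are abstract because two sequences are used: successive integrals for a variable
    coefficient in [linear_ode], and the partial sums of the exponential series in [mexp_ode]. *)
Lemma picard : exists Z : R -> 'M[C]_(p, q),
  [/\ forall x, 0 <= x -> HD Z x (A x *m Z x), Z 0 = Y 0%N 0 &
      forall x, 0 <= x -> mcvg \oo (Y^~ x) (Z x)].
Proof.
have /choice[Br HBr] : forall T, exists B, 0 <= T ->
   forall k x, 0 <= x <= T -> nrm (Y k.+1 x - Y k x) <= B / 2 ^+ k.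
  move=> T.
  have [T0|T0] := leP 0 T; last by exists 0 => h; lra.
  by have [B HB] := picard_step T0; exists B.
pose part (b : bool) (z : C) := if b then Re z else Im z.
have partB b (y z : C) : part b (y - z) = part b y - part b z.
  by case: b; rewrite /= ?cReD ?cReN ?cImD ?cImN.
have part_le b (M : 'M[C]_(p, q)) i j : `|part b (M i j)| <= nrm M.
  by case: b; [exact: nrm_Re|exact: nrm_Im].
have steps x T b i j k : 0 <= x <= T ->
    `|part b (Y k.+1 x i j) - part b (Y k x i j)| <= Br T / 2 ^+ k.
  move=> xT; have T0 : 0 <= T by case/andP: xT => /le_trans; apply.
  apply: le_trans (HBr T T0 k x xT); rewrite -partB.
  by apply: le_trans (part_le b _ i j); rewrite !mxE.
have /choice[l Hl] : forall v : R * (bool * ('I_p * 'I_q)), exists l, 0 <= v.1 ->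
   forall k, `|part v.2.1 (Y k v.1 v.2.2.1 v.2.2.2) - l| <= 2 * Br v.1 / 2 ^+ k.
  move=> [x [b [i j]]] /=; have [x0|x0] := leP 0 x; last by exists 0 => h; lra.
  have [|l Hl] := @geometric_limit R (fun k => part b (Y k x i j)) (Br x).
    by move=> k; apply: steps; rewrite x0 lexx.
  by exists l.
pose Z x : 'M[C]_(p, q) := \matrix_(i, j) (l (x, (true, (i, j))) +i* l (x, (false, (i, j)))).
have YZ x b i j k : 0 <= x -> `|part b (Y k x i j) - part b (Z x i j)| <= 2 * Br x / 2 ^+ k.
  by move=> x0; rewrite mxE; case: b; [have := Hl (x, (true, (i, j))) x0 k|have := Hl (x, (false, (i, j))) x0 k].
(* The constant in [YZ] depends on [x]. On [[0, T]] the increments have the common bound [Br T], and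
   the limit obtained from it must be the one already chosen. *)
have YZu T x b i j k : 0 <= x <= T ->
    `|part b (Y k x i j) - part b (Z x i j)| <= 2 * Br T / 2 ^+ k.
  move=> xT; have x0 : 0 <= x by case/andP: xT.
  have [|l' Hl'] := @geometric_limit R (fun k => part b (Y k x i j)) (Br T).
    by move=> k'; exact: steps.
  suff <- : l' = part b (Z x i j) by [].
  apply/eqP; rewrite -subr_eq0 -normr_le0; apply/ler_addgt0Pl => e e0; rewrite addr0.
  have e2 : 0 < e / 2 by rewrite divr_gt0.
  have [K1 HK1] := geometric_small (2 * Br T) e2.
  have [K2 HK2] := geometric_small (2 * Br x) e2.
  have := le_trans (Hl' (maxn K1 K2)) (HK1 _ (leq_maxl _ _)).
  have := le_trans (YZ x b i j (maxn K1 K2) x0) (HK2 _ (leq_maxr _ _)).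
  rewrite !ler_norml => /andP[h1 h2] /andP[h3 h4]; apply/andP; split; lra.
have YZn T e : 0 <= T -> 0 < e -> exists K, forall k, (K <= k)%N -> forall x, 0 <= x <= T ->
    nrm (Y k x - Z x) <= e.
  move=> T0 e0; have [K HK] := geometric_small ((2 * p * q)%:R * (2 * Br T)) e0.
  exists K => k kK x xT; apply: le_trans (HK k kK); rewrite -mulrA.
  apply: nrm_le => i j.
  by split; [have := YZu T x true i j k xT|have := YZu T x false i j k xT]; rewrite -partB /= !mxE.
exists Z; split.
- have AYc k : mcont (fun x => A x *m Y k x) by apply: mcontM => //; exact: picard_cont.
  have AZ b T e i j : 0 <= T -> 0 < e -> exists K, forall k, (K <= k)%N -> forall x, 0 <= x <= T ->
      `|part b ((A x *m Y k x) i j) - part b ((A x *m Z x) i j)| <= e.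
    move=> T0 e0; have [L L0 HL] := mcont_bounded T0 Ac.
    have eL : 0 < e / L by rewrite divr_gt0.
    have [K HK] := YZn _ _ T0 eL; exists K => k kK x xT.
    rewrite -partB; apply: (@le_trans _ _ (nrm (A x *m (Y k x - Z x)))).
      by have := part_le b (A x *m (Y k x - Z x)) i j; rewrite mulmxBr mxBE.
    apply: (le_trans (nrmM _ _)); rewrite -[leRHS](divfK (lt0r_neq0 L0)) [leRHS]mulrC.
    by apply: ler_pM; rewrite ?nrm_ge0//; [exact: HL|exact: HK].
  have lim b i j x : 0 <= x ->
     hdR (fun x => part b (Z x i j)) x (part b ((A x *m Z x) i j)).
    apply: (@hdR_limit _ (fun k x => part b (Y k.+1 x i j)) (fun k x => part b ((A x *m Y k x) i j))
       _ (fun x => part b ((A x *m Z x) i j))).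
    + by move=> k y y0; case: b; [apply: HD_Re|apply: HD_Im]; exact: YS.
    + by move=> k y y0; have [h1 h2] := AYc k y y0 i j; case: b.
    + move=> y e y0 e0; have [K HK] := YZn y e y0 e0; exists K => k kK.
      rewrite -partB; apply: le_trans (HK k.+1 (leqW kK) y _); last by rewrite y0 lexx.
      by apply: le_trans (part_le b _ i j); rewrite !mxE.
    + move=> T e T0 e0; exact: AZ.
  by move=> x x0; apply/HDP => i j; split; [exact: (lim true)|exact: (lim false)].
- apply/matrixP => i j; apply: Complex_eq.
  + apply/eqP; rewrite -subr_eq0 -normr_le0; apply/ler_addgt0Pl => e e0; rewrite addr0.
    have [K HK] := YZn 0 e (lexx _) e0.
    have := HK K.+1 (leqW (leqnn _)) 0; rewrite lexx Yi => /(_ isT); apply: le_trans.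
    by have := part_le true (Y 0%N 0 - Z 0) i j; rewrite mxBE partB distrC.
  + apply/eqP; rewrite -subr_eq0 -normr_le0; apply/ler_addgt0Pl => e e0; rewrite addr0.
    have [K HK] := YZn 0 e (lexx _) e0.
    have := HK K.+1 (leqW (leqnn _)) 0; rewrite lexx Yi => /(_ isT); apply: le_trans.
    by have := part_le false (Y 0%N 0 - Z 0) i j; rewrite mxBE partB distrC.
- move=> x x0; apply/mcvg_nrm/cvgrPdist_le => e e0.
  have [K HK] := YZn x e x0 e0; exists K => // k /= kK.
  by rewrite sub0r normrN ger0_norm ?nrm_ge0// HK// x0 lexx.
Qed.

End Picard.

Section LinearODE.
Context {R : realType}.
Local Notation C := R[i].

Lemma linear_ode p q (A : R -> 'M[C]_p) (c : 'M[C]_(p, q)) : mcont A ->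
  exists2 Z : R -> 'M[C]_(p, q), Z 0 = c & forall x, 0 <= x -> HD Z x (A x *m Z x).
Proof.
move=> Ac.
pose Y := fix Y k : R -> 'M[C]_(p, q) := if k is k'.+1 then
    fun x => c + mintegral (fun s => A s *m Y k' s) x else fun=> c.
have Yc k : mcont (Y k) /\ forall x, 0 <= x -> HD (Y k.+1) x (A x *m Y k x).
  elim: k => [|k [IH1 IH2]].
    have c0 : mcont (Y 0%N) by move=> x x0; exact: mcvg_cst.
    split => // x x0; apply: HD_eq (HDD (HD_cst c x) (HD_mintegral (mcontM Ac c0) x0)) _.
    by rewrite add0r.
  have cS : mcont (Y k.+1) by exact: HD_mcont IH2.
  split => // x x0; apply: HD_eq (HDD (HD_cst c x) (HD_mintegral (mcontM Ac cS) x0)) _.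
  by rewrite add0r.
have [|||Z [Z1 Z2 _]] := @picard R p q A Y Ac; last by exists Z.
- by [].
- by move=> k x x0; exact: (Yc k).2.
- by move=> k /=; rewrite mintegral0 addr0.
Qed.

Lemma hdR_expn_fact j (x : R) :
  hdR (fun y => y ^+ j.+1 / (j.+1)`!%:R) x (x ^+ j / j`!%:R).
Proof.
have H : hdR (fun y => y ^+ j.+1) x (j.+1%:R * x ^+ j).
  elim: j => [|j IH].
    by rewrite expr0 mulr1; exact: hdR_id.
  have := hdRM (hdR_id x) IH; rewrite /=.
  under eq_fun do rewrite -exprS; move=> h; apply: (hdR_eq h).
  by rewrite mul1r mulrCA -exprS -[in RHS]natr1 mulrDl mul1r addrC.
have := hdRZ (c := (j.+1)`!%:R^-1) H.
under eq_fun do rewrite mulrC.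
move=> h; apply: (hdR_eq h); rewrite factS natrM.
by rewrite invfM mulrACA mulVf ?pnatr_eq0// mul1r mulrC.
Qed.

Lemma HD_scalR p q (r : R -> R) (M : 'M[C]_(p, q)) x d : hdR r x d ->
  HD (fun y => (r y)%:C *: M) x (d%:C *: M).
Proof.
move=> h; apply/HDP => i j; split.
- under eq_fun do rewrite mxE cReM /= mul0r subr0 mulrC.
  by rewrite mxE cReM /= mul0r subr0 mulrC; exact: hdRZ.
- under eq_fun do rewrite mxE cImM /= mul0r addr0 mulrC.
  by rewrite mxE cImM /= mul0r addr0 mulrC; exact: hdRZ.
Qed.

Lemma expmxZ p (a : C) (B : 'M[C]_p) j : (a *: B) ^+ j = a ^+ j *: B ^+ j.
Proof.
elim: j => [|j IH]; first by rewrite !expr0 scale1r.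
rewrite ![_ ^+ j.+1]exprS IH -!mulmxE.
by rewrite -scalemxAl -scalemxAr scalerA.
Qed.

(** The derivative of a partial sum is [B] times the previous partial sum, exactly the recursion of
    [picard]. The series index is shifted by one since [Y k] has [k + 1] terms. *)
Lemma mexp_ode p (B : 'M[C]_p) :
  mexp ((0 : R)%:C *: B) = 1%:M /\
  forall x : R, 0 <= x -> HD (fun x => mexp (x%:C *: B)) x (B *m mexp (x%:C *: B)).
Proof.
pose Y k (x : R) : 'M[C]_p := \sum_(0 <= j < k.+1) (x ^+ j / j`!%:R)%:C *: B ^+ j.
have Bc : mcont (fun=> B : 'M[C]_p) by move=> x _; exact: mcvg_cst.
have Yi k : Y k 0 = 1%:M.
  rewrite /Y big_nat_recl// big1 ?addr0 => [|j _]; last by rewrite expr0n /= mul0r scale0r.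
  by rewrite expr0 expr0 fact0 divr1 scale1r.
have [|||Z [Z1 Z2 Z3]] := @picard R p p (fun=> B) Y Bc.
- by move=> x; rewrite /Y !big_nat1 !expr0.
- move=> k x x0; rewrite /Y.
  elim: k => [|k IH].
    have h := HDD (HD_cst ((1 : R)%:C *: B ^+ 0) x)
      (HD_scalR (B ^+ 1) (hdR_expn_fact (j := 0) (x := x))).
    rewrite (_ : B *m _ = 0 + (x ^+ 0 / 0`!%:R)%:C *: B ^+ 1); last first.
      by rewrite big_nat1 add0r -scalemxAr expr0 expr1 mulmx1.
    rewrite (_ : (fun y => _) = (fun y => 1%:C *: B ^+ 0 + (y ^+ 1 / 1`!%:R)%:C *: B ^+ 1)) //.
    apply/funext => y; rewrite big_nat_recr//= big_nat1.
    by rewrite [y ^+ 0]expr0 fact0 divr1.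
  have h := HDD IH (HD_scalR (B ^+ k.+2) (hdR_expn_fact (j := k.+1) (x := x))).
  rewrite (_ : B *m _ = B *m (\sum_(0 <= j < k.+1) (x ^+ j / j`!%:R)%:C *: B ^+ j) +
     (x ^+ k.+1 / k.+1`!%:R)%:C *: B ^+ k.+2); last first.
    by rewrite [in LHS]big_nat_recr//= mulmxDr -scalemxAr [B ^+ k.+2]exprS.
  rewrite (_ : (fun y => _) = (fun y => \sum_(0 <= j < k.+2) (y ^+ j / j`!%:R)%:C *: B ^+ j +
     (y ^+ k.+2 / k.+2`!%:R)%:C *: B ^+ k.+2)) //.
  by apply/funext => y; rewrite [in LHS]big_nat_recr.
- by move=> k; rewrite !Yi.
have E x : 0 <= x -> mexp (x%:C *: B) = Z x.
  move=> x0; rewrite /mexp; apply: cvg_lim => //.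
  rewrite -(cvg_shiftS (series _)).
  rewrite (_ : (fun n => series _ n.+1) = Y^~ x); first by apply: mcvg_to_cvg; exact: Z3.
  apply/funext => k; rewrite /series /Y /=; apply: eq_bigr => j _.
  rewrite expmxZ scalerA; congr (_ *: _).
  by rewrite rmorphM /= rmorphXn /= fmorphV rmorph_nat mulrC.
split; first by rewrite E// Z2 Yi.
move=> x x0; rewrite E//; apply: HD_ext (Z1 x x0) => //.
by move=> y y0; rewrite E.
Qed.

End LinearODE.

(** * Weyl functions *)

Section Schroedinger.
Context {R : realType}.
Local Notation C := R[i].

Definition wr m (y : 'cV[C]_(m + m)) : R := Im (ip (usubmx y) (dsubmx y)).

Lemma usub_coefG m (v : 'M[C]_m) z (y : 'cV[C]_(m + m)) : usubmx (coefG v z *m y) = dsubmx y.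
Proof.
by rewrite -[y in LHS]vsubmxK /coefG mul_block_col mul0mx mul1mx add0r col_mxKu.
Qed.
Lemma dsub_coefG m (v : 'M[C]_m) z (y : 'cV[C]_(m + m)) :
  dsubmx (coefG v z *m y) = (v - z%:M) *m usubmx y.
Proof.
by rewrite -[y in LHS]vsubmxK /coefG mul_block_col !mul0mx addr0 col_mxKd.
Qed.

Lemma hdR_const_on (f : R -> R) (x l d : R) : 0 <= x -> x < l ->
  (forall y, x <= y <= l -> f y = f x) -> hdR f x d -> d = 0.
Proof.
move=> x0 xl H /hdRP h; apply/eqP; rewrite -normr_le0; apply/ler_addgt0Pl => e e0; rewrite addr0.
have [dl dl0 Hd] := h e e0.
pose t := Num.min ((l - x)) (dl / 2).
have t0 : 0 < t by rewrite lt_min subr_gt0 xl divr_gt0.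
have tl : t <= l - x by rewrite ge_min lexx.
have td : t < dl by rewrite gt_min ltr_pdivrMr// ltr_pMr// ltr1n orbT.
have xt : 0 <= x + t by rewrite addr_ge0// ltW.
have := Hd _ xt; rewrite [x + t]addrC addrK (gtr0_norm t0) => /(_ td).
rewrite (H (t + x)); last by apply/andP; split; lra.
by rewrite subrr sub0r normrN normrM (gtr0_norm t0) ler_pM2r.
Qed.

Section FixedPotential.
Variables (m : nat) (v : R -> 'M[C]_m) (z : C) (K : R).
Hypothesis vh : forall x, 0 <= x -> (v x) ^t* = v x.
Hypothesis vK : forall x, 0 <= x -> forall i j, `|Re (v x i j)| <= K /\ `|Im (v x i j)| <= K.
Hypothesis z0 : 0 < Im z.

Definition sol (y : R -> 'cV[C]_(m + m)) :=
  forall x, 0 <= x -> HD y x (coefG (v x) z *m y x).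

Lemma sol_sub y w : sol y -> sol w -> sol (fun x => y x - w x).
Proof. by move=> h k x x0; rewrite mulmxBr; apply: HDB; [exact: h|exact: k]. Qed.

Lemma sol1 y x : sol y -> 0 <= x -> HD (fun t => usubmx (y t)) x (dsubmx (y x)).
Proof. by move=> h x0; have := HD_usub (h x x0); rewrite usub_coefG. Qed.
Lemma sol2 y x : sol y -> 0 <= x ->
  HD (fun t => dsubmx (y t)) x ((v x - z%:M) *m usubmx (y x)).
Proof. by move=> h x0; have := HD_dsub (h x x0); rewrite dsub_coefG. Qed.

Lemma ip_pot y x : 0 <= x -> ip y ((v x - z%:M) *m y) = ip y (v x *m y) - z * (sqn y)%:C.
Proof. by move=> x0; rewrite mulmxBl ipDr ipNr mul_scalar_mx ipZr ip_self. Qed.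

Lemma hdR_wr y x : sol y -> 0 <= x ->
  hdR (fun t => wr (y t)) x (- (Im z * sqn (usubmx (y x)))).
Proof.
move=> h x0; have [_ H] := HD_ip (sol1 h x0) (sol2 h x0).
apply: (hdR_eq H); rewrite ip_self ip_pot// cImD cImN cImM /= ip_herm ?vh//; ring.
Qed.

Lemma wr_noninc y a b : sol y -> 0 <= a -> a <= b -> wr (y b) <= wr (y a).
Proof.
move=> h a0 ab; apply: (@hdR_le _ (fun t => wr (y t)) (fun x => - (Im z * sqn (usubmx (y x))))) => //.
- by move=> x /andP[ax _]; apply: hdR_wr => //; exact: le_trans ax.
- by move=> x _; rewrite oppr_le0 mulr_ge0 ?sqn_ge0// ltW.
Qed.

(* As [wr' = - Im z * sqn y1], a lower bound on [wr] means that the first component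
   [y1] is square integrable.  If moreover [wr (y x0) = - eta < 0], then
   [sqn y1 + sqn y2 >= 2 * eta] beyond [x0], and [(sqn y1)'' >= 4 * eta - K' * sqn y1]
   makes [(sqn y1)'] tend to infinity, a contradiction. *)
Lemma wr_ge0 y B : sol y -> (forall x, 0 <= x -> B <= wr (y x)) ->
  forall x, 0 <= x -> 0 <= wr (y x).
Proof.
move=> h hB x0 x00; rewrite leNgt; apply/negP => wn.
pose eta := - wr (y x0); have eta0 : 0 < eta by rewrite oppr_gt0.
pose q x := sqn (usubmx (y x)); pose r x := 2 * Re (ip (usubmx (y x)) (dsubmx (y x))).
have q0 x : 0 <= q x by exact: sqn_ge0.
have hq x : 0 <= x -> hdR q x (r x).
  by move=> ?; exact: HD_sqn (sol1 h _).
have b0 := z0; set b := Im z in b0.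
pose K1 := `|K * m%:R * 2| + `|Re z|.
pose r' x := 2 * (Re (ip (dsubmx (y x)) (dsubmx (y x))) +
  Re (ip (usubmx (y x)) ((v x - z%:M) *m usubmx (y x)))).
have hr x : 0 <= x -> hdR r x (r' x).
  move=> x0'; have [H _] := HD_ip (sol1 h x0') (sol2 h x0').
  exact: hdRZ H.
have wle x : x0 <= x -> wr (y x) <= - eta.
  by move=> xx; rewrite opprK; exact: wr_noninc.
have r'ge x : x0 <= x -> 4 * eta - (2 + 2 * K1) * q x <= r' x.
  move=> xx; have x0' : 0 <= x by exact: le_trans xx.
  have /ler_normlP [A1 _] := (ip_mx_le (usubmx (y x)) (usubmx (y x)) (vK x0')).
  have [_ /ler_normlP [A2 _]] := ip_le (usubmx (y x)) (dsubmx (y x)).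
  have A3 := wle _ xx.
  have A4 : K * m%:R * (q x + q x) <= `|K * m%:R * 2| * q x.
    rewrite (_ : _ * (q x + q x) = (K * m%:R * 2) * q x); last by ring.
    by apply: ler_wpM2r => //; exact: ler_norm.
  have A5 : Re z * q x <= `|Re z| * q x by apply: ler_wpM2r => //; exact: ler_norm.
  rewrite /r' ip_pot// cReD cReN cReM /= mulr0 subr0 -/(q x) -/(sqn (dsubmx (y x))).
  rewrite (_ : (2 + 2 * K1) * q x = 2 * q x + 2 * (`|K * m%:R * 2| * q x) + 2 * (`|Re z| * q x));
    last by rewrite /K1; ring.
  rewrite /wr in A3; rewrite -/(q x) in A1 A2.
  move: (sqn (dsubmx _)) (Re (ip _ _)) (Im (ip _ _)) A1 A2 A3 A4 A5.
  move: (K * m%:R * (q x + q x)) (`|K * m%:R * 2| * q x) (`|Re z| * q x) (Re z * q x) (q x).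
  by move=> *; lra.
(* Beyond [x0] the function [r + (2 + 2 * K1) / b * (- wr) - 4 * eta * x] is nondecreasing, because
   [- wr] has derivative [b * q], which cancels the negative term in [r'ge]. The constant [c1]
   collects its value at [x0] and the lower bound [B]. *)
pose c1 := - (r x0 + (2 + 2 * K1) / b * (- wr (y x0)) - 4 * eta * x0) - (2 + 2 * K1) / b * B.
have K1ge : 0 <= (2 + 2 * K1) / b.
  by rewrite divr_ge0 ?(ltW b0)// addr_ge0 ?mulr_ge0// addr_ge0.
have rge x : x0 <= x -> 4 * eta * x - c1 <= r x.
  move=> xx; have x0' : 0 <= x by exact: le_trans xx.
  have := @hdR_ge _ (fun t => r t + (2 + 2 * K1) / b * (- wr (y t)) - 4 * eta * t)
    (fun t => r' t + (2 + 2 * K1) / b * (- - (b * q t)) - 4 * eta) x0 x x00 xx.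
  have P1 t : x0 <= t <= x -> hdR (fun t => r t + (2 + 2 * K1) / b * (- wr (y t)) - 4 * eta * t) t
      (r' t + (2 + 2 * K1) / b * (- - (b * q t)) - 4 * eta).
    move=> /andP[t1 _]; have t0 : 0 <= t by exact: le_trans t1.
    apply: hdRB; last exact: hdR_lin.
    apply: hdRD; first exact: hr.
    by apply: hdRZ; apply: hdRN; exact: hdR_wr.
  have P2 t : x0 <= t <= x -> 0 <= r' t + (2 + 2 * K1) / b * (- - (b * q t)) - 4 * eta.
    move=> /andP[t1 _]; have := r'ge _ t1.
    rewrite opprK (_ : (2 + 2 * K1) / b * (b * q t) = (2 + 2 * K1) * q t); last first.
      by field; rewrite gt_eqF.
    by move: (_ * q t) => Q; lra.
  move=> /(_ P1 P2); have := ler_wpM2l K1ge (hB x x0').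
  rewrite /c1 !mulrN; move: (_ / b * wr (y x)) (_ / b * wr (y x0)) (_ / b * B) (r x) (r x0).
  by move: (4 * eta * x) (4 * eta * x0); clear=> *; lra.
pose x1 := Num.max x0 ((c1 + 1) / (4 * eta)).
have x1ge : x0 <= x1 by rewrite le_max lexx.
have x10 : 0 <= x1 by exact: le_trans x1ge.
have r1 x : x1 <= x -> 1 <= r x.
  move=> xx; apply: le_trans (rge x (le_trans x1ge xx)).
  have : (c1 + 1) / (4 * eta) <= x by apply: le_trans xx; rewrite le_max lexx orbT.
  by rewrite ler_pdivrMr ?mulr_gt0// [x * _]mulrC lerBrDr addrC.
have q1 x : x1 + 1 <= x -> 1 <= q x.
  move=> xx; have xx1 : x1 <= x by lra.
  have := @hdR_ge _ (fun t => q t - 1 * t) (fun t => r t - 1) x1 x x10 xx1.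
  have P1 t : x1 <= t <= x -> hdR (fun t => q t - 1 * t) t (r t - 1).
    by move=> /andP[t1 _]; apply: hdRB; [apply: hq; exact: le_trans t1|exact: hdR_lin].
  have P2 t : x1 <= t <= x -> 0 <= r t - 1.
    by move=> /andP[t1 _]; rewrite subr_ge0 r1.
  move=> /(_ P1 P2); have := q0 x1; move: xx; move: (q x) (q x1); clear=> *; lra.
(* Beyond [x2] the form [wr] drops at rate at least [b]; over this length it falls below [B]. *)
pose x2 := x1 + 1; pose x3 := x2 + (`|B| + 1) / b.
have x20 : 0 <= x2 by rewrite /x2; lra.
have x23 : x2 <= x3 by rewrite lerDl divr_ge0 ?(ltW b0)// addr_ge0.
have := @hdR_le _ (fun t => wr (y t) + b * t) (fun t => - (b * q t) + b) x2 x3 x20 x23.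
have P1 t : x2 <= t <= x3 -> hdR (fun t => wr (y t) + b * t) t (- (b * q t) + b).
  move=> /andP[t1 _]; apply: hdRD; last exact: hdR_lin.
  by apply: hdR_wr => //; exact: le_trans t1.
have P2 t : x2 <= t <= x3 -> - (b * q t) + b <= 0.
  move=> /andP[t1 _]; rewrite addrC subr_le0 ler_peMr ?(ltW b0)//.
  exact: q1.
move=> /(_ P1 P2).
have A1 := hB x3 (le_trans x20 x23).
have A2 : wr (y x2) <= - eta by apply: wle; rewrite /x2; lra.
have A3 : b * x3 = b * x2 + (`|B| + 1) by rewrite /x3; field; rewrite gt_eqF.
have := ler_norm (- B); rewrite normrN.
move: A1 A2 A3 eta0; move: (wr (y x2)) (wr (y x3)) (b * x3) (b * x2) (eta) `|B|; clear=> *; lra.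
Qed.

(** Square integrability of first components passes to differences: by [sqnB_le], the combination
    [wr (y - w) - 2 wr y - 2 wr w] is nondecreasing. *)
Lemma wr_bounded_sub y w B1 B2 : sol y -> sol w ->
  (forall x, 0 <= x -> B1 <= wr (y x)) -> (forall x, 0 <= x -> B2 <= wr (w x)) ->
  exists B, forall x, 0 <= x -> B <= wr (y x - w x).
Proof.
move=> h k hy hw.
exists (wr (y 0 - w 0) - 2 * wr (y 0) - 2 * wr (w 0) + 2 * B1 + 2 * B2) => x x0.
have yw := sol_sub h k.
pose d t := - (Im z * sqn (usubmx (y t - w t))) - 2 * - (Im z * sqn (usubmx (y t)))
   - 2 * - (Im z * sqn (usubmx (w t))).
have := @hdR_ge _ (fun t => wr (y t - w t) - 2 * wr (y t) - 2 * wr (w t)) d 0 x (lexx _) x0.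
have P1 t : 0 <= t <= x -> hdR (fun t => wr (y t - w t) - 2 * wr (y t) - 2 * wr (w t)) t (d t).
  move=> /andP[t0 _]; apply: hdRB; last by apply: hdRZ; exact: hdR_wr.
  by apply: hdRB; [exact: (hdR_wr yw)|apply: hdRZ; exact: hdR_wr].
have P2 t : 0 <= t <= x -> 0 <= d t.
  move=> _; rewrite /d linearB /=.
  have := ler_wpM2l (ltW z0) (sqnB_le (usubmx (y t)) (usubmx (w t))).
  rewrite mulrDr; move: (sqn _) (sqn _) (sqn _) => s1 s2 s3; lra.
move=> /(_ P1 P2); have := hy x x0; have := hw x x0.
move: (wr (y x - w x)) (wr (y 0 - w 0)) (wr (y x)) (wr (w x)) (wr (y 0)) (wr (w 0)).
by clear=> *; lra.
Qed.

(** A nonnegative nonincreasing [wr] that starts at 0 is constant, so its derivative at 0, which is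
    [- Im z] times [sqn] of the first component, vanishes. *)
Lemma wr_zero y (l : R) : sol y -> 0 < l -> wr (y 0) = 0 -> (forall x, 0 <= x <= l -> 0 <= wr (y x)) ->
  usubmx (y 0) = 0.
Proof.
move=> h l0 y0 yp.
have E x : 0 <= x <= l -> wr (y x) = wr (y 0).
  move=> /andP[x0 xl]; apply/eqP; rewrite eq_le wr_noninc//= y0 yp//.
  by rewrite x0 xl.
have /eqP := hdR_const_on (lexx 0) l0 E (hdR_wr h (lexx _)).
rewrite oppr_eq0 mulf_eq0 gt_eqF//= => /eqP; exact: sqn_eq0.
Qed.

End FixedPotential.
End Schroedinger.

(** * Block matrices with scalar blocks, and the matrices T and J *)

Section ScalarBlocks.
Context {R : realType}.
Local Notation C := R[i].

Definition sblock m (a b c d : C) : 'M[C]_(m + m) := block_mx a%:M b%:M c%:M d%:M.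

Lemma sblockM m a b c d a' b' c' d' : sblock m a b c d *m sblock m a' b' c' d' =
  sblock m (a * a' + b * c') (a * b' + b * d') (c * a' + d * c') (c * b' + d * d').
Proof. by rewrite /sblock mulmx_block -!scalar_mxM -!raddfD. Qed.
Lemma sblock1 m : sblock m 1 0 0 1 = 1%:M.
Proof. by rewrite /sblock !scalar_mx_block raddf0. Qed.
Lemma trC_mul p q r (A : 'M[C]_(p, q)) (B : 'M[C]_(q, r)) : (A *m B) ^t* = B ^t* *m A ^t*.
Proof. by rewrite trmx_mul map_mxM. Qed.
Lemma trC_K p q (A : 'M[C]_(p, q)) : (A ^t*) ^t* = A.
Proof. by apply/matrixP => i j; rewrite !mxE conjCK. Qed.
Lemma trC_N p q (A : 'M[C]_(p, q)) : (- A) ^t* = - A ^t*.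
Proof. by rewrite raddfN /= map_mxN. Qed.
Lemma trC_D p q (A B : 'M[C]_(p, q)) : (A + B) ^t* = A ^t* + B ^t*.
Proof. by rewrite raddfD /= map_mxD. Qed.
Lemma trC_scalar m (a : C) : (a%:M : 'M[C]_m) ^t* = (a^*)%:M.
Proof. by rewrite tr_scalar_mx map_scalar_mx. Qed.
Lemma sblock_trC m a b c d : (sblock m a b c d) ^t* = sblock m a^* c^* b^* d^*.
Proof. by rewrite /sblock tr_block_mx map_block_mx !trC_scalar. Qed.
Lemma sblock_eq m a b c d a' b' c' d' : a = a' -> b = b' -> c = c' -> d = d' ->
  sblock m a b c d = sblock m a' b' c' d'.
Proof. by move=> -> -> -> ->. Qed.
Lemma sblock_col m q a b c d (x y : 'M[C]_(m, q)) :
  sblock m a b c d *m col_mx x y = col_mx (a *: x + b *: y) (c *: x + d *: y).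
Proof. by rewrite /sblock mul_block_col !mul_scalar_mx. Qed.
Lemma sblockZ m k a b c d : k *: sblock m a b c d = sblock m (k * a) (k * b) (k * c) (k * d).
Proof. by rewrite /sblock scale_block_mx !scale_scalar_mx. Qed.

Definition Jm m := sblock m 0 1 (-1) 0.
Definition Km m := sblock m 0 1 1 0.
Definition rs2 : R := (Num.sqrt (2%:R : R))^-1.
Lemma rs2_gt0 : 0 < rs2.
Proof. by rewrite /rs2 invr_gt0 sqrtr_gt0. Qed.
Lemma rs2_sqr : rs2 * rs2 = 2^-1.
Proof. by rewrite /rs2 -invfM -expr2 sqr_sqrtr. Qed.

Lemma matTE m : matT R m = sblock m (0 +i* rs2) (rs2%:C) (0 +i* rs2) (- rs2%:C).
Proof.
rewrite /matT -/rs2 (_ : block_mx _ _ _ _ = sblock m 'i%C 1 'i%C (-1)); last first.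
  by rewrite /sblock raddfN.
rewrite sblockZ; apply: sblock_eq; apply: Complex_eq;
  by rewrite ?(cReM, cImM, cReN, cImN) /=; ring.
Qed.

Ltac csimp := apply: Complex_eq;
  rewrite ?(cReD, cImD, cReM, cImM, cReC, cImC, cReN, cImN) /=.

Lemma matT_unitary m : matT R m *m (matT R m) ^t* = 1%:M /\ (matT R m) ^t* *m matT R m = 1%:M.
Proof.
have h := rs2_sqr.
by rewrite matTE sblock_trC !sblockM -sblock1; split; apply: sblock_eq; csimp; lra.
Qed.

(** [matT] with its two block columns exchanged. Through [T2_trC] it converts the adjoint in [calA]
    into an inverse, and the value [M] of a Weyl function corresponds to the initial values [T2]
    applied to [(- i M c, c)]. *)
Definition T2 m := matT R m *m Km m.
Lemma T2E m : T2 m = sblock m rs2%:C (0 +i* rs2) (- rs2%:C) (0 +i* rs2).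
Proof. by rewrite /T2 matTE /Km sblockM; apply: sblock_eq; csimp; ring. Qed.

Lemma T2_trC m : T2 m *m (matT R m) ^t* = (- 'i%C) *: Jm m.
Proof.
have h := rs2_sqr.
by rewrite T2E matTE sblock_trC sblockM /Jm sblockZ; apply: sblock_eq; csimp; lra.
Qed.

Lemma Km_K m : Km m *m Km m = 1%:M.
Proof. by rewrite sblockM -sblock1; apply: sblock_eq; csimp; ring. Qed.
Lemma T2_surj m (y : 'cV[C]_(m + m)) : exists a b, y = T2 m *m col_mx a b.
Proof.
pose w := Km m *m (matT R m) ^t* *m y.
exists (usubmx w), (dsubmx w); rewrite vsubmxK /w /T2 !mulmxA.
by rewrite -[matT R m *m Km m *m _]mulmxA Km_K mulmx1 (matT_unitary m).1 mul1mx.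
Qed.

Lemma Jm_J m : Jm m *m Jm m = - 1%:M.
Proof. by rewrite sblockM -sblock1 -[- sblock _ _ _ _ _]scaleN1r sblockZ; apply: sblock_eq; csimp; ring. Qed.
Lemma Jm_trC m : (Jm m) ^t* = - Jm m.
Proof. by rewrite sblock_trC -[- Jm m]scaleN1r sblockZ; apply: sblock_eq; csimp; ring. Qed.

Lemma ip_col m n (a c : 'cV[C]_m) (b d : 'cV[C]_n) :
  ip (col_mx a b) (col_mx c d) = ip a c + ip b d.
Proof. by rewrite /ip tr_col_mx map_row_mx mul_row_col [LHS]mxE. Qed.

Lemma wr_J m (y : 'cV[C]_(m + m)) : 2 * wr y = Im (ip y (Jm m *m y)).
Proof.
rewrite -[in RHS](vsubmxK y) /Jm sblock_col !scale0r add0r addr0 scale1r scaleN1r.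
by rewrite ip_col ipNr cImD cImN [ip (dsubmx y) _]ipC cImC /wr; ring.
Qed.

Lemma wr_T2 m (c : 'cV[C]_m) : wr (T2 m *m col_mx c 0) = 0.
Proof.
rewrite T2E sblock_col !scaler0 !addr0 /wr col_mxKu col_mxKd scaleNr ipNr ip_self.
by rewrite cImN /= oppr0.
Qed.

End ScalarBlocks.

Section LftAlgebra.
Context {R : realType}.
Local Notation C := R[i].
Variables (p : nat) (J : 'M[C]_p).
Hypothesis JJ : J *m J = - 1%:M.

(** A left inverse of a square matrix is also a right inverse. *)
Lemma J_unitary_transpose (U Ws : 'M[C]_p) : Ws *m J *m U = J -> U *m J *m Ws = J.
Proof.
move=> WU.
have : (- J *m Ws *m J) *m U = 1%:M.
  by rewrite -!mulmxA [Ws *m _]mulmxA WU mulNmx JJ opprK.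
move=> /mulmx1C H; have : U *m (- J *m Ws *m J) *m J = J by rewrite H mul1mx.
by rewrite -!mulmxA JJ mulmxN mulmx1 !mulmxN mulNmx !mulmxN opprK !mulmxA.
Qed.

Lemma invmx_J (T Ts X Xs : 'M[C]_p) : Ts *m T = 1%:M -> Xs *m J *m X = J ->
  invmx (X *m T) = - (Ts *m J *m Xs *m J).
Proof.
move=> TT XJ.
have E : - (Ts *m J *m Xs *m J) *m (X *m T) = 1%:M.
  rewrite mulNmx -!mulmxA [J *m (X *m T)]mulmxA [Xs *m _]mulmxA [Xs *m _]mulmxA XJ.
  by rewrite [J *m (J *m T)]mulmxA JJ mulNmx mul1mx mulmxN opprK.
have [_ u] := mulmx1_unit E.
by have := congr1 (mulmx^~ (invmx (X *m T))) E; rewrite /= mulmxK// mul1mx => ->.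
Qed.

Lemma lft_algebra_aux (T Ts T2 X U Ws : 'M[C]_p) : Ts *m T = 1%:M ->
  T2 *m Ts = (- 'i%C) *: J -> U *m J *m Ws = J ->
  U *m T2 *m - (Ts *m Ws *m J *m X *m J *m T) = X *m T2.
Proof.
move=> TT T2T UW.
have n0 : - 'i%C != 0 :> C by rewrite oppr_eq0 eq_complex /= oner_eq0 andbF.
rewrite mulmxN !mulmxA -[U *m T2 *m _]mulmxA T2T -scalemxAr -!scalemxAl UW JJ.
rewrite !mulNmx mul1mx scalerN opprK -[X *m J *m T]mulmxA.
rewrite (_ : J *m T = (- 'i%C)^-1 *: (T2 *m (Ts *m T))); last first.
  by rewrite mulmxA T2T -scalemxAl scalerA mulVf// scale1r.
by rewrite TT mulmx1 -scalemxAr scalerA divff// scale1r.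
Qed.

(** The relation [W^* J U = J] makes the adjoint of [W] a conjugate by [J] of the inverse of [U],
    which cancels the left factor; the adjoint of the inverse of [X T] turns back into [X]. *)
Lemma lft_algebra (T T2 X U W : 'M[C]_p) : T ^t* *m T = 1%:M ->
  T2 *m T ^t* = (- 'i%C) *: J -> J ^t* = - J ->
  X ^t* *m J *m X = J -> W ^t* *m J *m U = J ->
  U *m T2 *m (invmx (X *m T) *m W *m T) ^t* = X *m T2.
Proof.
move=> TT T2T JC XJ WU.
rewrite -[RHS](lft_algebra_aux X TT T2T (J_unitary_transpose WU)).
congr (_ *m _); rewrite (invmx_J TT XJ) !mulNmx trC_N !trC_mul !trC_K JC.
by rewrite !(mulNmx, mulmxN) opprK !mulmxA.
Qed.

End LftAlgebra.

Section WeylFunction.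
Context {R : realType}.
Local Notation C := R[i].
Variables (m : nat) (v : R -> 'M[C]_m) (K : R).
Hypothesis vh : forall x, 0 <= x -> (v x) ^t* = v x.
Hypothesis vK : forall x, 0 <= x -> forall i j, `|Re (v x i j)| <= K /\ `|Im (v x i j)| <= K.

Lemma coefG_J x z : 0 <= x ->
  (coefG (v x) z^*) ^t* *m Jm m + Jm m *m coefG (v x) z = 0.
Proof.
move=> x0; rewrite /coefG tr_block_mx map_block_mx !trmx0 !map_mx0 trC_scalar conjC1.
rewrite (_ : ((v x - z^*%:M) ^t*) = v x - z%:M); last first.
  by rewrite raddfB /= map_mxB vh// trC_scalar conjCK.
rewrite (_ : Jm m = block_mx 0 1%:M (- 1%:M) 0); last by rewrite /Jm /sblock raddf0 raddfN.
rewrite mulmx_block [X in _ + X]mulmx_block add_block_mx.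
rewrite !mul0mx !mulmx0 !mul1mx !mulmx1 !add0r !addr0.
by rewrite mulmxN mulmx1 addNr subrr block_mx0.
Qed.

(** Wronskian identity: by [coefG_J] the left side has zero derivative. *)
Lemma fund_J z (Psi W : R -> 'M[C]_(m + m)) x : 0 <= x ->
  fundamental_solution v z Psi -> fundamental_solution v z^* W ->
  (W x) ^t* *m Jm m *m Psi x = Jm m.
Proof.
move=> x0 [P0 P1] [W0 W1].
have HP y : 0 <= y -> HD Psi y (coefG (v y) z *m Psi y).
  by move=> y0; have [d <-] := P1 y y0; exact: HD_hl.
have HW y : 0 <= y -> HD W y (coefG (v y) z^* *m W y).
  by move=> y0; have [d <-] := W1 y y0; exact: HD_hl.
have -> : (W x) ^t* *m Jm m *m Psi x = (W 0) ^t* *m Jm m *m Psi 0.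
  apply: (@HD_const _ _ _ (fun x => (W x) ^t* *m Jm m *m Psi x)) => // y y0.
  apply: HD_eq (HDM (HDMr (Jm m) (HD_trC (HW y y0))) (HP y y0)) _.
  rewrite trmx_mul map_mxM -!mulmxA -mulmxDr !mulmxA -mulmxDl coefG_J//.
  by rewrite mul0mx mulmx0.
by rewrite P0 W0 trmx1 map_mx1 mul1mx mulmx1.
Qed.

Lemma sol_fund z (Psi : R -> 'M[C]_(m + m)) (c : 'cV[C]_(m + m)) :
  fundamental_solution v z Psi -> sol v z (fun x => Psi x *m c).
Proof.
move=> [P0 P1] x x0; have [d e] := P1 x x0; rewrite mulmxA -e.
by apply: HDMr; exact: HD_hl.
Qed.

(** In the frame [T2], [calA] is the inverse of [Psi z l] times [Psi 0 l]. A solution at [z] with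
    initial value [T2 *m calA *m d] therefore has the value [Psi 0 l *m T2 *m d] at [l], and
    [Psi 0 l] preserves [wr]. *)
Lemma calA_key (Psi : C -> R -> 'M[C]_(m + m)) z l : 0 <= l ->
  (forall z, fundamental_solution v z (Psi z)) ->
  Psi z l *m T2 m *m calA Psi l z = Psi 0 l *m T2 m.
Proof.
move=> l0 F.
have F0 : fundamental_solution v (0 : C)^* (Psi 0) by rewrite conjC0; exact: F.
exact: (lft_algebra (Jm_J m) (matT_unitary m).2 (T2_trC m) (Jm_trC m)
  (fund_J l0 (F 0) F0) (fund_J l0 (F z) (F z^*))).
Qed.

End WeylFunction.

Section WeylCharacterization.
Context {R : realType}.
Local Notation C := R[i].

Lemma wr_J_unitary m (X : 'M[C]_(m + m)) y : X ^t* *m Jm m *m X = Jm m -> wr (X *m y) = wr y.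
Proof.
move=> XJ; have n2 : (2 : R) != 0 by [].
apply: (mulfI n2); rewrite !wr_J ipMl; congr (Im (ip _ _)).
by rewrite !mulmxA XJ.
Qed.

Lemma J_unitary_inj m (X : 'M[C]_(m + m)) (y : 'cV[C]_(m + m)) :
  X ^t* *m Jm m *m X = Jm m -> X *m y = 0 -> y = 0.
Proof.
move=> XJ Xy; have : Jm m *m y = 0 by rewrite -XJ -[_ *m X *m y]mulmxA Xy mulmx0.
move=> /(congr1 (mulmx (Jm m))); rewrite mulmx0 mulmxA Jm_J mulNmx mul1mx => /eqP.
by rewrite oppr_eq0 => /eqP.
Qed.

Lemma usub_T2 m (c d : 'cV[C]_m) : usubmx (T2 m *m col_mx c d) = rs2%:C *: c + (0 +i* rs2) *: d.
Proof. by rewrite T2E sblock_col col_mxKu. Qed.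
Lemma dsub_T2 m (c d : 'cV[C]_m) : dsubmx (T2 m *m col_mx c d) = - rs2%:C *: c + (0 +i* rs2) *: d.
Proof. by rewrite T2E sblock_col col_mxKd. Qed.

Lemma usub_T2_eq0 m (c : 'cV[C]_m) : usubmx (T2 m *m col_mx c 0) = 0 -> c = 0.
Proof.
rewrite usub_T2 scaler0 addr0 => /eqP; rewrite scaler_eq0 => /orP[/eqP|/eqP//].
by move=> /(congr1 (@complex.Re R)) /= h; have := @rs2_gt0 R; rewrite h ltxx.
Qed.

Lemma inj_unitmx n (N : 'M[C]_n) : (forall c : 'cV[C]_n, N *m c = 0 -> c = 0) -> N \in unitmx.
Proof.
move=> h; rewrite unitmxE unitfE -det_tr; apply/det0P => -[w w0 wN].
have e : w^T = 0 by apply: h; rewrite -[N]trmxK -trmx_mul wN trmx0.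
by move: w0; rewrite -[w]trmxK e trmx0 eqxx.
Qed.

Variables (m : nat) (v : R -> 'M[C]_m) (K : R).
Hypothesis vh : forall x, 0 <= x -> (v x) ^t* = v x.
Hypothesis vK : forall x, 0 <= x -> forall i j, `|Re (v x i j)| <= K /\ `|Im (v x i j)| <= K.

(** The limit is common to all pairs, so it is evaluated on the constant pair (1, 0), for which [wr]
    vanishes at [l]. *)
Let P1 : R -> C -> 'M[C]_m := fun _ _ => 1%:M.
Let Q0 : R -> C -> 'M[C]_m := fun _ _ => 0.

Lemma holo_cst (M : 'M[C]_m) z : holomorphic_at (fun _ : C => M) z.
Proof. by rewrite /holomorphic_at; near=> w; exact: derivable_cst. Unshelve. all: by end_near. Qed.

Lemma admissible_10 : admissible_pair P1 Q0.
Proof.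
move=> l l0; split.
- move=> z z0; exists 0%N, (fun=> 1%:M); split; first exact: holo_cst.
  by near=> w; rewrite expr0 scale1r.
- move=> z z0; exists 0%N, (fun=> 0); split; first exact: holo_cst.
  by near=> w; rewrite expr0 scale1r.
- move=> z _ _ _; rewrite /P1 /Q0 trmx1 trmx0 map_mx1 map_mx0 mulmx1 !mulmx0 !mul0mx !addr0.
  split=> w; last by rewrite mulmx0 mul0mx mxE.
  move=> w0; rewrite mulmx1 -/(ip w w) ip_self ltcR lt_neqAle sqn_ge0 andbT eq_sym.
  by apply: contra w0 => /eqP /sqn_eq0 ->.
Unshelve. all: by end_near. Qed.

Lemma weylM_10 Psi l z : weylM Psi P1 Q0 l z =
  'i%C *: (ulsubmx (calA Psi l z) *m invmx (dlsubmx (calA Psi l z))).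
Proof. by rewrite /weylM /P1 /Q0 !mulmx1 !mulmx0 !addr0. Qed.

(* For the pair (1, 0) the solution below has [wr = 0] at [l]; as [wr] decreases, it is
   nonnegative on [0, l]. *)
Lemma weyl_finite Psi l z c x : 0 < Im z -> (forall z, fundamental_solution v z (Psi z)) ->
  0 <= x -> x <= l -> 0 < l ->
  0 <= wr (Psi z x *m (T2 m *m col_mx (- 'i%C *: (weylM Psi P1 Q0 l z *m c)) c)).
Proof.
move=> z0 F x0 xl l0; have l0' := ltW l0.
rewrite weylM_10; set A := calA Psi l z.
set N1 := ulsubmx A; set N2 := dlsubmx A.
have Acol (d : 'cV[C]_m) : A *m col_mx d 0 = col_mx (N1 *m d) (N2 *m d).
  by rewrite -[A]submxK mul_block_col !mulmx0 !addr0.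
have XJ : (Psi 0 l) ^t* *m Jm m *m Psi 0 l = Jm m.
  have F0 : fundamental_solution v (0 : C)^* (Psi 0) by rewrite conjC0; exact: F.
  exact: (fund_J vh l0' (F 0) F0).
have key (d : 'cV[C]_m) : Psi z l *m (T2 m *m (A *m col_mx d 0)) = Psi 0 l *m (T2 m *m col_mx d 0).
  have kA := congr1 (mulmx^~ (col_mx d 0)) (calA_key vh z l0' F).
  by rewrite /= -/A -!(mulmxA _ (T2 m)) -[_ *m (_ *m A) *m _]mulmxA -[_ *m A *m _]mulmxA in kA.
pose y (d : 'cV[C]_m) t := Psi z t *m (T2 m *m (A *m col_mx d 0)).
have ys d : sol v z (y d) by exact: sol_fund (F z).
have yl d : wr (y d l) = 0 by rewrite /y key wr_J_unitary// wr_T2.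
have yp d t : 0 <= t <= l -> 0 <= wr (y d t).
  by move=> /andP[t0 tl]; rewrite -(yl d); exact: (wr_noninc vh z0 (ys d)).
(* If [N2 *m d = 0], the solution [y d] starts at an isotropic vector and has [wr = 0] at [l] as
   well; [wr_zero] then gives [N1 *m d = 0], so [y d] is zero, and so is [d] because [Psi 0 l] is
   injective. *)
have N2u : N2 \in unitmx.
  apply: inj_unitmx => d N2d.
  have y0 : y d 0 = T2 m *m col_mx (N1 *m d) 0.
    by rewrite /y (F z).1 mul1mx Acol N2d.
  have N1d : N1 *m d = 0.
    apply: usub_T2_eq0; rewrite -y0; apply: (wr_zero vh z0 (ys d) l0).
      by rewrite y0 wr_T2.
    exact: yp.
  apply: usub_T2_eq0.
  suff -> : T2 m *m col_mx d 0 = 0 by rewrite linear0.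
  apply: (J_unitary_inj XJ); rewrite -key Acol N1d N2d col_mx0.
  by rewrite !mulmx0.
have E1 : N2 *m (invmx N2 *m c) = c by rewrite mulKVmx.
have E2 : - 'i%C *: ('i%C *: (N1 *m invmx N2) *m c) = N1 *m (invmx N2 *m c).
  have ii : 'i%C * 'i%C = -1 :> C by rewrite -expr2 sqr_i.
  by rewrite scaleNr -scalemxAl scalerA ii scaleN1r opprK mulmxA.
have := yp (invmx N2 *m c) x; rewrite x0 xl /y Acol E1 => /(_ isT).
by rewrite E2.
Qed.

(** Positivity is the limit of [weyl_finite] as [l] grows. For the converse, subtract from [y] the
    Weyl solution with the same lower coordinate [c]: the difference starts with [wr = 0], its [wr]
    is bounded below and hence nonnegative by [wr_ge0], so [wr_zero] forces the initial values to
    agree. *)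
Lemma weyl_char z M : 0 < Im z -> is_weyl_function v M ->
  exists Psi : R -> 'M[C]_(m + m), [/\ fundamental_solution v z Psi,
    forall c x, 0 <= x ->
      0 <= wr (Psi x *m (T2 m *m col_mx (- 'i%C *: (M z *m c)) c)) &
    forall y B, sol v z y -> (forall x, 0 <= x -> B <= wr (y x)) ->
      exists c, y 0 = T2 m *m col_mx (- 'i%C *: (M z *m c)) c].
Proof.
move=> z0 [Psi [F W]]; exists (Psi z).
have := W _ _ admissible_10 _ z0.
have /[swap]/[apply] Wl : \forall l \near +oo, holomorphic_at (P1 l) z /\ holomorphic_at (Q0 l) z.
  by near=> l; split; exact: holo_cst.
have pos c x : 0 <= x -> 0 <= wr (Psi z x *m (T2 m *m col_mx (- 'i%C *: (M z *m c)) c)).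
  move=> x0.
  pose g (D : 'M[C]_m) := Psi z x *m (T2 m *m col_mx (- 'i%C *: (D *m c)) c).
  have gl : mcvg +oo (fun l => g (weylM Psi P1 Q0 l z)) (g (M z)).
    apply: mcvgM; first exact: mcvg_cst.
    apply: mcvgM; first exact: mcvg_cst.
    apply: mcvg_col; last exact: mcvg_cst.
    apply: mcvgZ; first exact: ccvg_cst.
    apply: mcvgM; last exact: mcvg_cst.
    exact: mcvg_cvg.
  have [_ h] := mcvgM (mcvg_trC (mcvg_usub gl)) (mcvg_dsub gl) 0 0.
  apply: (cvgr_to_ge h).
  near=> l; apply: weyl_finite => //; near: l; exact: nbhs_pinfty_ge.
split=> //.
move=> y B ys yB.
have [a [c y0]] := T2_surj (y 0).
exists c.
pose w x := Psi z x *m (T2 m *m col_mx (- 'i%C *: (M z *m c)) c).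
have ws : sol v z w by exact: sol_fund (F z).
have [B' hB'] := wr_bounded_sub vh z0 ys ws yB (pos c).
have es := sol_sub ys ws.
have e0 : y 0 - w 0 = T2 m *m col_mx (a - - 'i%C *: (M z *m c)) 0.
  by rewrite y0 /w (F z).1 mul1mx -mulmxBr opp_col_mx add_col_mx subrr.
have : a - - 'i%C *: (M z *m c) = 0.
  apply: usub_T2_eq0; rewrite -e0.
  apply: (wr_zero vh z0 es ltr01); first by rewrite e0 wr_T2.
  by move=> x /andP[x0 _]; exact: (wr_ge0 vh vK z0 es hB').
by move=> /eqP; rewrite subr_eq0 => /eqP <-.
Unshelve. all: by end_near. Qed.

End WeylCharacterization.

(** * Evolution in time *)

Section Gronwall.
Context {R : realType}.
Local Notation C := R[i].

Lemma nrmZ p q (r : R) (M : 'M[C]_(p, q)) : nrm (r%:C *: M) = `|r| * nrm M.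
Proof.
rewrite /nrm mulr_sumr; apply: eq_bigr => i _; rewrite mulr_sumr; apply: eq_bigr => j _.
by rewrite mxE cReM cImM /= !mul0r subr0 addr0 !normrM mulrDr.
Qed.

Lemma HD_nrmP p q (f : R -> 'M[C]_(p, q)) x D :
  HD f x D <-> forall e, 0 < e -> exists2 d, 0 < d & forall y, 0 <= y -> `|y - x| < d ->
    nrm (f y - f x - (y - x)%:C *: D) <= e * `|y - x|.
Proof.
have E y : y != x -> nrm (f y - f x - (y - x)%:C *: D) =
    `|y - x| * nrm (((y - x)^-1)%:C *: (f y - f x) - D).
  move=> yx; rewrite -nrmZ scalerBr scalerA -rmorphM /= divff ?subr_eq0//.
  by rewrite scale1r.
split.
  move=> /mcvg_hlP h e e0; have [d d0 H] := h e e0; exists d => // y y0 yd.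
  have [->|yx] := eqVneq y x; first by rewrite !subrr scale0r subr0 nrm0 normr0 mulr0.
  by rewrite E// mulrC ler_wpM2r//; exact: H.
move=> h; apply/mcvg_hlP => e e0; have [d d0 H] := h e e0; exists d => // y y0 yx yd.
have := H y y0 yd; rewrite E// mulrC ler_pM2r//.
by rewrite normr_gt0 subr_eq0.
Qed.

Lemma sqn_nrm p (a : 'cV[C]_p) (e : R) : nrm a <= e -> sqn a <= p%:R * (2 * e ^+ 2).
Proof.
move=> h; apply: sqn_le; first exact: le_trans (nrm_ge0 a) h.
by move=> i; split; apply: le_trans h; [exact: nrm_Re|exact: nrm_Im].
Qed.

Lemma nrm_sqn p (a : 'cV[C]_p) (e : R) : 0 <= e -> sqn a <= e ^+ 2 -> nrm a <= (2 * p * 1)%:R * e.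
Proof.
move=> e0 h; apply: nrm_le => i j; rewrite ord1.
have := le_trans (sqn_entry a i) h => h2.
split; rewrite -(@ler_pXn2r _ 2)// ?nnegrE// real_normK ?num_real//; apply: le_trans h2.
- by rewrite lerDl sqr_ge0.
- by rewrite lerDr sqr_ge0.
Qed.

(** Integrating factor [expR (- k * t)]; in [k] the part [4 * Kg * N] comes from [A] and the 1 from
    the product of [D] with [r]. *)
Lemma gronwall N (D r : R -> 'cV[C]_N) (A : R -> 'M[C]_N) (X Kg rho : R) :
  0 <= X -> 0 <= Kg -> 0 <= rho ->
  (forall x, 0 <= x <= X -> HD D x (A x *m D x + r x)) ->
  (forall x, 0 <= x <= X -> forall i j, `|Re (A x i j)| <= Kg /\ `|Im (A x i j)| <= Kg) ->
  (forall x, 0 <= x <= X -> sqn (r x) <= rho) -> sqn (D 0) <= rho ->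
  forall x, 0 <= x <= X ->
    sqn (D x) <= rho * ((1 + X) * expR ((4 * Kg * N%:R + 1) * X)).
Proof.
move=> X0 Kg0 rho0 hD hA hr hD0 x /andP[x0 xX].
set k := 4 * Kg * N%:R + 1.
have k0 : 0 <= k by rewrite addr_ge0// !mulr_ge0.
pose q t := sqn (D t); pose q' t := 2 * Re (ip (D t) (A t *m D t + r t)).
have xX' t : 0 <= t <= x -> 0 <= t <= X by move=> /andP[-> tx]; exact: le_trans xX.
have hq t : 0 <= t <= x -> hdR q t (q' t).
  by move=> tx; apply: HD_sqn; apply: hD; exact: xX'.
have q'le t : 0 <= t <= x -> q' t <= k * q t + rho.
  move=> tx; rewrite /q' ipDr cReD.
  have /ler_normlP[_ h1] := ip_mx_le (D t) (D t) (hA t (xX' _ tx)).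
  have [/ler_normlP[_ h2] _] := ip_le (D t) (r t).
  have h3 := hr t (xX' _ tx).
  have -> : k * q t = 2 * (Kg * N%:R * (sqn (D t) + sqn (D t))) + sqn (D t) by rewrite /k /q; ring.
  move: h1 h2 h3; move: (Re (ip (D t) (A t *m D t))) (Re (ip (D t) (r t))).
  move: (Kg * N%:R * (sqn (D t) + sqn (D t))) (sqn (D t)) (sqn (r t)).
  by clear=> *; lra.
have P1 t : 0 <= t <= x -> hdR (fun t => expR (- k * t) * q t - rho * t) t
    (- k * expR (- k * t) * q t + expR (- k * t) * q' t - rho).
  move=> tx; apply: hdRB; last exact: hdR_lin.
  by apply: hdRM; [exact: hdR_expR|exact: hq].
have P2 t : 0 <= t <= x -> - k * expR (- k * t) * q t + expR (- k * t) * q' t - rho <= 0.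
  move=> tx; have e0 := expR_ge0 (- k * t).
  have e1 : expR (- k * t) <= 1.
    rewrite -expR0 ler_expR mulNr oppr_le0 mulr_ge0//.
    by case/andP: tx.
  have := ler_wpM2l e0 (q'le t tx); have := ler_wpM2r rho0 e1.
  rewrite mulrDr mul1r.
  rewrite (_ : expR (- k * t) * (k * q t) = - (- k * expR (- k * t) * q t)); last by ring.
  by move: (_ * q' t) (_ * rho) (_ * q t); clear=> *; lra.
have := hdR_le (lexx 0) x0 P1 P2; rewrite !mulr0 expR0 mul1r subr0 => h.
have {h} : expR (- k * x) * q x <= rho * (1 + X).
  rewrite mulrDr mulr1; apply: le_trans (lerD hD0 (ler_wpM2l rho0 xX)).
  by rewrite -lerBlDr.
rewrite mulrA => /(ler_wpM2l (expR_ge0 (k * x))).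
rewrite mulrA -expRD mulNr subrr expR0 mul1r => /le_trans; apply.
rewrite mulrC ler_wpM2l//; first by rewrite mulr_ge0// addr_ge0.
by rewrite ler_expR ler_wpM2l.
Qed.

End Gronwall.

(** * The rate of change of [wr] under the time evolution *)

Section Flux.
Context {R : realType}.
Local Notation C := R[i].

Lemma usub_coefF m (u p w : 'M[C]_m) z (y : 'cV[C]_(m + m)) :
  usubmx (coefF u p w z *m y) =
  p *m usubmx y - 2%:R *: (u *m dsubmx y + (2%:R * z) *: dsubmx y).
Proof.
rewrite -[y in LHS]vsubmxK /coefF mul_block_col col_mxKu; congr (_ + _).
by rewrite mulNmx -scalemxAl mulmxDl mul_scalar_mx.
Qed.
Lemma dsub_coefF m (u p w : 'M[C]_m) z (y : 'cV[C]_(m + m)) :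
  dsubmx (coefF u p w z *m y) =
  w *m usubmx y - 2%:R *: (u *m (u *m usubmx y) + z *: (u *m usubmx y)
    - (2%:R * z ^+ 2) *: usubmx y) - p *m dsubmx y.
Proof.
rewrite -[y in LHS]vsubmxK /coefF mul_block_col col_mxKd mulNmx; congr (_ - _).
rewrite mulmxBl; congr (_ - _); rewrite -scalemxAl; congr (_ *: _).
rewrite -mulmxA mulmxBl mul_scalar_mx mulmxDl mul_scalar_mx !mulmxBr scalerBr -scalemxAr.
rewrite addrA scalerA -mulrA -expr2; congr (_ - _).
rewrite -addrA; congr (_ + _).
by rewrite mulr_natl mulr2n scalerDl addrA addNr add0r.
Qed.

(** With components [a], [b] of [y], the matrix [p] enters through [(p a, b) - (a, p b)], which is
    zero, and [w] and [u u] enter through forms that are real. *)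
Lemma flux_F m (u p w : 'M[C]_m) z (y : 'cV[C]_(m + m)) :
  u ^t* = u -> p ^t* = p -> w ^t* = w ->
  Im (ip (usubmx (coefF u p w z *m y)) (dsubmx y)) +
  Im (ip (usubmx y) (dsubmx (coefF u p w z *m y))) =
  Im z * (4 * sqn (dsubmx y) + 8 * Re z * sqn (usubmx y)
    - 2 * Re (ip (usubmx y) (u *m usubmx y))).
Proof.
move=> hu hp hw; rewrite usub_coefF dsub_coefF.
move: (usubmx y) (dsubmx y) => a b.
have uu : Im (ip a (u *m (u *m a))) = 0.
  by rewrite mulmxA ip_herm// trC_mul hu.
rewrite !(ipDl, ipDr, ipNl, ipNr, ipZl, ipZr) (ipMl p) hp (ipMl u) hu !ip_self.
have e1 := ip_herm a hu; have e2 := ip_herm b hu; have e3 := ip_herm a hw.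
move: e1 e2 e3 uu; move: (ip a (u *m a)) (ip b (u *m b)) (ip a (w *m a)) (ip a (u *m (u *m a))) (ip a (p *m b)).
move=> [x1 x2] [x3 x4] [x5 x6] [x7 x8] [x9 x10] /= -> -> -> ->.
case: z => z1 z2.
rewrite !(cImD, cImN, cImM, cReD, cReM, cReN, cImC, cReC, expr2) /=; ring.
Qed.

End Flux.

Lemma subrBB (V : zmodType) (a b c d : V) : a - b - (c - d) = a - c - (b - d).
Proof. by rewrite !opprB [d - c]addrC [d - b]addrC addrACA. Qed.

Section UniformInTime.
Context {R : realType}.
Local Notation C := R[i].

Lemma quarter_planeP p q (w : R -> R -> 'M[C]_(p, q)) x t e :
  {within @quarter_plane R, continuous (fun p : R * R => w p.1 p.2)} ->
  0 <= x -> 0 <= t -> 0 < e -> exists2 d, 0 < d &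
    forall x' t', 0 <= x' -> 0 <= t' -> `|x' - x| < d -> `|t' - t| < d ->
      nrm (w x' t' - w x t) <= e.
Proof.
move=> /(_ (x, t)) wc x0 t0 e0.
have QP : quarter_plane (x, t) by split.
have {}wc : (fun p : R * R => w p.1 p.2) @ within (@quarter_plane R) (nbhs (x, t)) --> w x t.
  by rewrite (nbhs_subspace_in QP); exact: wc.
have /mcvg_nrm /cvgrPdist_le /(_ _ e0) : mcvg (within (@quarter_plane R) (nbhs (x, t)))
    (fun p : R * R => w p.1 p.2) (w x t) by exact: mcvg_cvg.
rewrite /within /= => /nbhs_ballP[d d0 H]; exists d => // x' t' x0' t0' xd td.
have := H (x', t'); rewrite sub0r normrN ger0_norm ?nrm_ge0//; apply; last by split.
by split; rewrite /ball /= distrC.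
Qed.

(** By continuity and compactness [wt x s] is close to [wt x t] for [s] near [t], uniformly in [x];
    the mean value inequality for [w x s - s wt x t] gives a first-order expansion with one radius
    for all [x]. *)
Lemma uniform_dt p q (w wt : R -> R -> 'M[C]_(p, q)) X t e :
  (forall x s, 0 <= x -> 0 <= s -> HD (w x) s (wt x s)) ->
  {within @quarter_plane R, continuous (fun p : R * R => wt p.1 p.2)} ->
  0 <= X -> 0 <= t -> 0 < e -> exists2 d, 0 < d &
    forall t', 0 <= t' -> `|t' - t| < d -> forall x, 0 <= x <= X ->
      nrm (w x t' - w x t - (t' - t)%:C *: wt x t) <= e * `|t' - t|.
Proof.
move=> hw wtc X0 t0 e0.
pose e1 := e / (2 * p * q).+1%:R.
have e10 : 0 < e1 by rewrite divr_gt0.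
have e12 : 0 < e1 / 2 by rewrite divr_gt0.
have [||d d0 Hd] := @uniform_of_local R 0 X
   (fun x d => forall s, 0 <= s -> `|s - t| < d -> nrm (wt x s - wt x t) <= e1) X0.
- by move=> x d d' dd' H s s0 sd; apply: H => //; exact: lt_le_trans dd'.
- move=> x /andP[x0 xX]; have [d d0 H] := quarter_planeP wtc x0 t0 e12.
  exists d => // y /andP[y0 yX] yd s s0 sd.
  have h1 := H y s y0 s0 yd sd.
  have tt : `|t - t| < d by rewrite subrr normr0.
  have h2 := H y t y0 t0 yd tt.
  rewrite (_ : wt y s - wt y t = (wt y s - wt x t) - (wt y t - wt x t)); last first.
    by rewrite opprB addrA subrK.
  apply: (le_trans (nrmB _ _)); lra.
have fin (r : R) : 0 <= r -> (2 * p * q)%:R * (e1 * r) <= e * r.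
  move=> r0; rewrite /e1 mulrA; apply: ler_wpM2r => //.
  by rewrite mulrA ler_pdivrMr// mulrC ler_pM2l// ler_nat leqnSn.
have dfx x s : 0 <= x -> 0 <= s -> HD (fun s => w x s - s%:C *: wt x t) s (wt x s - wt x t).
  move=> x0 s0; apply: HDB; first exact: hw.
  by have := HD_scalR (wt x t) (hdR_id s); rewrite scale1r.
exists d => // t' t'0 td x /andP[x0 xX].
have xX' : 0 <= x <= X by rewrite x0 xX.
have [tt'|t't] := leP t t'.
  rewrite [`|t' - t|]ger0_norm ?subr_ge0//; apply: le_trans (fin _ _); last by rewrite subr_ge0.
  have := @HD_mvt R p q (fun s => w x s - s%:C *: wt x t) (fun s => wt x s - wt x t)
    (fun s => e1 * s) (fun=> e1) t t' t0 tt'.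
  rewrite -mulrBr (_ : w x t' - _ - _ = w x t' - w x t - (t' - t)%:C *: wt x t); last first.
    by rewrite rmorphB scalerBl subrBB.
  apply.
  - by move=> s /andP[ts st]; apply: dfx => //; exact: le_trans ts.
  - by move=> s _; exact: hdR_lin.
  - move=> s /andP[ts st]; apply: (Hd x xX'); first exact: le_trans ts.
    apply: le_lt_trans td; rewrite !ger0_norm ?subr_ge0//; exact: lerB.
have t't' := ltW t't.
rewrite [`|t' - t|]distrC [`|t - t'|]ger0_norm ?subr_ge0//; apply: le_trans (fin _ _); last by rewrite subr_ge0.
have := @HD_mvt R p q (fun s => w x s - s%:C *: wt x t) (fun s => wt x s - wt x t)
    (fun s => e1 * s) (fun=> e1) t' t t'0 t't'.
rewrite -mulrBr nrmBC (_ : w x t' - _ - _ = w x t' - w x t - (t' - t)%:C *: wt x t); last first.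
  by rewrite rmorphB scalerBl subrBB.
apply.
- by move=> s /andP[ts st]; apply: dfx => //; exact: le_trans ts.
- by move=> s _; exact: hdR_lin.
- move=> s /andP[ts st]; apply: (Hd x xX'); first exact: le_trans ts.
  apply: le_lt_trans td; rewrite [`|s - t|]distrC [`|t' - t|]distrC !ger0_norm ?subr_ge0//; exact: lerB.
Qed.

End UniformInTime.

(** This is [F_x = G_t + G F - F G]. The evolution equation [utE] enters in the lower left block;
    the other blocks are identities, the last one because [v] and [s] commute. *)
Lemma zero_curvature_algebra {R : realType} m (U p w w' ut : 'M[R[i]]_m) z :
  ut = w' - 3%:R *: (U *m p + p *m U) ->
  let v := U + (2%:R * z)%:M in let s := U - z%:M in
  block_mx w (- (2%:R *: p)) (w' - 2%:R *: (p *m s + v *m p)) (- w) =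
  block_mx 0 0 ut 0
  + block_mx 0 1%:M s 0 *m block_mx p (- (2%:R *: v)) (w - 2%:R *: (v *m s)) (- p)
  - block_mx p (- (2%:R *: v)) (w - 2%:R *: (v *m s)) (- p) *m block_mx 0 1%:M s 0.
Proof.
move=> utE v s.
have vs : s *m v = v *m s.
  rewrite /v /s mulmxBl !mulmxDr mulmxDl !mulmxN.
  rewrite !mul_scalar_mx !mul_mx_scalar.
  by apply/matrixP => i j; move: (U *m U) => UU; rewrite !mxE; ring.
rewrite !mulmx_block !mul0mx !mulmx0 !mul1mx !mulmx1 !add0r !addr0.
rewrite add_block_mx opp_block_mx add_block_mx !add0r.
congr block_mx.
- by rewrite mulNmx -scalemxAl opprK subrK.
- by rewrite -opprD scaler_nat mulr2n.
- rewrite utE mulNmx opprK /s /v mulmxBr mulmxDl mulmxBl mul_scalar_mx mul_mx_scalar mul_scalar_mx.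
  by apply/matrixP => i j; move: (U *m p) (p *m U) => A B; rewrite !mxE; ring.
- rewrite mulmxN -scalemxAr vs opprD opprK.
  by move: (v *m s) => A; apply/matrixP => i j; rewrite !mxE; ring.
Qed.

(** [D] is the velocity of a solution along a line [x + c s = const]. The flux is [Im z] times the
    sum of [4 * sqn y2] and a form in [y1], where the two summands of [c] absorb the terms with
    [Re z] and with [u]. *)
Lemma line_flux {R : realType} m (u p w : 'M[R[i]]_m) z (Y : 'cV[R[i]]_(m + m)) (K : R) :
  u ^t* = u -> p ^t* = p -> w ^t* = w -> 0 < Im z ->
  (forall i j, `|Re (u i j)| <= K /\ `|Im (u i j)| <= K) ->
  let c : R := 8 * `|Re z| + 4 * (`|K| * m%:R) in
  let D := coefF u p w z *m Y - c%:C *: (coefG u z *m Y) in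
  is_true (0 <= Im (ip (usubmx D) (dsubmx Y)) + Im (ip (usubmx Y) (dsubmx D)) ).
Proof.
move=> hu hp hw z0 uK c D.
have split A B : Im (ip (usubmx (A - c%:C *: B)) (dsubmx Y)) +
    Im (ip (usubmx Y) (dsubmx (A - c%:C *: B))) =
    (Im (ip (usubmx A) (dsubmx Y)) + Im (ip (usubmx Y) (dsubmx A))) -
    c * (Im (ip (usubmx B) (dsubmx Y)) + Im (ip (usubmx Y) (dsubmx B))).
  have uE : usubmx (A - c%:C *: B) = usubmx A - c%:C *: usubmx B.
    by apply/matrixP => i j; rewrite !mxE.
  have dE : dsubmx (A - c%:C *: B) = dsubmx A - c%:C *: dsubmx B.
    by apply/matrixP => i j; rewrite !mxE.
  rewrite uE dE ipDl ipDr ipNl ipNr ipZl ipZr !cImD !cImN !cImM !cReC !cImC /=.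
  move: (ip (usubmx A) (dsubmx Y)) (ip (usubmx B) (dsubmx Y)) => i1 i2.
  by move: (ip (usubmx Y) (dsubmx A)) (ip (usubmx Y) (dsubmx B)) => i3 i4; ring.
rewrite /D split (flux_F z Y hu hp hw) usub_coefG dsub_coefG.
rewrite (_ : Im (ip (dsubmx Y) (dsubmx Y)) = 0); last by rewrite ip_self.
rewrite mulmxBl ipDr ipNr mul_scalar_mx ipZr ip_self cImD cImN cImM ip_herm//= mulr0 !add0r.
have q0 := sqn_ge0 (usubmx Y); have s0 := sqn_ge0 (dsubmx Y).
have /ler_normlP[_ h1] := ip_mx_le (usubmx Y) (usubmx Y) uK.
move: (sqn (usubmx Y)) (sqn (dsubmx Y)) (Re (ip _ _)) q0 s0 h1 => q s t q0 s0 h1.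
rewrite (_ : _ - c * - (Im z * q) = Im z * (4 * s + 8 * Re z * q - 2 * t + c * q)); last by ring.
apply: mulr_ge0; first exact: ltW.
have h2 : K * m%:R * (q + q) <= 2 * (`|K| * m%:R * q).
  rewrite (_ : K * m%:R * (q + q) = 2 * (K * (m%:R * q))); last by ring.
  rewrite -[`|K| * _ * _]mulrA; apply: ler_wpM2l => //; apply: ler_wpM2r; first by rewrite mulr_ge0.
  exact: ler_norm.
have h3 : - (Re z * q) <= `|Re z| * q.
  rewrite -mulNr; apply: ler_wpM2r => //; by rewrite -normrN ler_norm.
rewrite (_ : _ + c * q = 4 * s + 8 * (Re z * q) - 2 * t + 8 * (`|Re z| * q) + 4 * (`|K| * m%:R * q));
  last by rewrite /c; ring.
move: (`|K| * m%:R * q) (`|Re z| * q) (Re z * q) (K * m%:R * (q + q)) h1 h2 h3 => k1 k2 k3 k4 h1 h2 h3.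
lra.
Qed.

Lemma line_split {R : realType} N (a1 a2 a3 a4 a5 a6 : 'cV[R[i]]_N) k l :
  a1 - a3 - k *: (a5 - l *: a6) =
  (a1 - a2 - k *: a4) + k *: (a4 - a5) + (a2 - a3 - (- (l * k)) *: a6).
Proof. by apply/matrixP => i j; rewrite !mxE; ring. Qed.

(** * Solutions that satisfy both linear systems *)

Section Evolution.
Context {R : realType}.
Local Notation C := R[i].
Variables (m : nat) (u : R -> R -> 'M[C]_m) (K : R) (z : C).
Hypothesis z0 : 0 < Im z.
Hypothesis uh : forall x t, 0 <= x -> 0 <= t -> (u x t) ^t* = u x t.
Hypothesis ukdv : kdv_solution u.
Hypothesis uK : forall x t, 0 <= x -> 0 <= t -> forall i j,
  `|Re (u x t i j)| <= K /\ `|Im (u x t i j)| <= K.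
Local Notation G := (fun x t => coefG (u x t) z).
Local Notation F := (fun x t => coefF (u x t) (dx u x t) (dx (dx u) x t) z).
Hypothesis GC1 : quarter_plane_C1 G.

Lemma HD_dx x t : 0 <= x -> 0 <= t -> HD (u^~ t) x (dx u x t).
Proof. by move=> x0 t0; have [_ h _ _ _] := ukdv x0 t0; exact: HD_hl. Qed.
Lemma HD_dxx x t : 0 <= x -> 0 <= t -> HD ((dx u)^~ t) x (dx (dx u) x t).
Proof. by move=> x0 t0; have [_ _ h _ _] := ukdv x0 t0; exact: HD_hl. Qed.
Lemma HD_dxxx x t : 0 <= x -> 0 <= t -> HD ((dx (dx u))^~ t) x (dx (dx (dx u)) x t).
Proof. by move=> x0 t0; have [_ _ _ h _] := ukdv x0 t0; exact: HD_hl. Qed.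
Lemma HD_dt x t : 0 <= x -> 0 <= t -> HD (u x) t (dt u x t).
Proof. by move=> x0 t0; have [h _ _ _ _] := ukdv x0 t0; exact: HD_hl. Qed.

Lemma herm_derive (f : R -> 'M[C]_m) x D : 0 <= x -> (forall y, 0 <= y -> (f y) ^t* = f y) ->
  HD f x D -> D ^t* = D.
Proof.
move=> x0 fh fD; apply: (HD_unique x0 _ fD).
by apply: HD_ext (HD_trC fD).
Qed.
Lemma dx_herm x t : 0 <= x -> 0 <= t -> (dx u x t) ^t* = dx u x t.
Proof.
move=> x0 t0; apply: (herm_derive x0 _ (HD_dx x0 t0)) => y y0; exact: uh.
Qed.
Lemma dxx_herm x t : 0 <= x -> 0 <= t -> (dx (dx u) x t) ^t* = dx (dx u) x t.
Proof.
move=> x0 t0; apply: (herm_derive x0 _ (HD_dxx x0 t0)) => y y0; exact: dx_herm.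
Qed.

Lemma HD_dtG x t : 0 <= x -> 0 <= t -> HD (G x) t (dt G x t).
Proof. by move=> x0 t0; have [/(_ x t x0 t0)[_ h] _ _] := GC1; exact: HD_hl. Qed.

Lemma dtGE x t : 0 <= x -> 0 <= t -> dt G x t = block_mx 0 0 (dt u x t) 0.
Proof.
move=> x0 t0; apply: (HD_unique t0 (HD_dtG x0 t0)).
apply: HD_block; [exact: HD_cst|exact: HD_cst| |exact: HD_cst].
by apply: HD_eq (HDB (HD_dt x0 t0) (HD_cst z%:M t)) _; rewrite subr0.
Qed.

Lemma zero_curvature x t : 0 <= x -> 0 <= t ->
  HD (F^~ t) x (dt G x t + G x t *m F x t - F x t *m G x t).
Proof.
move=> x0 t0; rewrite dtGE//.
have h0 := HD_dx x0 t0; have h1 := HD_dxx x0 t0; have h2 := HD_dxxx x0 t0.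
have hv : HD (fun x => u x t + (2%:R * z)%:M) x (dx u x t).
  by apply: HD_eq (HDD h0 (HD_cst (2%:R * z)%:M x)) _; rewrite addr0.
have hw : HD (fun x => u x t - z%:M) x (dx u x t).
  by apply: HD_eq (HDB h0 (HD_cst z%:M x)) _; rewrite subr0.
have := HD_block h1 (HDN (HDZ (2%:R) hv)) (HDB h2 (HDZ (2%:R) (HDM hv hw))) (HDN h1).
move=> H; apply: (HD_eq H).
have [_ _ _ _ kdv] := ukdv x0 t0.
apply: zero_curvature_algebra.
by apply/eqP; rewrite -subr_eq0 opprB addrA kdv.
Qed.

(** For each [t], [y] solves the equation in [x] with initial value [Y0 t], and [Y0] evolves by [F]
    at the boundary. Nothing relates [Psi] at different times; [evo_uniform] proves that [y] evolves
    by [F] at every [x]. *)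
Variables (Psi : R -> R -> 'M[C]_(m + m)) (Y0 : R -> 'cV[C]_(m + m)).
Hypothesis PsiF : forall t, 0 <= t -> fundamental_solution (u^~ t) z (Psi t).
Hypothesis Y0F : forall t, 0 <= t -> HD Y0 t (F 0 t *m Y0 t).
Local Notation y := (fun x t => Psi t x *m Y0 t).

Lemma evo_sol t : 0 <= t -> sol (u^~ t) z (y^~ t).
Proof. by move=> t0; exact: sol_fund (PsiF t0). Qed.

Let Kg := `|K| + (`|Re z| + `|Im z|) + 1.
Lemma coefG_bound x t i j : 0 <= x -> 0 <= t ->
  `|Re (G x t i j)| <= Kg /\ `|Im (G x t i j)| <= Kg.
Proof.
move=> x0 t0.
have p0 : 0 <= `|K| by []. have p1 : 0 <= `|Re z| by []. have p2 : 0 <= `|Im z| by [].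
have Kg0 : 0 <= Kg by rewrite /Kg; lra.
have Kg1 : 1 <= Kg by rewrite /Kg; lra.
rewrite /coefG /block_mx !mxE; case: splitP => k _; rewrite mxE; case: splitP => l _; rewrite !mxE.
- by rewrite /= normr0.
- by case: eqP => _; rewrite ?mulr1n ?mulr0n /= ?normr0 ?normr1.
- have [h1 h2] := uK x0 t0 k l; have hK := ler_norm K.
  rewrite cReD cImD cReN cImN.
  split; apply: (le_trans (ler_normD _ _)); rewrite normrN.
  + have : `|Re (z *+ (k == l))| <= `|Re z| by case: eqP => _; rewrite ?mulr1n ?mulr0n //= normr0.
    by rewrite /Kg; lra.
  + have : `|Im (z *+ (k == l))| <= `|Im z| by case: eqP => _; rewrite ?mulr1n ?mulr0n //= normr0.
    by rewrite /Kg; lra.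
- by rewrite /= normr0.
Qed.

(** With [A], [A'] the values of [G] at two times, [A1] its time derivative and [B] the value of
    [F], the left side is the x-derivative of the error in the first-order expansion of [y]: [A']
    times that error, plus a remainder of higher order in [tau]. *)
Lemma evo_remainder (A A' A1 B : 'M[C]_(m + m)) (v v' : 'cV[C]_(m + m)) (tau : C) :
  A' *m v' - A *m v - tau *: ((A1 + A *m B - B *m A) *m v + B *m (A *m v)) =
  A' *m (v' - v - tau *: (B *m v)) +
  ((A' - A - tau *: A1) *m v + tau *: ((A' - A) *m (B *m v))).
Proof.
rewrite !mulmxBr !mulmxBl -!scalemxAl -!scalemxAr mulmxDl !mulmxA subrK.
move: (A' *m v') (A *m v) (A' *m v) (A1 *m v) (A *m B *m v) (A' *m B *m v) => a b c d e f.
by rewrite scalerDr scalerBr; apply/matrixP => i j; rewrite !mxE; ring.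
Qed.

(* The difference [D] of the two sides vanishes to first order in [t' - t] at [x = 0],
   and zero curvature makes its [x]-derivative [G x t' *m D] plus a small term. *)
Lemma evo_uniform X t e : 0 <= X -> 0 <= t -> 0 < e ->
  exists2 d, 0 < d & forall t', 0 <= t' -> `|t' - t| < d -> forall x, 0 <= x <= X ->
    nrm (y x t' - y x t - (t' - t)%:C *: (F x t *m y x t)) <= e * `|t' - t|.
Proof.
move=> X0 t0 e0.
have yc : mcont (y^~ t) := HD_mcont (evo_sol t0).
have Fyc : mcont (fun x => F x t *m y x t).
  apply: mcontM => // x x0; exact: HD_cont (zero_curvature x0 t0).
have Gtc : mcont (fun x => dt G x t).
  move=> x x0; apply/mcvg_hlP => e1 e10.
  have [_ _ c] := GC1; have [d d0 H] := quarter_planeP c x0 t0 e10.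
  exists d => // x' x'0 _ xd; apply: H => //; by rewrite subrr normr0.
have [By By0 HBy] := mcont_bounded X0 yc.
have [BF BF0 HBF] := mcont_bounded X0 Fyc.
have [BG BG0 HBG] := mcont_bounded X0 Gtc.
pose N := (m + m)%N.
pose B1 := By + BF + 1.
have B10 : 0 < B1 by rewrite /B1; lra.
pose c := (1 + X) * expR ((4 * Kg * N%:R + 1) * X).
(* The summand 1 gives [c1 <= c1 ^+ 2], so that the bound on [sqn] becomes a square. *)
pose c1 := N%:R * 2 * B1 ^+ 2 * c + 1.
have Kg0 : 0 <= Kg by rewrite /Kg !addr_ge0.
have c0 : 0 <= c by rewrite /c mulr_ge0 ?expR_ge0// addr_ge0.
have c1' : 0 <= N%:R * 2 * B1 ^+ 2 * c.
  by apply: mulr_ge0 => //; apply: mulr_ge0; [exact: mulr_ge0 | rewrite exprn_ge0// ltW].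
have c10 : 1 <= c1 by rewrite /c1 lerDr.
have c1pos : 0 < c1 by apply: lt_le_trans c10.
pose e1 := e / ((2 * N * 1).+1%:R * c1).
have e10 : 0 < e1 by rewrite divr_gt0// mulr_gt0.
have [_ _ Gt_cont] := GC1.
have [d1 d10 H1] := uniform_dt HD_dtG Gt_cont X0 t0 e10.
have /HD_nrmP /(_ _ e10) [d2 d20 H2] := Y0F t0.
(* Within this radius [G] moves by at most [e1], its increment being bounded by [e1 + BG] times the
   time step. *)
pose d3 := e1 / (e1 + BG).
have d30 : 0 < d3 by rewrite divr_gt0// addr_gt0.
exists (Num.min d1 (Num.min d2 d3)) => [|t' t'0]; first by rewrite !lt_min d10 d20.
rewrite !lt_min => /and3P[td1 td2 td3] x xX.
set tau := t' - t.
have tau0 : 0 <= `|tau| by [].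
pose D s := y s t' - y s t - tau%:C *: (F s t *m y s t).
pose r s := (G s t' - G s t - tau%:C *: dt G s t) *m y s t
   + tau%:C *: ((G s t' - G s t) *m (F s t *m y s t)).
have hD s : 0 <= s <= X -> HD D s (G s t' *m D s + r s).
  move=> /andP[s0 _].
  have h1 := evo_sol t'0 s0; have h2 := evo_sol t0 s0.
  have h3 := HDZ tau%:C (HDM (zero_curvature s0 t0) h2).
  apply: HD_eq (HDB (HDB h1 h2) h3) _.
  exact: (evo_remainder (G s t) (G s t') (dt G s t) (F s t) (y s t) (y s t') tau%:C).
have hr s : 0 <= s <= X -> nrm (r s) <= e1 * `|tau| * B1.
  move=> sX; have g1 := H1 t' t'0 td1 s sX.
  have g2 : nrm (G s t' - G s t) <= e1.
    rewrite -[G s t' - G s t](subrK (tau%:C *: dt G s t)).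
    apply: (le_trans (nrmD _ _)); rewrite nrmZ.
    apply: (@le_trans _ _ (e1 * `|tau| + `|tau| * BG)).
      by apply: lerD => //; apply: ler_wpM2l => //; exact: HBG.
    rewrite mulrC -mulrDr -ler_pdivlMr ?addr_gt0//.
    exact: ltW.
  apply: (le_trans (nrmD _ _)); rewrite nrmZ.
  apply: (@le_trans _ _ (e1 * `|tau| * By + `|tau| * (e1 * BF))).
    apply: lerD.
      by apply: (le_trans (nrmM _ _)); apply: ler_pM; rewrite ?nrm_ge0//; exact: HBy.
    apply: ler_wpM2l => //; apply: (le_trans (nrmM _ _)).
    by apply: ler_pM; rewrite ?nrm_ge0//; exact: HBF.
  rewrite (_ : _ + _ = e1 * `|tau| * (By + BF)); last by ring.
  by apply: ler_wpM2l; [rewrite mulr_ge0// ltW | rewrite lerDl].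
have yE0 s : 0 <= s -> y 0 s = Y0 s by move=> s0; rewrite (PsiF s0).1 mul1mx.
have hD0 : nrm (D 0) <= e1 * `|tau| * B1.
  rewrite /D !yE0//; apply: (le_trans (H2 t' t'0 td2)).
  apply: ler_peMr; first by rewrite mulr_ge0// ltW.
  by rewrite /B1 lerDr addr_ge0 ?ltW.
have rho0 : 0 <= N%:R * (2 * (e1 * `|tau| * B1) ^+ 2) by rewrite mulr_ge0// mulr_ge0// sqr_ge0.
have := gronwall X0 Kg0 rho0 hD _ (fun s sX => sqn_nrm (hr s sX)) (sqn_nrm hD0) xX.
have hA s : 0 <= s <= X -> forall i j, `|Re (G s t' i j)| <= Kg /\ `|Im (G s t' i j)| <= Kg.
  by move=> /andP[s0 _] i j; exact: coefG_bound.
move=> /(_ hA); rewrite -/N -/c => hsq.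
have hsq2 : sqn (D x) <= (c1 * (e1 * `|tau|)) ^+ 2.
  apply: (le_trans hsq).
  rewrite (_ : _ * c = (N%:R * 2 * B1 ^+ 2 * c) * (e1 * `|tau|) ^+ 2); last by ring.
  rewrite [(c1 * _) ^+ 2]exprMn; apply: ler_wpM2r; first exact: sqr_ge0.
  apply: (@le_trans _ _ c1); first by rewrite /c1 lerDl.
  by rewrite expr2 ler_peMr// ltW.
have c1e : 0 <= c1 * (e1 * `|tau|) by apply: mulr_ge0; [exact: ltW | rewrite mulr_ge0// ltW].
apply: (le_trans (nrm_sqn c1e hsq2)).
rewrite (_ : _ * (c1 * _) = (2 * N * 1)%:R * c1 * e1 * `|tau|); last by rewrite /N; ring.
apply: ler_wpM2r => //.
rewrite /e1 mulrA ler_pdivrMr ?mulr_gt0// [leRHS]mulrC; apply: ler_wpM2r; first exact: ltW.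
by apply: ler_wpM2r; [exact: ltW | rewrite ler_nat leqnSn].
Qed.

(** Chain rule, with the time step taken uniformly in [x] thanks to [evo_uniform]. The absolute
    value is inactive near [s], where the position stays positive because [x0 > 0]. *)
Lemma evo_line c x0 t0 s : 0 <= c -> 0 < x0 -> 0 <= s -> s <= t0 ->
  let x := x0 + c * (t0 - s) in
  HD (fun s' => y `|x0 + c * (t0 - s')| s') s
     (F x s *m y x s - c%:C *: (G x s *m y x s)).
Proof.
move=> c0 x00 s0 st0 x.
have xx0 : x0 <= x by rewrite /x lerDl mulr_ge0// subr_ge0.
have xpos : 0 < x by exact: lt_le_trans xx0.
have x0' := ltW xpos.
apply/HD_nrmP => e e0.
have X0 : 0 <= x + 1 by rewrite addr_ge0 ?ler01.
have c1 : 0 < c + 1 by rewrite ltr_wpDl.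
have e3 : 0 < e / 3 by rewrite divr_gt0.
have e3c : 0 < e / 3 / (c + 1) by rewrite divr_gt0.
have [d1 d10 H1] := evo_uniform X0 s0 e3.
have Fyc : mcont (fun x => F x s *m y x s).
  apply: mcontM; last exact: HD_mcont (evo_sol s0).
  move=> x1 x10; exact: HD_cont (zero_curvature x10 s0).
have [d2 d20 H2] := mcontP x0' Fyc e3.
have /HD_nrmP /(_ _ e3c) [d3 d30 H3] := evo_sol s0 x0'.
pose dm := Num.min (Num.min d2 d3) (Num.min 1 x0).
have dm0 : 0 < dm by rewrite !lt_min d20 d30 x00 ltr01.
exists (Num.min d1 (dm / (c + 1))) => [|s' s'0]; first by rewrite lt_min d10 divr_gt0.
rewrite lt_min => /andP[sd1]; rewrite ltr_pdivlMr// => sdm.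
set tau := s' - s; rewrite -/tau in sd1 sdm.
pose x' := x0 + c * (t0 - s').
have xE : x' - x = - (c * tau) by rewrite /x' /x /tau; ring.
have xN : `|x' - x| = c * `|tau| by rewrite xE normrN normrM (ger0_norm c0).
have xdm : `|x' - x| < dm.
  by rewrite xN; apply: le_lt_trans sdm; rewrite mulrC ler_wpM2l// lerDl ler01.
move: (xdm); rewrite !lt_min => /andP[/andP[xd2 xd3] /andP[xd1 xdx]].
have x'0 : 0 <= x'.
  have := ler_norm (x - x'); rewrite distrC => /le_trans /(_ (ltW xdx)).
  by move=> /le_trans /(_ xx0); rewrite gerBl.
have x'X : 0 <= x' <= x + 1.
  by rewrite x'0 -lerBlDl; apply: le_trans (ler_norm _) (ltW xd1).
rewrite -/x' (ger0_norm x'0) -/x (ger0_norm x0').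
have K1 := H1 s' s'0 sd1 x' x'X; have K2 := H2 x' x'0 xd2; have K3 := H3 x' x'0 xd3.
rewrite -/tau in K1.
(* A time step at [x'], the variation of [F y] between [x] and [x'], and a space step at time [s],
   each contributing [e / 3]. *)
have -> : y x' s' - y x s - tau%:C *: (F x s *m y x s - c%:C *: (G x s *m y x s)) =
  (y x' s' - y x' s - tau%:C *: (F x' s *m y x' s)) +
  tau%:C *: (F x' s *m y x' s - F x s *m y x s) +
  (y x' s - y x s - (x' - x)%:C *: (G x s *m y x s)).
  by rewrite xE rmorphN rmorphM; exact: line_split.
apply: (le_trans (nrmD _ _)); apply: (le_trans (lerD (nrmD _ _) (lexx _))).
rewrite nrmZ.
have K4 : nrm (y x' s - y x s - (x' - x)%:C *: (G x s *m y x s)) <= e / 3 * `|tau|.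
  apply: (le_trans K3); rewrite xN mulrA; apply: ler_wpM2r => //.
  rewrite mulrAC ler_pdivrMr//; apply: ler_wpM2l; first exact: ltW.
  by rewrite lerDl ler01.
have K5 := ler_wpM2l (normr_ge0 tau) K2.
rewrite (_ : e * `|tau| = e / 3 * `|tau| + `|tau| * (e / 3) + e / 3 * `|tau|); last by field.
by apply: lerD K4; apply: lerD K1 K5.
Qed.

Hypothesis wr0 : forall x, 0 <= x -> 0 <= wr (y x 0).

(* [wr] decreases in [x] at rate [Im z * sqn y1] and cannot decrease in [t]
   faster than a constant multiple of that, so it is monotone along the lines
   [x + c t = const] for large [c]. *)
Lemma evo_pos x t : 0 <= x -> 0 <= t -> 0 <= wr (y x t).
Proof.
move=> x0 t0.
(* A line ending at [x1 > 0] stays away from the boundary; [x = 0] is then covered since [wr] is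
   nonincreasing in [x]. *)
suff H x1 : 0 < x1 -> 0 <= wr (y x1 t).
  have x1 : x <= x + 1 by rewrite lerDl ler01.
  apply: le_trans (H (x + 1) _) _; first by rewrite ltr_wpDl.
  by apply: (wr_noninc _ z0 (evo_sol t0)) => // s s0; exact: uh.
move=> x10; pose c := 8 * `|Re z| + 4 * (`|K| * m%:R).
have c0 : 0 <= c by rewrite /c addr_ge0// mulr_ge0// mulr_ge0.
pose xs s := x1 + c * (t - s).
pose Yl s := y `|xs s| s.
pose D s := F (xs s) s *m y (xs s) s - c%:C *: (G (xs s) s *m y (xs s) s).
have xs0 s : s <= t -> 0 < xs s.
  by move=> st; rewrite /xs ltr_pwDl// mulr_ge0// subr_ge0.
have YlE s : s <= t -> Yl s = y (xs s) s by move=> st; rewrite /Yl gtr0_norm// xs0.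
pose d s := Im (ip (usubmx (D s)) (dsubmx (Yl s))) + Im (ip (usubmx (Yl s)) (dsubmx (D s))).
have hd s : 0 <= s <= t -> hdR (fun s => wr (Yl s)) s (d s).
  move=> /andP[s0 st]; have H := evo_line c0 x10 s0 st.
  by have [_ h] := HD_ip (HD_usub H) (HD_dsub H).
have dpos s : 0 <= s <= t -> 0 <= d s.
  move=> /andP[s0 st]; rewrite /d YlE// /D.
  have X0 := ltW (xs0 _ st).
  exact: (line_flux _ (uh X0 s0) (dx_herm X0 s0) (dxx_herm X0 s0) z0 (uK X0 s0)).
have := hdR_ge (lexx 0) t0 hd dpos.
rewrite (YlE 0 t0) (YlE t (lexx t)) => /(le_trans (wr0 (ltW (xs0 0 t0)))).
by have -> : xs t = x1 by rewrite /xs subrr mulr0 addr0.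
Qed.

End Evolution.

(** * The Weyl solution of the initial potential *)

(** Dictionary: [P] and [Q] are the adjoints of [L2] and [L1], [Si] is the inverse of [S], and [A1],
    [A2] are [L1], [L2]. This is the second-order equation for the transformed solution [ps], with
    derivative [ps1]. *)
Lemma transform_algebra {R : realType} m n (P Q : 'M[R[i]]_(m, n)) (Si al : 'M[R[i]]_n)
    (A1 A2 : 'M[R[i]]_(n, m)) (h : 'cV[R[i]]_n) (p ps ps1 : 'cV[R[i]]_m) (z ik : R[i]) :
  ps1 = ik *: p + Q *m h - P *m Si *m A2 *m ps ->
  P *m h = p - ps ->
  al *m h = z *: h + Si *m (A2 *m (ik *: p + Q *m h) + A1 *m ps) ->
  - z *: p + (P *m al *m h + Q *m (Si *m A2 *m ps)) -
    (- (Q *m Si *m A2 + P *m Si *m A2 *m (P *m Si *m A2) + P *m Si *m A1) *m ps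
     + P *m Si *m A2 *m ps1) =
  (2%:R *: (P *m Si *m A2 *m (P *m Si *m A2) + Q *m Si *m A2 + P *m Si *m A1) - z%:M) *m ps.
Proof.
move=> psE PhE ahE.
set X := P *m Si *m A2 in psE *.
have pE : ik *: p + Q *m h = ps1 + X *m ps by rewrite psE subrK.
rewrite -[P *m al *m h]mulmxA ahE pE [P *m (z *: h + _)]mulmxDr -scalemxAr PhE.
have -> : P *m (Si *m (A2 *m (ps1 + X *m ps) + A1 *m ps)) =
    X *m ps1 + X *m X *m ps + P *m Si *m A1 *m ps.
  by rewrite !mulmxA mulmxDr !mulmxA -/X mulmxDr !mulmxA.
rewrite !mulmxA mulNmx mulmxBl mul_scalar_mx -scalemxAl !mulmxDl.
move: (X *m ps1) (X *m X *m ps) (P *m Si *m A1 *m ps) (Q *m Si *m A2 *m ps) => a1 a2 a3 a4.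
by clear; apply/matrixP => i j; rewrite !mxE; ring.
Qed.

(** The commutator relation moves [al] past [S]; the result eliminates [al *m h] in
    [transform_algebra]. *)
Lemma alpha_h_algebra {R : realType} m n (P Q : 'M[R[i]]_(m, n)) (S al : 'M[R[i]]_n)
    (A1 A2 : 'M[R[i]]_(n, m)) (g h : 'cV[R[i]]_n) (p ps : 'cV[R[i]]_m) (z ik : R[i]) :
  S *m h = g ->
  al *m g = z *: g + (ik *: (A2 *m p) + A1 *m p) ->
  al *m S - S *m al = A1 *m P - A2 *m Q ->
  ps = p - P *m h ->
  S *m (al *m h) = z *: g + (A2 *m (ik *: p + Q *m h) + A1 *m ps).
Proof.
move=> Sh ag com psE.
have -> : S *m (al *m h) = al *m g - (al *m S - S *m al) *m h.
  by rewrite mulmxBl opprB -!mulmxA Sh addrC subrK.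
rewrite com ag psE mulmxBl mulmxBr mulmxDr -scalemxAr !mulmxA.
move: (A2 *m p) (A1 *m p) (A1 *m P *m h) (A2 *m Q *m h) => a1 a2 a3 a4.
by clear; apply/matrixP => i j; rewrite !mxE; ring.
Qed.

Section Transformed.
Context {R : realType}.
Local Notation C := R[i].
Variables (m n : nat) (alpha : 'M[C]_n) (th : 'M[C]_(n, m)).
Variables (L1 L2 : R -> 'M[C]_(n, m)) (S : R -> 'M[C]_n).
Hypothesis alphaH : alpha ^t* = alpha.
Hypothesis L1D : forall x, 0 <= x -> HD L1 x (alpha *m L2 x).
Hypothesis L2D : forall x, 0 <= x -> HD L2 x (- L1 x).
Hypothesis SD : forall x, 0 <= x -> HD S x (L2 x *m (L2 x) ^t*).
Hypothesis L10 : L1 0 = th.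
Hypothesis L20 : L2 0 = 0.
Hypothesis S0 : S 0 = 1%:M.

Lemma S_herm x : 0 <= x -> (S x) ^t* = S x.
Proof.
move=> x0; apply/eqP; rewrite -subr_eq0; apply/eqP.
rewrite (@HD_const _ _ _ (fun x => (S x) ^t* - S x) x x0).
  by rewrite S0 trmx1 map_mx1 subrr.
move=> y y0; apply: HD_eq (HDB (HD_trC (SD y0)) (SD y0)) _.
by rewrite trC_mul trC_K subrr.
Qed.

(** [S] starts at the identity and has the nonnegative derivative [L2 L2^*]. Staying above the
    identity makes it invertible with bounded inverse. *)
Lemma S_ge x (w : 'cV[C]_n) : 0 <= x -> sqn w <= Re (ip w (S x *m w)).
Proof.
move=> x0; have -> : sqn w = Re (ip w (S 0 *m w)) by rewrite S0 mul1mx.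
apply: (@hdR_ge _ (fun x => Re (ip w (S x *m w))) (fun x => sqn ((L2 x) ^t* *m w))) => //.
- move=> t /andP[t0 _]; have [h _] := HD_ip (HD_cst w t) (HDMr w (SD t0)).
  apply: (hdR_eq h); rewrite -mulmxA /sqn ipMl trC_K.
  by rewrite /ip trmx0 map_mx0 mul0mx mxE add0r.
- by move=> t _; exact: sqn_ge0.
Qed.

Lemma S_unit x : 0 <= x -> S x \in unitmx.
Proof.
move=> x0; apply: inj_unitmx => w Sw; apply: sqn_eq0; apply/eqP.
rewrite eq_le sqn_ge0 andbT; apply: (le_trans (S_ge w x0)).
by rewrite Sw /ip mulmx0 mxE.
Qed.

Lemma Sinv_herm x : 0 <= x -> (invmx (S x)) ^t* = invmx (S x).
Proof.
move=> x0; have u := S_unit x0.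
have : (invmx (S x)) ^t* *m S x = 1%:M.
  by rewrite -{2}(S_herm x0) -trC_mul mulmxV// trmx1 map_mx1.
by move=> /(congr1 (mulmx^~ (invmx (S x)))); rewrite mulmxK// mul1mx.
Qed.

(** For a basis vector [e] and [w = S^-1 e], [sqn w <= Re (ip w e) <= (sqn w + 1) / 2], hence
    [sqn w <= 1]. *)
Lemma Sinv_bound x : 0 <= x -> nrm (invmx (S x)) <= (2 * n * n)%:R.
Proof.
move=> x0; rewrite -[leRHS]mulr1; apply: nrm_le => i j.
pose e : 'cV[C]_n := delta_mx j 0.
have e1 : sqn e = 1.
  rewrite sqnE (bigD1 j)//= big1 ?addr0 => [|k kj]; last first.
    by rewrite mxE (negbTE kj) /= expr0n /= addr0.
  by rewrite mxE !eqxx /= expr1n expr0n /= addr0.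
pose w := invmx (S x) *m e.
have w1 : sqn w <= 1.
  have := S_ge w x0; rewrite mulKVmx ?S_unit//.
  have [/ler_normlP[_ h] _] := ip_le w e; rewrite e1 in h.
  by move=> h2; lra.
have wi : w i 0 = invmx (S x) i j by rewrite /w -colE mxE.
have := le_trans (sqn_entry w i) w1; rewrite wi.
move: (invmx _ i j) => [a b] /= h.
have ha := sqr_ge0 a; have hb := sqr_ge0 b.
by split; rewrite -(@ler_pXn2r _ 2)// ?nnegrE// expr1n real_normK ?num_real//; lra.
Qed.

Lemma Sinv_diff x y : 0 <= x -> 0 <= y ->
  invmx (S y) - invmx (S x) = - (invmx (S y) *m (S y - S x) *m invmx (S x)).
Proof.
move=> x0 y0; have ux := S_unit x0; have uy := S_unit y0.
by rewrite mulmxBr mulVmx// mulmxBl mul1mx mulmxK// opprB.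
Qed.

Lemma HD_Sinv x : 0 <= x ->
  HD (fun y => invmx (S y)) x (- (invmx (S x) *m (L2 x *m (L2 x) ^t*) *m invmx (S x))).
Proof.
move=> x0.
have Scont := HD_cont (SD x0).
have c : mcvg (hl_filter x) (fun y => invmx (S y)) (invmx (S x)).
  apply/mcvg_hlP => e e0.
  pose B := (2 * n * n).+1%:R * (nrm (invmx (S x)) + 1).
  have B0 : 0 < B by rewrite mulr_gt0// ltr_wpDl ?nrm_ge0.
  have eB : 0 < e / B by rewrite divr_gt0.
  move/mcvg_hlP : Scont => /(_ _ eB)[d d0 H]; exists d => // y y0 yx yd.
  rewrite Sinv_diff// nrmN; apply: (le_trans (nrmM _ _)).
  apply: (@le_trans _ _ ((2 * n * n)%:R * (e / B) * nrm (invmx (S x)))).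
    apply: ler_wpM2r; first exact: nrm_ge0.
    apply: (le_trans (nrmM _ _)); apply: ler_pM; rewrite ?nrm_ge0 ?Sinv_bound//.
    exact: H.
  rewrite mulrAC mulrA ler_pdivrMr// mulrC; apply: ler_wpM2l; first exact: ltW.
  rewrite /B; apply: ler_pM; rewrite ?nrm_ge0//; first by rewrite ler_nat leqnSn.
  by rewrite lerDl ler01.
apply: mcvg_near (mcvgN (mcvgM (mcvgM c (SD x0)) (mcvg_cst (invmx (S x))))).
apply/hl_filterP; exists 1 => // y y0 _ _.
by rewrite Sinv_diff// -scalemxAr -scalemxAl scalerN.
Qed.

(** Both sides vanish at 0 and, [alpha] being Hermitian, have the same derivative. *)
Lemma S_commutator x : 0 <= x ->
  alpha *m S x - S x *m alpha = L1 x *m (L2 x) ^t* - L2 x *m (L1 x) ^t*.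
Proof.
move=> x0; apply/eqP; rewrite -subr_eq0; apply/eqP.
rewrite (@HD_const _ _ _ (fun x => alpha *m S x - S x *m alpha -
  (L1 x *m (L2 x) ^t* - L2 x *m (L1 x) ^t*)) x x0).
  by rewrite S0 L20 mulmx1 mul1mx trmx0 map_mx0 mulmx0 mul0mx !subrr.
move=> y y0.
apply: HD_eq (HDB (HDB (HDMl alpha (SD y0)) (HDMr alpha (SD y0)))
  (HDB (HDM (L1D y0) (HD_trC (L2D y0))) (HDM (L2D y0) (HD_trC (L1D y0))))) _.
rewrite trC_N trC_mul alphaH mulmxN mulNmx !mulmxA.
move: (alpha *m L2 y *m _) (L2 y *m _ *m alpha) (L1 y *m _) => a b d.
by apply/matrixP => i j; rewrite !mxE; ring.
Qed.

Variables (z : C).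
Hypothesis z0 : 0 < Im z.
Let k : C := sqrtc z.
(** [p0] is the free solution [exp (i k x) c], with second derivative [- z p0]; it decays when
    [Im k > 0]. *)
Variables (c : 'cV[C]_m) (p0 : R -> 'cV[C]_m).
Hypothesis p00 : p0 0 = c.
Hypothesis p0D : forall x, 0 <= x -> HD p0 x (('i%C * k) *: p0 x).

Let Rz := invmx (alpha - z%:M).
Lemma resolvent_unit : alpha - z%:M \in unitmx.
Proof.
apply: inj_unitmx => w; rewrite mulmxBl mul_scalar_mx => /eqP; rewrite subr_eq0 => /eqP aw.
have := ip_herm w alphaH; rewrite aw ipZr ip_self cImM /= mulr0 add0r => /eqP.
by rewrite mulf_eq0 gt_eqF//= => /eqP /sqn_eq0.
Qed.

(* Double commutation: [g] is the primitive of [L2 *m p0] given by the Wronskian of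
   [L2] and [p0], and the transformed solution is [p0 - L2^* S^-1 g]. *)
Let g x := Rz *m (('i%C * k) *: (L2 x *m p0 x) + L1 x *m p0 x).
Let h x := invmx (S x) *m g x.
Let psi x := p0 x - (L2 x) ^t* *m h x.
Let X x := (L2 x) ^t* *m invmx (S x) *m L2 x.
Let psi1 x := ('i%C * k) *: p0 x + (L1 x) ^t* *m h x - X x *m psi x.
Let ik := 'i%C * k.
Lemma ik_sqr : ik * ik = - z.
Proof.
by rewrite /ik mulrACA -!expr2 sqr_i sqr_sqrtc mulN1r.
Qed.

Lemma HD_g x : 0 <= x -> HD g x (L2 x *m p0 x).
Proof.
move=> x0.
apply: HD_eq (HDMl Rz (HDD (HDZ ik (HDM (L2D x0) (p0D x0))) (HDM (L1D x0) (p0D x0)))) _.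
rewrite -/ik -!scalemxAr scalerDr scalerA ik_sqr mulNmx scalerN.
rewrite -[alpha *m _ *m _]mulmxA.
rewrite [X in Rz *m X](_ : _ = (alpha - z%:M) *m (L2 x *m p0 x)); last first.
  rewrite mulmxBl mul_scalar_mx scaleNr [alpha *m _ + _]addrC addrACA addNr add0r.
  by rewrite addrC.
by rewrite mulKmx// resolvent_unit.
Qed.

Lemma HD_h x : 0 <= x -> HD h x (invmx (S x) *m L2 x *m psi x).
Proof.
move=> x0; apply: HD_eq (HDM (HD_Sinv x0) (HD_g x0)) _.
by rewrite /psi mulmxBr mulNmx !mulmxA addrC.
Qed.

Lemma HD_psi x : 0 <= x -> HD psi x (psi1 x).
Proof.
move=> x0; apply: HD_eq (HDB (p0D x0) (HDM (HD_trC (L2D x0)) (HD_h x0))) _.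
by rewrite trC_N mulNmx /psi1 /X opprD opprK addrA !mulmxA.
Qed.

Lemma HD_X x : 0 <= x ->
  HD X x (- ((L1 x) ^t* *m invmx (S x) *m L2 x + X x *m X x + (L2 x) ^t* *m invmx (S x) *m L1 x)).
Proof.
move=> x0; apply: HD_eq (HDM (HDM (HD_trC (L2D x0)) (HD_Sinv x0)) (L2D x0)) _.
rewrite trC_N /X !(mulNmx, mulmxN) mulmxDl !(mulNmx, mulmxN) !mulmxA.
by rewrite !opprD.
Qed.

Lemma alpha_h x : 0 <= x ->
  alpha *m h x = z *: h x + invmx (S x) *m (L2 x *m (ik *: p0 x + (L1 x) ^t* *m h x) + L1 x *m psi x).
Proof.
move=> x0; have u := S_unit x0.
have Sh : S x *m h x = g x by rewrite /h mulKVmx.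
have ag : alpha *m g x = z *: g x + (ik *: (L2 x *m p0 x) + L1 x *m p0 x).
  have : (alpha - z%:M) *m g x = ik *: (L2 x *m p0 x) + L1 x *m p0 x.
    by rewrite /g mulKVmx// resolvent_unit.
  by rewrite mulmxBl mul_scalar_mx => /eqP; rewrite subr_eq addrC => /eqP.
have E := alpha_h_algebra Sh ag (S_commutator x0) (erefl (psi x)).
rewrite -[LHS](mulKmx u) E mulmxDr -scalemxAr.
by rewrite -/(h x).
Qed.

Let f x := 2%:R *: (X x *m X x + (L1 x) ^t* *m invmx (S x) *m L2 x + (L2 x) ^t* *m invmx (S x) *m L1 x).

Lemma HD_psi1 x : 0 <= x -> HD psi1 x ((f x - z%:M) *m psi x).
Proof.
move=> x0.
apply: HD_eq (HDB (HDD (HDZ ik (p0D x0)) (HDM (HD_trC (L1D x0)) (HD_h x0)))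
   (HDM (HD_X x0) (HD_psi x0))) _.
rewrite -/ik scalerA ik_sqr trC_mul alphaH.
apply: transform_algebra; [by [] | | exact: alpha_h].
by rewrite /psi opprB addrC subrK.
Qed.

(* Hence the integral of [sqn psi] is at most that of [sqn p0], up to a constant. *)
Lemma energy x : 0 <= x ->
  hdR (fun x => Re (ip (g x) (h x))) x (sqn (p0 x) - sqn (psi x)).
Proof.
move=> x0; have [E _] := HD_ip (HD_g x0) (HD_h x0); apply: (hdR_eq E).
have Lh : (L2 x) ^t* *m h x = p0 x - psi x by rewrite /psi opprB addrC subrK.
rewrite ipMl Lh.
have -> : ip (g x) (invmx (S x) *m L2 x *m psi x) = ip (p0 x - psi x) (psi x).
  rewrite -mulmxA -[X in ip (g x) (X *m _)](Sinv_herm x0) -ipMl -/(h x).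
  by rewrite -[L2 x]trC_K -ipMl Lh.
rewrite ipDl ipDr !ipNl !ipNr !cReD !cReN /sqn; ring.
Qed.

Lemma f_herm x : 0 <= x -> (f x) ^t* = f x.
Proof.
move=> x0; have Sh := Sinv_herm x0.
have XH : (X x) ^t* = X x by rewrite /X !trC_mul trC_K Sh mulmxA.
rewrite /f; set A := (L1 x) ^t* *m _ *m _; set B := (L2 x) ^t* *m _ *m L1 x.
have AB : A ^t* = B by rewrite /A !trC_mul trC_K Sh mulmxA.
have BA : B ^t* = A by rewrite -AB trC_K.
have trC2 (M : 'M[C]_m) : (2%:R *: M) ^t* = 2%:R *: M ^t*.
  by rewrite linearZ /= map_mxZ; congr (_ *: _); exact: conjC_nat.
by rewrite trC2 !trC_D trC_mul XH AB BA addrAC.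
Qed.

Lemma transformed_sol : 0 < Im k ->
  let y x := col_mx (psi x) (psi1 x) in
  [/\ sol f z y, exists B, forall x, 0 <= x -> B <= wr (y x) &
      y 0 = col_mx c (ik *: c + th ^t* *m (invmx (alpha - z%:M) *m (th *m c)))].
Proof.
move=> k0 y.
have ys : sol f z y.
  move=> x x0; apply: HD_eq (HD_col (HD_psi x0) (HD_psi1 x0)) _.
  by rewrite /coefG mul_block_col !mul0mx mul1mx add0r addr0.
split=> //.
(* The derivative of [sqn p0] is [- 2 * Im k * sqn p0], so this [b] makes [F] constant: [energy]
   cancels the terms in [psi], the last summand those in [p0]. Both subtracted quantities are
   nonnegative, so [F 0] bounds [wr] from below. *)
- pose b := Im z / (2 * Im k).
  pose F x := wr (y x) - Im z * Re (ip (g x) (h x)) - b * sqn (p0 x).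
  exists (F 0) => x x0.
  have hF t : 0 <= t -> hdR F t 0.
    move=> t0; have W := hdR_wr f_herm ys t0.
    rewrite col_mxKu in W.
    apply: hdR_eq (hdRB (hdRB W (hdRZ (energy t0))) (hdRZ (HD_sqn (p0D t0)))) _.
    rewrite ipZr ip_self !cReM cImM /= !(mul0r, mul1r, mulr0, subr0, add0r, addr0, sub0r).
    rewrite /b; move: (sqn (psi t)) (sqn (p0 t)) (Im k) k0 => s1 s2 kk kk0.
    by field; rewrite gt_eqF.
  rewrite -(hdR_const x0 hF) /F.
  have e0 : 0 <= Re (ip (g x) (h x)).
    have -> : g x = S x *m h x by rewrite /h mulKVmx// S_unit.
    rewrite ipC cReC; apply: le_trans (S_ge (h x) x0); exact: sqn_ge0.
  have e1 : 0 <= Im z * Re (ip (g x) (h x)) by rewrite mulr_ge0// ltW.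
  have e2 : 0 <= b * sqn (p0 x).
    by rewrite mulr_ge0 ?sqn_ge0// divr_ge0 ?mulr_ge0// ltW.
  by rewrite -addrA gerDl -opprD oppr_le0 addr_ge0.
- rewrite /y /psi1 /X /psi /h /g L10 L20 S0 p00 trmx0 map_mx0 !mul0mx scaler0 add0r !subr0.
  by rewrite invmx1 mul1mx.
Qed.

End Transformed.

Section TripleWeyl.
Context {R : realType}.
Local Notation C := R[i].

Lemma triple_weyl m n (alpha : 'M[C]_n) (th : 'M[C]_(n, m)) z (c : 'cV[C]_m) :
  alpha ^t* = alpha -> 0 < Im z ->
  exists y B, [/\ sol (triple_fun alpha th 0) z y, forall x, 0 <= x -> B <= wr (y x) &
    y 0 = col_mx c (('i%C * sqrtc z) *: c + th ^t* *m (invmx (alpha - z%:M) *m (th *m c)))].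
Proof.
move=> alphaH z0.
pose L := triple_Lambda alpha th 0.
pose L1 x := usubmx (L x); pose L2 x := dsubmx (L x).
have [E0 ED] := mexp_ode (triple_beta alpha).
have LD x : 0 <= x -> HD L x (triple_beta alpha *m L x).
  by move=> x0; apply: HD_eq (HDMr (col_mx th 0) (ED x x0)) _; rewrite mulmxA.
have Lb x : triple_beta alpha *m L x = col_mx (alpha *m L2 x) (- L1 x).
  rewrite -[L x in LHS]vsubmxK /triple_beta mul_block_col !mul0mx add0r addr0.
  by rewrite mulNmx mul1mx.
have L1D x : 0 <= x -> HD L1 x (alpha *m L2 x).
  by move=> x0; have := HD_usub (LD x x0); rewrite Lb col_mxKu.
have L2D x : 0 <= x -> HD L2 x (- L1 x).
  by move=> x0; have := HD_dsub (LD x x0); rewrite Lb col_mxKd.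
have L0 : L 0 = col_mx th 0 by rewrite /L /triple_Lambda E0 mul1mx.
have L10 : L1 0 = th by rewrite /L1 L0 col_mxKu.
have L20 : L2 0 = 0 by rewrite /L2 L0 col_mxKd.
pose S := triple_S alpha th 0.
have LLc : mcont (fun x => L2 x *m (L2 x) ^t*).
  by apply: (HD_mcont (fun x x0 => HDM (L2D x x0) (HD_trC (L2D x x0)))).
have SD x : 0 <= x -> HD S x (L2 x *m (L2 x) ^t*).
  by move=> x0; apply: HD_eq (HDD (HD_cst 1%:M x) (HD_mintegral LLc x0)) _; rewrite add0r.
have S0 : S 0 = 1%:M by rewrite /S /triple_S mintegral0 addr0.
pose ik := 'i%C * sqrtc z.
have ikc : mcont (fun=> ik%:M : 'M[C]_m) by move=> x _; exact: mcvg_cst.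
have [p0 p00 p0D'] := linear_ode c ikc.
have p0D x : 0 <= x -> HD p0 x (ik *: p0 x).
  by move=> x0; rewrite -mul_scalar_mx; exact: p0D'.
have [ys [B hB] y0] := transformed_sol alphaH L1D L2D SD L10 L20 S0 z0 p00 p0D (Im_sqrtc_gt0 z0).
eexists; exists B; split; [|exact: hB|exact: y0].
move=> x x0; have := ys x x0.
set f1 := 2%:R *: _.
suff -> : triple_fun alpha th 0 x = f1 by [].
by rewrite /triple_fun expr2 -mulmxE.
Qed.

End TripleWeyl.

(** * Signs in the sector where [z] is close to the negative half-axis *)

Section AsymptoticSign.
Context {R : realType}.
Local Notation C := R[i].

(* Twice the primitive cube root of unity [e^(2 i pi / 3)]. *)
Definition om : C := (-1) +i* Num.sqrt (3%:R : R).

Lemma sqrt3 : Num.sqrt (3%:R : R) ^+ 2 = 3 /\ 1 <= Num.sqrt (3%:R : R) <= 2.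
Proof.
have s0 : 0 <= Num.sqrt (3%:R : R) by exact: sqrtr_ge0.
have s2 : Num.sqrt (3%:R : R) ^+ 2 = 3 by rewrite sqr_sqrtr.
split => //; apply/andP; split.
- by rewrite -(@ler_pXn2r _ 2)// ?nnegrE// s2 expr1n; lra.
- by rewrite -(@ler_pXn2r _ 2)// ?nnegrE// s2; lra.
Qed.

Lemma sqrtc_parts (z : C) : 0 < Im z -> [/\ 0 < Re (sqrtc z), 0 < Im (sqrtc z) &
  Re (sqrtc z) ^+ 2 - Im (sqrtc z) ^+ 2 = Re z /\ 2 * Re (sqrtc z) * Im (sqrtc z) = Im z].
Proof.
move=> z0; have q0 := Im_sqrtc_gt0 z0.
have e : sqrtc z * sqrtc z = z by rewrite -expr2 sqr_sqrtc.
have e1 := congr1 (@complex.Re R) e; have e2 := congr1 (@complex.Im R) e.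
rewrite cReM in e1; rewrite cImM in e2.
move: (Re (sqrtc z)) (Im (sqrtc z)) q0 e1 e2 => p q q0 e1 e2.
have p0 : 0 < p by rewrite -(pmulr_lgt0 _ q0); move: z0; rewrite -e2; lra.
split => //; split; [rewrite -e1; ring | rewrite -e2; ring].
Qed.

(* With [w = om / 2], [coefF 0 p 0 (w z)] is conjugate to [coefF 0 p 0 z] by
   [diag (1, w^-1)]; the form below is [wr] for the rotated spectral parameter. *)
Lemma rotated_monotone m (p : R -> 'M[C]_m) (z : C) (Y : R -> 'cV[C]_(m + m)) t :
  Re z < 0 -> 0 < Im z -> Im z <= - Re z ->
  (forall t, 0 <= t -> (p t) ^t* = p t) ->
  (forall t, 0 <= t -> HD Y t (coefF 0 (p t) 0 z *m Y t)) -> 0 <= t ->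
  Im (om * ip (usubmx (Y 0)) (dsubmx (Y 0))) <= Im (om * ip (usubmx (Y t)) (dsubmx (Y t))).
Proof.
move=> a0 b0 ab hp YD t0.
pose w t := ip (usubmx (Y t)) (dsubmx (Y t)).
pose dw t : C := 4%:R * z ^+ 2 * (sqn (usubmx (Y t)))%:C - 4%:R * z^* * (sqn (dsubmx (Y t)))%:C.
have H s : 0 <= s -> hdR (fun t => Im (om * w t)) s (Im (om * dw s)).
  move=> s0; have [h1 h2] := HD_ip (HD_usub (YD s s0)) (HD_dsub (YD s s0)).
  have E : dw s = ip (usubmx (coefF 0 (p s) 0 z *m Y s)) (dsubmx (Y s)) +
      ip (usubmx (Y s)) (dsubmx (coefF 0 (p s) 0 z *m Y s)).
    rewrite usub_coefF dsub_coefF !mul0mx scaler0 !add0r.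
    rewrite !(ipDl, ipDr, ipNl, ipNr, ipZl, ipZr) (ipMl (p s)) hp// !ip_self /dw.
    rewrite !rmorphM /= conjC_nat.
    by move: (z^*) (sqn _)%:C (sqn _)%:C (ip _ _) => zb s1 s2 i1; ring.
  have := hdRD (hdRZ (c := complex.Re om) h2) (hdRZ (c := complex.Im om) h1).
  rewrite -!cImD -!cReD -E -cImM.
  by under eq_fun do rewrite -cImM.
apply: (@hdR_ge _ (fun t => Im (om * w t)) (fun t => Im (om * dw t)) 0 t (lexx _) t0).
  by move=> s /andP[s0 _]; exact: H.
move=> s _; change (0 <= Im (om * dw s)); rewrite /dw.
have := sqn_ge0 (usubmx (Y s)); have := sqn_ge0 (dsubmx (Y s)).
move: (sqn _) (sqn _) => s2 s1 s20 s10.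
have [_ /andP[w1 _]] := sqrt3.
rewrite /om; move: (Num.sqrt _) w1 => w3 w1.
case: z a0 b0 ab {H dw YD} => a b /= a0 b0 ab.
clear -a0 b0 ab w1 s10 s20.
(* The quantities in [P1] and [P2] are the imaginary parts of [om * z ^+ 2] and of [- om * z^*]; the
   sector [b <= - a] makes both nonnegative. *)
have P1 : 0 <= - 2 * a * b + w3 * (a * a - b * b).
  have : 0 <= w3 * ((- a - b) * (- a + b)) by rewrite mulr_ge0 ?mulr_ge0; lra.
  have : 0 <= (- a) * b by rewrite mulr_ge0; lra.
  lra.
have P2 : 0 <= - b - w3 * a.
  have : 0 <= (w3 - 1) * (- a) by rewrite mulr_ge0; lra.
  lra.
have := mulr_ge0 s10 P1; have := mulr_ge0 s20 P2; lra.
Qed.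

(** The components of [Y] are a common multiple of [(1 - M) c] and [(1 + M) c]. At the limit value
    the form is the scalar [nu], a positive multiple of [i sqrt z], and [om] rotates it strictly
    into the lower half-plane; a strict sign survives for [M] close to the limit, uniformly in
    [c]. *)
Lemma eventually_neg m (M : R -> 'M[C]_m) (z : C) : 0 < Im z ->
  M t @[t --> +oo] --> (('i%C * sqrtc z - 1) / ('i%C * sqrtc z + 1))%:M ->
  exists2 t, 0 <= t & forall (c : 'cV[C]_m) Y,
    Y = T2 m *m col_mx (- 'i%C *: (M t *m c)) c ->
    Im (om * ip (usubmx Y) (dsubmx Y)) <= 0.
Proof.
move=> z0 Mlim.
have [p0 q0 _] := sqrtc_parts z0.
set k := 'i%C * sqrtc z in Mlim *; set mu := _ / _ in Mlim.
have k1 : k + 1 != 0.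
  apply/eqP => /(congr1 (@complex.Im R)); rewrite cImD /k cImM /= mul0r mul1r add0r addr0 => h.
  by rewrite h ltxx in p0.
pose nu := (1 - mu)^* * (1 + mu).
have nuE : nu * (`|k + 1| ^+ 2) = 4%:R * k.
  rewrite normCK /nu.
  have e1 : (1 - mu) * (k + 1) = 2%:R by rewrite /mu; field.
  have e2 : (1 + mu) * (k + 1) = 2%:R * k by rewrite /mu; field.
  rewrite [(k + 1) * _]mulrC mulrACA -rmorphM /= e1 conjC_nat e2; ring.
have kn : 0 < `|k + 1| ^+ 2 by rewrite exprn_gt0// normr_gt0.
have [r rE] : exists r : R, `|k + 1| ^+ 2 = r%:C.
  by exists (Re (`|k + 1| ^+ 2)); rewrite RRe_real// gtr0_real.
have r0 : 0 < r by move: kn; rewrite rE ltcR.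
have [w2 /andP[w1 _]] := sqrt3.
have onu : Im (om * nu) < 0.
  rewrite -(pmulr_llt0 _ r0).
  have -> : Im (om * nu) * r = Im (om * (nu * r%:C)).
    by rewrite [in RHS]mulrA; move: (om * nu) => w; rewrite cImM /= mulr0 add0r.
  rewrite -rE nuE /k !(cReM, cImM) /=.
  move: (Re (sqrtc z)) (Im (sqrtc z)) (Num.sqrt (3%:R : R)) p0 q0 w1 => p q w p0 q0 w1.
  have := mulr_gt0 (lt_le_trans ltr01 w1) q0; nra.
pose sg := - Im (om * nu); have sg0 : 0 < sg by rewrite oppr_gt0.
(* The factor [- i] turns the imaginary part into a real part, to which [ip_mx_le] applies. *)
pose N t := ((- 'i%C * om) *: ((1%:M - M t) ^t* *m (1%:M + M t))) : 'M[C]_m.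
pose Nl := ((- 'i%C * om) *: (nu%:M)) : 'M[C]_m.
have Nlim : mcvg +oo N Nl.
  have Ml : mcvg +oo M mu%:M by exact: mcvg_cvg.
  apply: mcvgZ; first exact: ccvg_cst.
  have -> : nu%:M = (1%:M - mu%:M) ^t* *m (1%:M + mu%:M) :> 'M[C]_m.
    by rewrite -raddfB -raddfD /= trC_scalar -scalar_mxM.
  apply: mcvgM; first by apply: mcvg_trC; apply: mcvgB => //; exact: mcvg_cst.
  by apply: mcvgD => //; exact: mcvg_cst.
(* The perturbation contributes at most [2 * m * d * sqn c], which stays within the margin
   [sg * sqn c]. *)
pose d := sg / (2 * m%:R + 1).
have m1 : 0 < 2 * m%:R + 1 :> R by rewrite ltr_wpDl ?mulr_ge0.
have d0 : 0 < d by rewrite divr_gt0.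
have Nnear : \forall t \near +oo, nrm (N t - Nl) <= d.
  have /mcvg_nrm/cvgrPdist_le/(_ _ d0) : mcvg +oo N Nl := Nlim.
  by apply: filterS => t; rewrite sub0r normrN ger0_norm ?nrm_ge0.
have : \forall t \near +oo, 0 <= t /\ nrm (N t - Nl) <= d.
  by near=> t; split; near: t; [exact: nbhs_pinfty_ge|exact: Nnear].
move=> /filter_ex[t [t0 td]]; exists t => // c Y ->.
rewrite usub_T2 dsub_T2.
set Mc := M t *m c.
have -> : rs2%:C *: (- 'i%C *: Mc) + (0 +i* rs2) *: c = (0 +i* rs2) *: ((1%:M - M t) *m c).
  rewrite mulmxBl mul1mx -/Mc scalerBr addrC scalerA -[in RHS]scaleNr; congr (_ + _ *: _).
  by apply: Complex_eq; rewrite ?cReM ?cImM /=; ring.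
have -> : - rs2%:C *: (- 'i%C *: Mc) + (0 +i* rs2) *: c = (0 +i* rs2) *: ((1%:M + M t) *m c).
  rewrite mulmxDl mul1mx -/Mc scalerDr addrC scalerA; congr (_ + _ *: _).
  by apply: Complex_eq; rewrite ?cReM ?cImM /=; ring.
have gen (w : C) : Re (- 'i%C * w) = Im w by case: w => a b /=; ring.
rewrite ipZl ipZr ipMl [X in om * X]mulrA mulrCA.
have -> : (0 +i* rs2)^* * (0 +i* rs2) = (2^-1 : R)%:C.
  by rewrite -rs2_sqr; apply: Complex_eq; rewrite ?cReM ?cImM ?cReC ?cImC /=; ring.
rewrite cImM /= mul0r addr0 pmulr_rle0; last by rewrite invr_gt0.
have -> : Im (om * ip c ((1%:M - M t) ^t* *m ((1%:M + M t) *m c))) = Re (ip c (N t *m c)).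
  by rewrite /N -scalemxAl ipZr mulmxA -mulrA gen.
rewrite -[N t](subrK Nl) mulmxDl ipDr cReD.
have -> : Re (ip c (Nl *m c)) = - sg * sqn c.
  rewrite /Nl scale_scalar_mx mul_scalar_mx ipZr ip_self cReM /= mulr0 subr0; congr (_ * _).
  by rewrite -mulrA gen /sg opprK.
have bd i j : `|Re ((N t - Nl) i j)| <= d /\ `|Im ((N t - Nl) i j)| <= d.
  by split; apply: le_trans td; [exact: nrm_Re|exact: nrm_Im].
have /ler_normlP[_ h] := ip_mx_le c c bd.
apply: (le_trans (lerD h (lexx _))).
rewrite mulNr subr_le0 (_ : _ * _ * (_ + _) = (d * (2 * m%:R)) * sqn c); last by ring.
apply: ler_wpM2r; first exact: sqn_ge0.
rewrite /d mulrAC ler_pdivrMr//; apply: ler_wpM2l; first exact: ltW.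
by rewrite lerDl ler01.
Unshelve. all: by end_near. Qed.

End AsymptoticSign.

(** * The eigenvalues of [alpha] and the pole of the initial slope *)

Section Spectral.
Context {R : realType}.
Local Notation C := R[i].

Lemma spectral_data n (alpha : 'M[C]_n) : alpha ^t* = alpha ->
  exists (P : 'M[C]_n) (d : 'I_n -> R), P ^t* *m P = 1%:M /\
    forall (w : 'cV[C]_n) j, (P *m (alpha *m w)) j 0 = (d j)%:C * (P *m w) j 0.
Proof.
move=> alphaH.
have hs : alpha \is hermsymmx.
  by apply/is_hermitianmxP; rewrite expr0 scale1r.
have /orthomx_spectralP E := hermitian_normalmx hs.
have dreal := hermitian_spectral_diag_real hs.
have /unitarymxP PP := spectral_unitarymx alpha.
exists (spectralmx alpha), (fun j => Re (spectral_diag alpha 0 j)); split.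
  exact: mulmx1C.
move=> w j; rewrite {2}E !mulmxA mulmxV ?spectral_unit// mul1mx -mulmxA mul_diag_mx mxE.
by rewrite RRe_real//; move/mxOverP : dreal; apply.
Qed.

Lemma ip_unitary n (P : 'M[C]_n) (v w : 'cV[C]_n) : P ^t* *m P = 1%:M ->
  ip (P *m v) (P *m w) = ip v w.
Proof. by move=> PP; rewrite ipMl mulmxA PP mul1mx. Qed.

Lemma unitary_eq0 n (P : 'M[C]_n) (v : 'cV[C]_n) : P ^t* *m P = 1%:M -> P *m v = 0 -> v = 0.
Proof. by move=> PP Pv; rewrite -[v]mul1mx -PP -mulmxA Pv mulmx0. Qed.

(** In the eigenbasis [th^* alpha th = 0] says that the eigenvalues, weighted by the squared
    components of [th c], sum to 0. If none of those with nonzero weight were negative, every term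
    would vanish, so [alpha th c = 0] and then [th c = 0], contrary to the choice of [c]. *)
Lemma negative_component m n (alpha P : 'M[C]_n) (d : 'I_n -> R) (th : 'M[C]_(n, m)) :
  P ^t* *m P = 1%:M ->
  (forall (w : 'cV[C]_n) j, (P *m (alpha *m w)) j 0 = (d j)%:C * (P *m w) j 0) ->
  th ^t* *m alpha *m th = 0 -> \det alpha != 0 ->
  ~ neg_semidef (th ^t* *m invmx alpha *m th) ->
  exists (c : 'cV[C]_m) j, (P *m (th *m c)) j 0 != 0 /\ d j < 0.
Proof.
move=> PP Pa tht deta nneg.
have [c hc] : exists c : 'cV[C]_m, ~~ ((c ^t* *m (th ^t* *m invmx alpha *m th) *m c) 0 0 <= 0).
  by apply: contrapT => H; apply: nneg => v; apply: contrapT => /negP nv; apply: H; exists v.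
exists c; apply: contrapT => H.
have dn j : (P *m (th *m c)) j 0 != 0 -> 0 <= d j.
  by move=> bj; rewrite leNgt; apply/negP => dj; apply: H; exists j.
have b0 : P *m (th *m c) != 0.
  apply/eqP => b0; move: hc; rewrite -!mulmxA.
  by rewrite (unitary_eq0 PP b0) !mulmx0 mxE lexx.
have sum0 : \sum_j d j * (Re ((P *m (th *m c)) j 0) ^+ 2 + Im ((P *m (th *m c)) j 0) ^+ 2) = 0.
  have : ip (P *m (th *m c)) (P *m (alpha *m (th *m c))) = 0.
    by rewrite ip_unitary// ipMl !mulmxA tht mul0mx /ip mulmx0 mxE.
  rewrite ipE => /(congr1 (@complex.Re R)); rewrite Re_sum => h; rewrite -[RHS]/(Re (0 : C)) -h.
  apply: eq_bigr => j _; rewrite Pa.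
  by case: ((P *m (th *m c)) j 0) => x y /=; ring.
have terms j : (d j)%:C * (P *m (th *m c)) j 0 = 0.
  have [->|bj] := eqVneq ((P *m (th *m c)) j 0) 0; first by rewrite mulr0.
  move: sum0 => /eqP; rewrite psumr_eq0 => [/allP /(_ j (mem_index_enum _))|i _]; last first.
    have [->|bi] := eqVneq ((P *m (th *m c)) i 0) 0; first by rewrite /= expr0n addr0 mulr0.
    by rewrite mulr_ge0 ?dn// addr_ge0 ?sqr_ge0.
  rewrite implyTb mulf_eq0 => /orP[/eqP->|]; first by rewrite mul0r.
  rewrite paddr_eq0 ?sqr_ge0// !sqrf_eq0 => /andP[/eqP h1 /eqP h2].
  by move: bj; rewrite (_ : (P *m (th *m c)) j 0 = 0) ?eqxx//; apply: Complex_eq; rewrite ?h1 ?h2.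
move/eqP : b0; apply.
suff -> : th *m c = 0 by rewrite mulmx0.
have au : alpha \in unitmx by rewrite unitmxE unitfE.
rewrite -[th *m c](mulKmx au) (_ : alpha *m (th *m c) = 0) ?mulmx0//.
apply: (unitary_eq0 PP); apply/colP => j; rewrite Pa terms mxE.
by [].
Qed.

(** In the eigenbasis each factor on the right is the imaginary part of [om / (d j - z)]. *)
Lemma resolvent_sum n (alpha P : 'M[C]_n) (d : 'I_n -> R) (v : 'cV[C]_n) (z : C) :
  alpha ^t* = alpha -> P ^t* *m P = 1%:M ->
  (forall (w : 'cV[C]_n) j, (P *m (alpha *m w)) j 0 = (d j)%:C * (P *m w) j 0) ->
  0 < Im z ->
  Im (om * ip v (invmx (alpha - z%:M) *m v)) =
  \sum_j (Re ((P *m v) j 0) ^+ 2 + Im ((P *m v) j 0) ^+ 2) *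
    ((Num.sqrt (3%:R : R) * (d j - Re z) - Im z) / ((d j - Re z) ^+ 2 + Im z ^+ 2)).
Proof.
move=> alphaH PP Pa z0.
have u := resolvent_unit alphaH z0.
set w := invmx _ *m v.
have wE : (alpha - z%:M) *m w = v by rewrite /w mulKVmx.
rewrite -(ip_unitary v w PP) ipE mulr_sumr Im_sum; apply: eq_bigr => j _.
have E : ((d j)%:C - z) * (P *m w) j 0 = (P *m v) j 0.
  transitivity ((P *m ((alpha - z%:M) *m w)) j 0); last by rewrite wE.
  rewrite mulmxBl mulmxBr mul_scalar_mx -scalemxAr mxBE Pa mulrBl.
  by congr (_ - _); rewrite [in RHS]mxE.
have D0 : 0 < (d j - Re z) ^+ 2 + Im z ^+ 2 by rewrite ltr_wpDl ?sqr_ge0// exprn_gt0.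
rewrite -E; case: ((P *m w) j 0) => x y.
case: z z0 {u w wE E} D0 => a b /= b0 D0.
rewrite /om; move: (Num.sqrt _) => s; move: (d j) D0 => dj D0.
field.
by rewrite gt_eqF.
Qed.

(** A crude bound, needed to keep the free part of the slope bounded while [z] approaches the
    pole. *)
Lemma sqrtc_bound (z : C) : 0 < Im z ->
  Re (sqrtc z) + Num.sqrt (3%:R : R) * Im (sqrtc z) <= 2 * (- Re z + `|2 * Re z| + Im z) + 3.
Proof.
move=> z0; have [p0 q0 [e1 e2]] := sqrtc_parts z0.
have [_ /andP[_ w2]] := @sqrt3 R.
move: (Num.sqrt _) w2 => w w2.
move: (sqrtc z) p0 q0 e1 e2 => s; move: (Re s) (Im s) => p q p0 q0 e1 e2.
have h0 : 0 <= (p - 1) ^+ 2 by exact: sqr_ge0.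
have h1 : 0 <= (q - 1) ^+ 2 by exact: sqr_ge0.
have h2 : w * q <= 2 * q by apply: ler_wpM2r => //; exact: ltW.
have h3 : p ^+ 2 + q ^+ 2 <= - Re z + `|2 * Re z| + Im z.
  have a1 := ler_norm (2 * Re z); have a2 := normr_ge0 (2 * Re z).
  rewrite -mulrA in e2.
  have [qp|pq] := leP q p.
    have : q ^+ 2 <= p * q by rewrite expr2 ler_wpM2r// ltW.
    by move: (p ^+ 2) (q ^+ 2) (p * q) `|2 * Re z| e1 e2 a1 a2 => *; lra.
  have : p ^+ 2 <= p * q by rewrite expr2 ler_wpM2l// ltW.
  by move: (p ^+ 2) (q ^+ 2) (p * q) `|2 * Re z| e1 e2 a1 a2 => *; lra.
have := sqr_ge0 p; have := sqr_ge0 q; rewrite !expr2 in h0 h1 h3 *; lra.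
Qed.

(* [th^* (alpha - z)^-1 th] has a pole at a negative eigenvalue of [alpha]; near the
   lowest one seen by [c], all terms of [resolvent_sum] have the same sign. *)
Lemma sector_contradiction m n (alpha : 'M[C]_n) (th : 'M[C]_(n, m)) :
  alpha ^t* = alpha -> th ^t* *m alpha *m th = 0 -> \det alpha != 0 ->
  ~ neg_semidef (th ^t* *m invmx alpha *m th) ->
  exists z (c : 'cV[C]_m), [/\ Re z < 0, 0 < Im z, Im z <= - Re z &
    0 < Im (om * ip c (('i%C * sqrtc z) *: c + th ^t* *m (invmx (alpha - z%:M) *m (th *m c))))].
Proof.
move=> alphaH tht deta nneg.
have [P [d [PP Pa]]] := spectral_data alphaH.
have [c [j [bj dj]]] := negative_component PP Pa tht deta nneg.
pose b i := (P *m (th *m c)) i 0; rewrite -/(b j) in bj.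
case: (@Order.TotalTheory.arg_minP _ R _ j (fun i => b i != 0) d bj) => j0 bj0 jmin.
have d0 : d j0 < 0 by apply: le_lt_trans dj; exact: jmin.
pose B i := Re (b i) ^+ 2 + Im (b i) ^+ 2.
have Bge i : 0 <= B i by rewrite addr_ge0 ?sqr_ge0.
have B0 : 0 < B j0.
  rewrite lt_neqAle Bge andbT eq_sym; apply: contra bj0.
  rewrite paddr_eq0 ?sqr_ge0// !sqrf_eq0 => /andP[/eqP h1 /eqP h2].
  by apply/eqP; apply: Complex_eq; rewrite ?h1 ?h2.
(* The bound of [sqrtc_bound] at the point [z] below, where [- Re z + |2 Re z| + Im z = 3 * (2 * e -
   d j0) + e] with [e <= 1]. *)
pose K0 := 2 * (3 * (2 - d j0) + 1) + 3.
have s0 := sqn_ge0 c.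
have K00 : 0 <= K0 by rewrite /K0; lra.
have K1 : 0 < K0 * sqn c + 1 by rewrite ltr_wpDl// mulr_ge0.
(* Small enough for the pole term, at least [B j0 / (5 * e)], to exceed the free part, at most
   [K0 * sqn c], by 1. *)
pose e := Num.min 1 (B j0 / (5 * (K0 * sqn c + 1))).
have e0 : 0 < e by rewrite lt_min ltr01 divr_gt0// mulr_gt0.
have e1 : e <= 1 by rewrite ge_min lexx.
have eB : K0 * sqn c + 1 <= B j0 / (5 * e).
  rewrite ler_pdivlMr ?mulr_gt0// mulrCA mulrA -ler_pdivlMl ?mulr_gt0//.
  by rewrite mulrC ge_min lexx orbT.
(* To the left of the eigenvalue, so that every [d i - Re z] with nonzero weight is at least
   [2 * e]; the squared distance to [d j0] is [5 * e ^+ 2]. *)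
pose z : C := (d j0 - 2 * e) +i* e.
have z0 : 0 < Im z by [].
exists z, c; split=> //=; [by lra|by lra|].
have [w3 /andP[w1 w2]] := @sqrt3 R.
rewrite ipDr mulrDr cImD ipZr ip_self -ipMl (resolvent_sum _ alphaH PP Pa z0).
have first_term : - (K0 * sqn c) <= Im (om * ('i%C * sqrtc z * (sqn c)%:C)).
  have -> : Im (om * ('i%C * sqrtc z * (sqn c)%:C)) =
     - ((Re (sqrtc z) + Num.sqrt (3%:R : R) * Im (sqrtc z)) * sqn c).
    rewrite /om; case: (sqrtc z) => p q; rewrite !(cReM, cImM) /=; ring.
  rewrite lerN2; apply: ler_wpM2r => //; apply: (le_trans (sqrtc_bound z0)).
  rewrite /K0 /=; have -> : `|2 * (d j0 - 2 * e)| = 2 * (2 * e - d j0).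
    rewrite ler0_norm; first by ring.
    by rewrite pmulr_rle0//; lra.
  lra.
have term_ge i : 0 <= B i * ((Num.sqrt (3%:R : R) * (d i - Re z) - Im z) / ((d i - Re z) ^+ 2 + Im z ^+ 2)).
  have [bi|bi] := eqVneq (b i) 0.
    by rewrite /B bi /= expr0n addr0 mul0r.
  apply: mulr_ge0 => //; apply: divr_ge0; last by rewrite addr_ge0 ?sqr_ge0.
  have dd := jmin i bi; rewrite /=.
  have : 1 * (2 * e) <= Num.sqrt (3%:R : R) * (d i - (d j0 - 2 * e)).
    by apply: ler_pM => //; [rewrite mulr_ge0// ltW | lra].
  by lra.
have main_term : B j0 / (5 * e) <= B j0 * ((Num.sqrt (3%:R : R) * (d j0 - Re z) - Im z) / ((d j0 - Re z) ^+ 2 + Im z ^+ 2)).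
  apply: ler_wpM2l => //; rewrite /=.
  have -> : d j0 - (d j0 - 2 * e) = 2 * e by ring.
  have -> : (2 * e) ^+ 2 + e ^+ 2 = 5 * e * e by ring.
  rewrite ler_pdivlMr ?mulr_gt0// mulrA mulVf ?mul1r ?gt_eqF ?mulr_gt0//.
  have : 1 * e <= Num.sqrt (3%:R : R) * e by apply: ler_wpM2r => //; exact: ltW.
  by lra.
apply: (@lt_le_trans _ _ (- (K0 * sqn c) + (K0 * sqn c + 1))).
  by rewrite addrA addNr add0r ltr01.
apply: lerD first_term _; apply: (le_trans eB); apply: (le_trans main_term).
rewrite (bigD1 j0)//= lerDl.
by apply: sumr_ge0 => i _; exact: term_ge.
Qed.

End Spectral.

(** * The contradiction at the boundary x = 0 *)

Unset Implicit Arguments.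
Set Strict Implicit.
Set Printing Implicit Defensive.

Theorem proposition10 (R : realType) (m n : nat)
    (alpha : 'M[R[i]]_n) (th1 : 'M[R[i]]_(n, m)) :
  (0 < m)%N -> (0 < n)%N ->
  alpha = alpha ^t* ->
  th1 ^t* *m alpha *m th1 = 0 ->
  \det alpha != 0 ->
  \det (1%:M + th1 ^t* *m invmx alpha *m th1) != 0 ->
  \det (1%:M - th1 ^t* *m invmx alpha *m th1) != 0 ->
  ~ neg_semidef (th1 ^t* *m invmx alpha *m th1) ->
  ~ exists u : R -> R -> 'M[R[i]]_m,
      (forall x t, 0 <= x -> 0 <= t -> (u x t) ^t* = u x t) /\
      [/\ kdv_solution u,
          [/\ quarter_plane_bounded u,
              forall z : R[i], quarter_plane_C1 (fun x t => coefG (u x t) z) &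
              forall z : R[i], quarter_plane_C1 (fun x t =>
                coefF (u x t) (dx u x t) (dx (dx u) x t) z)],
          (forall x, 0 <= x -> u x 0 = triple_fun alpha th1 0 x) /\
          (forall t, 0 <= t -> u 0 t = 0 /\ dx (dx u) 0 t = 0) &
          exists M : R -> R[i] -> 'M[R[i]]_m,
            (forall t, 0 <= t -> is_weyl_function (u^~ t) (M t)) /\
            (forall z : R[i], 0 < complex.Im z ->
              M t z @[t --> +oo] -->
                (('i%C * sqrtc z - 1) / ('i%C * sqrtc z + 1))%:M)].
Proof.
move=> _ _ /esym alphaH tht deta _ _ nneg [u [uh [kdv [[K ub] GC FC] [u0 ubd] [M [MW Mlim]]]]].
have uK x t : 0 <= x -> 0 <= t -> forall i j, `|Re (u x t i j)| <= K /\ `|Im (u x t i j)| <= K.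
  by move=> x0 t0 i j; apply: mx_entry_le; exact: ub.
have [z [c [a0 b0 ab pos]]] := sector_contradiction alphaH tht deta nneg.
(* Fundamental solutions are chosen time by time; negative times get the default 0. *)
have /choice[Psi HPsi] : forall t, exists P : R -> 'M[R[i]]_(m + m), 0 <= t ->
  [/\ fundamental_solution (u^~ t) z P,
    forall c x, 0 <= x ->
      0 <= wr (P x *m (T2 m *m col_mx (- 'i%C *: (M t z *m c)) c)) &
    forall y B, sol (u^~ t) z y -> (forall x, 0 <= x -> B <= wr (y x)) ->
      exists c, y 0 = T2 m *m col_mx (- 'i%C *: (M t z *m c)) c].
  move=> t; have [t0|t0] := leP 0 t; last by exists (fun=> 0).
  have vh x : 0 <= x -> (u x t) ^t* = u x t by move=> x0; exact: uh.
  have vK x (x0 : 0 <= x) := uK x t x0 t0.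
  by have [P HP] := weyl_char vh vK b0 (MW t t0); exists P.
pose F t := coefF (u 0 t) (dx u 0 t) (dx (dx u) 0 t) z.
have Fc : mcont F.
  move=> t t0; have [/(_ 0 t (lexx _) t0)[_ h] _ _] := FC z.
  exact: HD_cont (HD_hl h).
pose y0 := col_mx c (('i%C * sqrtc z) *: c + th1 ^t* *m (invmx (alpha - z%:M) *m (th1 *m c))).
have [Y0 Y00 Y0D] := linear_ode y0 Fc.
have PsiF t (t0 : 0 <= t) : fundamental_solution (u^~ t) z (Psi t) by have [] := HPsi t t0.
(* The explicit solution has [wr] bounded below, so its initial value [y0] is one of those provided
   by the Weyl function at time 0, for which [wr] is nonnegative. *)
have wr0 x : 0 <= x -> 0 <= wr (Psi 0 x *m Y0 0).
  move=> x0; have [y [B [ys yB yE]]] := triple_weyl th1 c alphaH b0.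
  have ys' : sol (u^~ 0) z y by move=> s s0; rewrite u0//; exact: ys.
  have [_ h1 h2] := HPsi 0 (lexx 0).
  have [c' E] := h2 _ _ ys' yB.
  by rewrite Y00 /y0 -yE E; exact: h1.
have wrt := evo_pos b0 uh kdv uK (GC z) PsiF Y0D wr0.
have [t t0 neg] := eventually_neg b0 (Mlim z b0).
have [_ _ h2] := HPsi t t0.
have Ysol : sol (u^~ t) z (fun x => Psi t x *m Y0 t) by exact: sol_fund (PsiF t t0).
(* The evolved solution has [wr >= 0], so its initial value [Y0 t] is expressed by [M t], which is
   where the limit of the Weyl functions enters. *)
have [ct Et] := h2 _ 0 Ysol (fun x x0 => wrt x t x0 t0).
rewrite (PsiF t t0).1 mul1mx in Et.
have hp s : 0 <= s -> (dx u 0 s) ^t* = dx u 0 s.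
  by move=> s0; exact: (dx_herm uh kdv).
have YD s : 0 <= s -> HD Y0 s (coefF 0 (dx u 0 s) 0 z *m Y0 s).
  by move=> s0; have := Y0D s s0; rewrite /F (ubd s s0).1 (ubd s s0).2.
have := rotated_monotone a0 b0 ab hp YD t0.
rewrite Y00 /y0 col_mxKu col_mxKd => /le_trans /(_ (neg _ _ Et)).
by rewrite leNgt pos.
Qed.
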